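(* Let $Q$, $P$, Penrose tilings (that is, legal double hexagon tilings), Taylor-Socolar tilings, and non-singularity be as defined in the context. Penrose tilings are normalized so that their small hexagons are the Voronoi cells of $Q$ (so the centres of their double hexagon tiles form a coset $c+3P$, $c\in Q$), and Taylor-Socolar tilings have as tiles the Voronoi cells of $Q$. (i) Non-singular Taylor-Socolar tilings and non-singular Penrose tilings are aperiodic (they are invariant under no non-zero translation). (ii) Given a non-singular Taylor-Socolar tiling $\mathcal{S}$ on $Q$, one can build in a canonical way three different non-singular Penrose tilings $\mathcal{D}_c$, one for each of the three cosets $c+3P$ of $Q$ modulo $3P$: the double hexagon tiles of $\mathcal{D}_c$ are centred at the points of $c+3P$, and the tiling by small hexagons (inner and corner hexagons) of $\mathcal{D}_c$, with its black markings, is the hexagonal tiling $\mathcal{S}$ with its black markings. Moreover this uses only local information: there are a radius $R>0$ and a rule, independent of $\mathcal{S}$, $c$ and $x$, such that for every $x\in c+3P$ the double hexagon tile (with all its arrows) of $\mathcal{D}_c$ at $x$ is determined, up to the translation by $x$, by this rule from the $x$-centred translate of the patch of $\mathcal{S}$ within distance $R$ of $x$. (iii) Given a non-singular Penrose tiling $\mathcal{D}$ whose double hexagon tiles are centred on a coset $c+3P$, there is a unique $Q$-nested triangulation formed by the decorations of its inner and corner hexagons; that is, there is a unique element $\mathbf{q}=(L_k)_{k\ge 0}$ of $\varprojlim_k Q/2^kQ$ such that for each $k\ge 0$ the set of vertices of the triangles of side length $2^k$ in the arrangement formed by these decorations is the coset $L_k$ of $2^kQ$. This nested triangulation gives a unique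 non-singular Taylor-Socolar tiling on $Q$, i.e. there is exactly one non-singular Taylor-Socolar tiling on $Q$ whose black markings are those of the small hexagons of $\mathcal{D}$. This construction is not local: there is no radius $R>0$ such that, for all non-singular Penrose tilings $\mathcal{D}$ and all $y\in Q$, the Taylor-Socolar tile at $y$ is determined, up to the translation by $y$, by the $y$-centred translate of the patch of $\mathcal{D}$ within distance $R$ of $y$.
   Context: Lattices. $Q=\mathbb{Z}a_1+\mathbb{Z}a_2\subset\mathbb{R}^2$ with $a_1=(1,0)$, $a_2=(-\tfrac12,\tfrac{\sqrt3}{2})$; $P=\mathbb{Z}w_1+\mathbb{Z}w_2$ with $w_1=\tfrac23a_1+\tfrac13a_2$, $w_2=\tfrac13a_1+\tfrac23a_2$. Then $P\supset Q\supset 3P$, each inclusion of index 3. The w-directions are $\pm w_1,\pm w_2,\pm(w_2-w_1)$. Well-arrowed hexagons. An arrowed hexagon is a regular hexagon each of whose sides carries a direction (an arrow). It is well-arrowed if its sides can be labelled $e_0,\dots,e_5$ in counterclockwise order so that the arrows on $e_0,e_1,e_4$ run counterclockwise around the hexagon and those on $e_2,e_3,e_5$ run clockwise. Thus the arrows on the opposite sides $e_0,e_3$ are parallel and point in the same direction (this direction is the orientation of the hexagon), while those on $e_1,e_2$ point to their common vertex, and likewise those on $e_4,e_5$. Three alternate sides are of mixed type if their arrows are not all counterclockwise and not all clockwise; if three alternate sides of a hexagon carry arrows of mixed type there is exactly one way to arrow the other three sides so that the hexagon is well-arrowed. An edge-to-edge tiling of the plane by congruent well-arrowed regular hexagons is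 well-matched if on every common edge the arrows of the two adjacent hexagons coincide. Double hexagon tiles. A double hexagon tile is a well-arrowed (outer, or large) hexagon containing a concentric well-arrowed (inner) hexagon of one third the area, rotated by $90^\circ$ (equivalently $30^\circ$) relative to the outer one as a shape, whose orientation is at right angles to the orientation of the outer one. In an edge-to-edge tiling of the plane by double hexagon tiles (with the outer hexagons as tiles), at every vertex $v$ the three edges, one from each of the three inner hexagons in the tiles at $v$, that are closest to $v$ are three alternate edges of a regular hexagon centred at $v$, called a corner hexagon. The inner hexagons together with the corner hexagons (the small hexagons) form a hexagonal tiling of the plane. The tiling by double hexagons is legal if: its outer hexagons are well-matched; at each corner hexagon the three arrows coming from the inner hexagons are of mixed type (so the corner hexagon is completed uniquely to a well-arrowed one); and the resulting arrowed tiling by small hexagons is well-matched. Legal double hexagon tilings are also called Penrose (hexagonal) tilings. Lengths are normalized so that centres of adjacent small hexagons are at distance $1$. Black markings. Fix a small $\varepsilon>0$. In a well-arrowed hexagon with sides labelled $e_0,\dots,e_5$ in counterclockwise order so that the arrows on $e_0,e_1,e_4$ run counterclockwise around the hexagon and those on $e_2,e_3,e_5$ run clockwise, mark on each side the point at distance $\varepsilon$ from its midpoint in the direction of the arrow. The stripe is the straight segment joining the marked points on $e_0$ and $e_3$. The two corner markings are the two bent lines with a $60^\circ$ angle that join the marked points of $e_1,e_2$, respectively of $e_4,e_5$, and consist of two segments perpendicular to the sides at the marked points. In a well-matched tiling these markings join to continuous paths. Triangles. Suppose all paths of the small hexagons are boundaries of equilateral triangles (path triangles). The expanded triangle of a path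 triangle is the equilateral triangle whose vertices are the centres of the three small hexagons containing its three corners. A triangle $S$ is nested in a triangle $T$ if the vertices of $S$ are the midpoints of the sides of $T$; the three triangles, other than $S$, into which $S$ divides $T$ are then called corner triangles. The arrangement $\mathcal{T}$ of expanded triangles consists of the expanded path triangles together with all corner triangles obtained (repeatedly) from expanded path triangles $S$ nested in triangles $T$ of $\mathcal{T}$. Sizes of triangles are side lengths of expanded triangles. Taylor-Socolar tilings. A Taylor-Socolar tile is a regular hexagon with the following decoration, placed up to rotation: a stripe and two corner markings, and three coloured diameters (long diagonals, joining opposite vertices). Here the stripe and the two corner markings are those of a well-arrowed hexagon: with the sides of the tile labelled $e_0,\dots,e_5$ in counterclockwise order, mark on each side the point at distance $\varepsilon$ from its midpoint, displaced in the counterclockwise direction around the hexagon on $e_0,e_1,e_4$ and in the clockwise direction on $e_2,e_3,e_5$; the stripe is the straight segment joining the marked points on $e_0$ and $e_3$, and the two corner markings are the two bent lines with a $60^\circ$ angle that join the marked points of $e_1,e_2$, respectively of $e_4,e_5$, and consist of two segments perpendicular to the sides at the marked points. When the stripe is horizontal, the diameter from upper left to lower right is entirely red, the diameter from upper right to lower left is entirely blue, and the diameter perpendicular to the stripe is half red and half blue, the colour changing where it crosses the stripe. There are two prototiles, according to whether the stripe is displaced towards the red or towards the blue end of the mixed diameter. A Taylor-Socolar tiling on $Q$ is a tiling by rotated copies of these tiles, the tiles being the Voronoi cells of $Q$, such that (RT1) the black lines (stripes and corner markings) join continuously when tiles abut; and (RT2) the ends of the diameters of two tiles that are separated by an edge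 of another tile are of opposite colours. The notions of paths, expanded triangles and arrangement $\mathcal{T}$ apply to its black markings exactly as for small hexagons. Non-singularity. A Penrose tiling, respectively a Taylor-Socolar tiling, is non-singular if (N1) every path formed by the black markings of its small hexagons, respectively of its tiles, is the boundary of an equilateral triangle (there is no path extending infinitely in some direction); and (N2) there is no line $\ell$ in a w-direction such that $\ell$ meets $Q$ and for every $k\ge0$ contains a vertex of a triangle of side length $2^k$ of $\mathcal{T}$. In terms of the corresponding element $\mathbf{q}\in\varprojlim_k Q/2^kQ$, with $\overline{\mathbb{Z}_2}$ the 2-adic integers, these conditions read: for all $x\in Q$, $\mathbf{q}\notin x+\overline{\mathbb{Z}_2}\,a$ for $a\in\{a_1,a_2,a_1+a_2\}$ and $\mathbf{q}\notin x+\overline{\mathbb{Z}_2}\,3w$ for $w\in\{w_1,w_2,w_2-w_1\}$. *)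

(* Defs.v *)
From Stdlib Require Import Relation_Operators.
From mathcomp Require Import all_boot all_order all_algebra.
From mathcomp Require Import boolp classical_sets reals.

Set Implicit Arguments.
Unset Strict Implicit.
Unset Printing Implicit Defensive.

Import Order.TTheory GRing.Theory Num.Theory.

Local Open Scope classical_set_scope.
Local Open Scope ring_scope.

(* (m, n) stands for m a1 + n a2. *)
Definition Qlat : Type := (int * int)%type.

(* The six shortest vectors of Q in counterclockwise order, starting with a1:
   a1, a1 + a2, a2, - a1, - a1 - a2, - a2; [u k] has argument k * 60 degrees. *)
Definition u (k : 'Z_6) : Qlat :=
  nth 0 [:: (1, 0); (1, 1); (0, 1); (-1, 0); (-1, -1); (0, -1)] k.

(* 3 w1 = 2 a1 + a2 and 3 w2 = a1 + 2 a2 generate 3P. *)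
Definition coset3P (c : Qlat) : set Qlat :=
  [set x | exists m n : int, x = c + (((2, 1) : Qlat) *~ m + ((1, 2) : Qlat) *~ n)].

Definition coset2Q (k : nat) (c : Qlat) : set Qlat :=
  [set x | exists z : Qlat, x = c + z *+ (2 ^ k)].

(* Elements of the inverse limit of the Q / 2^k Q, as decreasing sequences of
   cosets. *)
Definition inv_lim_Q (q : nat -> set Qlat) : Prop :=
  (forall k, exists c, q k = coset2Q k c) /\ (forall k, q k.+1 `<=` q k).

(* [R^o] is R as a module over itself, so that the plane is an R-module. *)
Notation plane R := (R^o * R^o)%type.

Section Geometry.
Variable R : realType.

Implicit Types (p q a b c : plane R) (x y z : Qlat) (k : 'Z_6).

Definition a1 : plane R := (1, 0).
Definition a2 : plane R := (- 2^-1, Num.sqrt 3 / 2).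
Definition w1 : plane R := (2 / 3) *: a1 + (1 / 3) *: a2.
Definition w2 : plane R := (1 / 3) *: a1 + (2 / 3) *: a2.

Definition pos x : plane R := x.1%:~R *: a1 + x.2%:~R *: a2.

Definition dot p q : R := p.1 * q.1 + p.2 * q.2.
Definition dist p q : R := Num.sqrt (dot (p - q) (p - q)).

Definition segment p q : set (plane R) :=
  [set r | exists t : R, 0 <= t <= 1 /\ r = (1 - t) *: p + t *: q].

Definition line p d : set (plane R) := [set r | exists t : R, r = p + t *: d].

Definition equilateral a b c : Prop :=
  [/\ a <> b, dist a b = dist b c & dist b c = dist c a].

Definition triangle_boundary a b c : set (plane R) :=
  segment a b `|` segment b c `|` segment c a.

Definition voronoi x : set (plane R) :=
  [set p | forall y, dist p (pos x) <= dist p (pos y)].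

(* The Voronoi cell of x has vertices [pos x + vert k].  Its side k runs
   counterclockwise from vertex k - 1 to vertex k; it is shared with the cell of
   [x + u k], of which it is side k + 3. *)
Definition vert k : plane R := 3^-1 *: pos (u k + u (k + 1)).

Definition side_mid k : plane R := 2^-1 *: pos (u k).

(* Sides have length 1 / sqrt 3, so these are unit vectors. *)
Definition side_dir k : plane R := Num.sqrt 3 *: (vert k - vert (k - 1)).

End Geometry.

(* With the sides of a regular hexagon numbered counterclockwise by Z/6, a
   well-arrowed hexagon is given by the number s of its side e_0; e_j is then
   side s + j.  No rotation preserves the arrows, so s is unique. *)
Notation hexagon := 'Z_6 (only parsing).

(* Does the arrow on side k run counterclockwise round the hexagon? *)
Definition ccw (s : hexagon) (k : 'Z_6) : bool := k - s \in [:: 0; 1; 4].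

(* An arrow running counterclockwise round one of the two hexagons that share a
   side runs clockwise round the other. *)
Definition well_matched (h : Qlat -> hexagon) : Prop :=
  forall x k, ccw (h x) k = ~~ ccw (h (x + u k)) (k + 3).

Variant marking := Stripe | Corner12 | Corner45.

Definition mk_ends (s : hexagon) (m : marking) : 'Z_6 * 'Z_6 :=
  match m with
  | Stripe => (s, s + 3)
  | Corner12 => (s + 1, s + 2)
  | Corner45 => (s + 4, s + 5)
  end.

Section Markings.
Variables (R : realType) (eps : R).

(* Relative to the centre of the hexagon. *)
Definition marked_point (s : hexagon) (k : 'Z_6) : plane R :=
  side_mid R k + (if ccw s k then eps else - eps) *: side_dir R k.

Definition bent_line (s : hexagon) (i j : 'Z_6) : set (plane R) :=
  [set p | exists c : plane R,
     [/\ dot (c - marked_point s i) (side_dir R i) = 0,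
         dot (c - marked_point s j) (side_dir R j) = 0
       & (segment (marked_point s i) c `|` segment c (marked_point s j)) p]].

Definition mk_set (s : hexagon) (m : marking) : set (plane R) :=
  let: (i, j) := mk_ends s m in
  match m with
  | Stripe => segment (marked_point s i) (marked_point s j)
  | _ => bent_line s i j
  end.

Variable h : Qlat -> hexagon.

Definition placed_mk (m : Qlat * marking) : set (plane R) :=
  [set p | mk_set (h m.1) m.2 (p - pos R m.1)].

(* In a well-matched tiling the two marked points on a common side coincide, so
   the markings of adjacent hexagons that end on that side join up there. *)
Definition joined (m m' : Qlat * marking) : Prop :=
  exists k : 'Z_6,
    [/\ m'.1 = m.1 + u k,
        k \in [:: (mk_ends (h m.1) m.2).1; (mk_ends (h m.1) m.2).2]
      & k + 3 \in [:: (mk_ends (h m'.1) m'.2).1; (mk_ends (h m'.1) m'.2).2]].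

Definition mk_path (m : Qlat * marking) : set (plane R) :=
  \bigcup_(m' in [set m' | clos_refl_trans _ joined m m']) placed_mk m'.

Definition path_triangle (a b c : plane R) : Prop :=
  equilateral a b c /\ exists m, mk_path m = triangle_boundary a b c.

Definition expanded (x y z : Qlat) : Prop :=
  exists a b c : plane R,
    [/\ path_triangle a b c, voronoi x a, voronoi y b & voronoi z c].

Definition midpoint (p x y : Qlat) : Prop := p *+ 2 = x + y.

(* Triangles are given by their vertices in any order. *)
Definition nested (p q r x y z : Qlat) : Prop :=
  [/\ midpoint p y z, midpoint q z x & midpoint r x y].

Inductive arrangement : Qlat -> Qlat -> Qlat -> Prop :=
| arr_path x y z : expanded x y z -> arrangement x y z
| arr_corner1 x y z p q r : arrangement x y z -> expanded p q r ->
    nested p q r x y z -> arrangement x r q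
| arr_corner2 x y z p q r : arrangement x y z -> expanded p q r ->
    nested p q r x y z -> arrangement r y p
| arr_corner3 x y z p q r : arrangement x y z -> expanded p q r ->
    nested p q r x y z -> arrangement q p z.

(* [arrangement] is invariant under permutations of the vertices, so it is
   enough to look at first vertices. *)
Definition level_vertices (k : nat) : set Qlat :=
  [set x | exists y z, arrangement x y z /\ dist (pos R x) (pos R y) = 2 ^+ k].

Definition N1 : Prop :=
  forall m, exists a b c : plane R,
    equilateral a b c /\ mk_path m = triangle_boundary a b c.

Definition N2 : Prop :=
  ~ exists (x : Qlat) (w : plane R),
      (w = w1 R \/ w = w2 R \/ w = w2 R - w1 R) /\
      forall k, exists y, level_vertices k y /\ line (pos R x) w (pos R y).

Definition nonsingular : Prop := N1 /\ N2.

End Markings.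

(* A tiling by translates of decorated hexagons of type T, centred at points of
   Q: the tile at each centre, and None at points that are not centres. *)
Definition tiling (T : Type) : Type := Qlat -> option T.

Section Tilings.
Variables (R : realType) (T : Type).

(* The patch of D within distance r of x, translated by - x. *)
Definition patch (r : R) (D : tiling T) (x : Qlat) : tiling T :=
  fun y => if dist (pos R y) 0 <= r then D (x + y) else None.

Definition placed (D : tiling T) (p : plane R) (t : T) : Prop :=
  exists x, p = pos R x /\ D x = Some t.

Definition aperiodic (D : tiling T) : Prop :=
  forall v : plane R,
    (forall p t, placed D (p + v) t <-> placed D p t) -> v = 0.

End Tilings.

(* Side k of the outer hexagon of the tile at x runs counterclockwise from
   [x + u k] to [x + u (k + 1)]; it is shared with the outer hexagon of the tile
   at [x + u k + u (k + 1)], of which it is side k + 3.  The inner hexagon is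
   the Voronoi cell of x. *)
Record dhex := DHex { outer : hexagon; inner : hexagon }.

(* The arrow on e_0 is the orientation of a well-arrowed hexagon. *)
Definition right_angled (R : realType) (t : dhex) : Prop :=
  dot (pos R (u (outer t + 1)) - pos R (u (outer t)))
      (side_dir R (inner t)) = 0.

Definition outer_matched (D : tiling dhex) : Prop :=
  forall x k t t', D x = Some t -> D (x + u k + u (k + 1)) = Some t' ->
    ccw (outer t) k = ~~ ccw (outer t') (k + 3).

(* The sides k of a corner hexagon, centred at y, that belong to inner hexagons
   are those with a tile at [y + u k]; side k then has a counterclockwise arrow
   (as seen from y) iff the arrow is clockwise round that inner hexagon. *)
Definition corners_mixed (D : tiling dhex) : Prop :=
  forall y, D y = None -> forall b : bool, exists k t,
    D (y + u k) = Some t /\ ~~ ccw (inner t) (k + 3) = b.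

(* h is the tiling by small hexagons of D: inner hexagons, and corner hexagons
   completing the three arrows that come from inner ones. *)
Definition small_hexagons (D : tiling dhex) (h : Qlat -> hexagon) : Prop :=
  (forall x t, D x = Some t -> h x = inner t) /\
  (forall y, D y = None -> forall k t, D (y + u k) = Some t ->
     ccw (h y) k = ~~ ccw (inner t) (k + 3)).

Record penrose (R : realType) (c : Qlat) (D : tiling dhex) : Prop := {
  penrose_centres : forall x, coset3P c x <-> exists t, D x = Some t;
  penrose_tiles : forall x t, D x = Some t -> right_angled R t;
  penrose_outer : outer_matched D;
  penrose_mixed : corners_mixed D;
  penrose_small : exists h, small_hexagons D h /\ well_matched h
}.

Definition nonsingular_penrose (R : realType) (eps : R) (c : Qlat)
    (D : tiling dhex) : Prop :=
  penrose R c D /\ exists h, small_hexagons D h /\ nonsingular eps h.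

Record ts_tile := TSTile { black : hexagon; towards_red : bool }.

(* Is the end at vertex k of a diameter red?  If [black t = 0] then the stripe is
   horizontal and displaced upwards, vertices 0, 1, 2 are the upper right, the top
   and the upper left one, and vertex k + 3 is opposite to vertex k. *)
Definition red (t : ts_tile) (k : 'Z_6) : bool :=
  nth false
    [:: false; towards_red t; true; false; ~~ towards_red t; true]
    (k - black t)%R.

Section TaylorSocolar.
Variables (R : realType) (eps : R) (S : Qlat -> ts_tile).

Definition RT1 : Prop :=
  forall x k,
    pos R x + marked_point eps (black (S x)) k =
    pos R (x + u k) + marked_point eps (black (S (x + u k))) (k + 3).

(* Side k of the tile at y joins its vertices k - 1 and k.  These are vertex k + 1
   of the tile at [y + u (k - 1)] and vertex k + 4 of the tile at
   [y + u (k + 1)], the two tiles that this side separates. *)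
Definition RT2 : Prop :=
  forall y k,
    red (S (y + u (k - 1))) (k + 1) = ~~ red (S (y + u (k + 1))) (k + 4).

Definition nonsingular_ts : Prop :=
  [/\ RT1, RT2 & nonsingular eps (fun x => black (S x))].

End TaylorSocolar.

Definition full_tiling (T : Type) (S : Qlat -> T) : tiling T := fun x => Some (S x).

(* Main.v *)
Require Import Defs.
From Stdlib Require Import Relation_Operators.
From mathcomp Require Import all_boot all_order all_algebra.
From mathcomp Require Import ring lra zify.
From mathcomp Require Import boolp classical_sets reals.

(** The sides of the small hexagons are dual to the edges of the triangular
    lattice Q, and an arrow says to which side of its edge the black line is
    displaced.  Every edge therefore has exactly one direction in which the line
    runs displaced to the left, and a black path is a chain of edges directed in
    this way.  Condition (N1) says that these chains are the boundaries of
    equilateral triangles with vertices in Q ([N1_corners_close],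
    [corners_close_N1]).

    A double hexagon tiling is the same thing as a tiling by small hexagons
    together with a Taylor-Socolar colouring of the hexagons centred on one coset
    c + 3P only: a tile is right-angled iff its outer hexagon is one of two
    hexagons determined by the inner one, and the arrows of these two are the
    colours of the ends of the diameters of the two tiles with that stripe
    ([ccw_dtile]).  The outer hexagons are well-matched iff (RT2) holds along
    c + 3P.  Hence a Penrose tiling is obtained from a Taylor-Socolar tiling by
    forgetting the colours off c + 3P, tile by tile; this is part (ii).

    Each hexagon is a corner of two path triangles.  The key fact is
    [all_equal_corners]: if one of the two has side 1 then so has the other.  It
    does not follow from (N1): [periodic_start] is an arrangement of path
    triangles of sides 1 and 2 with period lattice 3P.  But a hexagon violating it
    forces two stripes to be equal in a way that the colour rule on a single coset
    of 3P already forbids ([no_large_outside]).  Granted this, the hexagons that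
    are corners of no triangle of side 1 are centred on a coset l + 2Q, and all
    others have their stripe along an edge of that sublattice
    ([deflation_centre]).  The hexagons on l + 2Q again form a tiling with all the
    properties used, so the argument can be repeated, and produces cosets L_k of
    2^k Q ([nest]).

    The rest is read off from these cosets.  The path triangles with a corner at x
    have side 2^k, where L_k is the last level containing x ([nest_tri]), so L_k
    is the set of vertices of the triangles of side 2^k ([level_verticesE]).  A
    period has to preserve every L_k, hence is zero ([nest_aperiodic]).  On a line
    in a w-direction the hexagons off the deepest level met by the line have their
    stripe perpendicular to it and transmit the colours, while those on that level
    are alternately red and blue.  By (N2) the deepest level exists, so exactly one
    colouring is possible ([colour_RT2], [RT2_uniq]).

    The colour of a hexagon thus depends on the deepest level met by a line, which
    may be met only far away.  To make this a proof of non-locality, take a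
    non-singular tiling, whose existence comes from a q with coordinates in the
    rationals of denominator 7 ([model_exists]), and two hexagons with equal black
    markings and opposite colours ([two_points]).  Inflating the tiling n times
    keeps these two hexagons, while the patches around them, with the colours on
    any coset of 3P not containing the centre, agree up to a radius growing like
    2^n ([agree_inflate]). *)

Set Implicit Arguments.
Unset Strict Implicit.
Unset Printing Implicit Defensive.

Import Order.TTheory GRing.Theory Num.Theory.

Local Open Scope ring_scope.

(** * Directions and lattice vectors *)

Lemma Z6_ind (P : 'Z_6 -> Prop) : P 0 -> P 1 -> P 2 -> P 3 -> P 4 -> P 5 -> forall k, P k.
Proof.
move=> p0 p1 p2 p3 p4 p5 k.
have : k \in [:: 0; 1; 2; 3; 4; 5] by case: k => [[|[|[|[|[|[|i]]]]]] Hi].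
by rewrite !inE; do 5?[case/orP=> [/eqP-> //|]]; move=> /eqP->.
Qed.

Lemma u3 k : u (k + 3) = - u k.
Proof. by move: k; apply: Z6_ind. Qed.
Lemma u2 k : u (k + 2) = u (k + 1) - u k.
Proof. by move: k; apply: Z6_ind. Qed.
Lemma u4 k : u (k + 4) = - u (k + 1).
Proof. by move: k; apply: Z6_ind. Qed.
Lemma u5 k : u (k + 5) = u k - u (k + 1).
Proof. by move: k; apply: Z6_ind. Qed.

Lemma ccwD k a b : ccw (k + a) (k + b) = ccw a b.
Proof. by rewrite /ccw opprD addrACA subrr add0r. Qed.

Lemma ccw_true s k : ccw s k -> [\/ s = k, s = k + 5 | s = k + 2].
Proof.
have : ccw s k ==> [|| s == k, s == k + 5 | s == k + 2].
  by move: s k; do 2!apply: Z6_ind; vm_compute.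
by move=> /implyP + H => /(_ H) /or3P[] /eqP->; [apply: Or31|apply: Or32|apply: Or33].
Qed.

(** Normal forms for the sums of directions that occur in chains of neighbours. *)
Lemma Z6E : ((forall k : 'Z_6, (k + 1 + 1 = k + 2)%R) *
  (forall k : 'Z_6, (k + 1 + 2 = k + 3)%R) *
  (forall k : 'Z_6, (k + 1 + 3 = k + 4)%R) *
  (forall k : 'Z_6, (k + 1 + 4 = k + 5)%R) *
  (forall k : 'Z_6, (k + 1 + 5 = k)%R) *
  (forall k : 'Z_6, (k + 2 + 1 = k + 3)%R) *
  (forall k : 'Z_6, (k + 2 + 2 = k + 4)%R) *
  (forall k : 'Z_6, (k + 2 + 3 = k + 5)%R) *
  (forall k : 'Z_6, (k + 2 + 4 = k)%R) *
  (forall k : 'Z_6, (k + 2 + 5 = k + 1)%R) *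
  (forall k : 'Z_6, (k + 3 + 1 = k + 4)%R) *
  (forall k : 'Z_6, (k + 3 + 2 = k + 5)%R) *
  (forall k : 'Z_6, (k + 3 + 3 = k)%R) *
  (forall k : 'Z_6, (k + 3 + 4 = k + 1)%R) *
  (forall k : 'Z_6, (k + 3 + 5 = k + 2)%R) *
  (forall k : 'Z_6, (k + 4 + 1 = k + 5)%R) *
  (forall k : 'Z_6, (k + 4 + 2 = k)%R) *
  (forall k : 'Z_6, (k + 4 + 3 = k + 1)%R) *
  (forall k : 'Z_6, (k + 4 + 4 = k + 2)%R) *
  (forall k : 'Z_6, (k + 4 + 5 = k + 3)%R) *
  (forall k : 'Z_6, (k + 5 + 1 = k)%R) *
  (forall k : 'Z_6, (k + 5 + 2 = k + 1)%R) *
  (forall k : 'Z_6, (k + 5 + 3 = k + 2)%R) *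
  (forall k : 'Z_6, (k + 5 + 4 = k + 3)%R) *
  (forall k : 'Z_6, (k + 5 + 5 = k + 4)%R))%type.
Proof. by repeat (split; last (by move=> k; apply/eqP; move: k; apply: Z6_ind; vm_compute)); move=> k; apply/eqP; move: k; apply: Z6_ind; vm_compute. Qed.

Lemma Qext (x y : Qlat) : x.1 = y.1 -> x.2 = y.2 -> x = y.
Proof. by case: x y => [? ?] [? ?] /= -> ->. Qed.

Lemma c1D (x y : Qlat) : (x + y).1 = x.1 + y.1. Proof. by []. Qed.
Lemma c2D (x y : Qlat) : (x + y).2 = x.2 + y.2. Proof. by []. Qed.
Lemma c1N (x : Qlat) : (- x).1 = - x.1. Proof. by []. Qed.
Lemma c2N (x : Qlat) : (- x).2 = - x.2. Proof. by []. Qed.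
Lemma c1M (x : Qlat) n : (x *+ n).1 = x.1 *+ n. Proof. exact: (raddfMn fst). Qed.
Lemma c2M (x : Qlat) n : (x *+ n).2 = x.2 *+ n. Proof. exact: (raddfMn snd). Qed.
Lemma c1Z (x : Qlat) m : (x *~ m).1 = x.1 *~ m. Proof. exact: (raddfMz fst). Qed.
Lemma c2Z (x : Qlat) m : (x *~ m).2 = x.2 *~ m. Proof. exact: (raddfMz snd). Qed.
Definition coordE := (c1D, c2D, c1N, c2N, c1M, c2M, c1Z, c2Z).

(** Vector identities: the six directions at a hexagon are combinations of two
    consecutive ones. *)
Ltac qvec := rewrite ?expnS ?Z6E ?u5 ?u4 ?u3 ?u2; apply: Qext; rewrite ?coordE; ring.

Lemma ccw_false s k : ~~ ccw s k -> [\/ s = k + 1, s = k + 3 | s = k + 4].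
Proof.
have : ~~ ccw s k ==> [|| s == k + 1, s == k + 3 | s == k + 4].
  by move: s k; do 2!apply: Z6_ind; vm_compute.
by move=> /implyP + H => /(_ H) /or3P[] /eqP->; [apply: Or31|apply: Or32|apply: Or33].
Qed.

Lemma ccw0 k b : ccw k (k + b) = ccw 0 b.
Proof. by rewrite -{1}[k]addr0 ccwD. Qed.
Lemma ccwa k a : ccw (k + a) k = ccw a 0.
Proof. by rewrite -{2}[k]addr0 ccwD. Qed.
Lemma ccwkk k : ccw k k.
Proof. by rewrite -[k]addr0 ccwD. Qed.
Definition ccwE := (ccwD, ccw0, ccwa, ccwkk).

Definition same3 (c x : Qlat) : bool := (3 %| x.1 + x.2 - c.1 - c.2)%Z.

Lemma same3P c x : coset3P c x <-> same3 c x.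
Proof.
split=> [[m [n ->]]|/dvdzP[t Ht]].
  apply/dvdzP; exists (m + n); rewrite !coordE /=; lia.
exists (x.1 - c.1 - t), (x.2 - c.2 - t).
apply: Qext; rewrite !coordE /=; lia.
Qed.

(** * The corners of a hexagon belong to equally small triangles *)

(** The six shortest vectors of 3P; [v j] points to the tile behind vertex j. *)
Definition v (j : 'Z_6) : Qlat := u j + u (j + 1).

(** The black lines on the edges from x in directions j and j + 1 are displaced
    towards each other: x is a corner of a path triangle lying between them. *)
Definition corner (h : Qlat -> hexagon) x j := ccw (h x) j && ~~ ccw (h x) (j + 1).

(** Both sides that start at the corner (x, j) pass straight through the first
    n - 1 hexagons.  On the second side the stripes are read against the
    displacement, hence the shift by 3. *)
Definition straight (h : Qlat -> hexagon) x j n :=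
  (forall i, (0 < i < n)%N -> h (x + u j *+ i) = j /\ h (x + u (j + 1) *+ i) = j + 4).

Definition stops (h : Qlat -> hexagon) x j n :=
  h (x + u j *+ n) <> j /\ h (x + u (j + 1) *+ n) <> j + 4.

Definition triangle_at (h : Qlat -> hexagon) x j n :=
  [/\ (0 < n)%N, corner h x j, straight h x j n & stops h x j n].

(** With [stripes_end], the combinatorial content of (N1). *)
Definition corners_close (h : Qlat -> hexagon) := forall x j, corner h x j -> exists n, triangle_at h x j n.

Definition stripes_end (h : Qlat -> hexagon) := forall x, exists n, h (x - u (h x) *+ n) <> h x.

(** The colour rule on one coset of 3P, the part of it that a double hexagon
    tiling retains. *)
Definition RT2on (c : Qlat) (h : Qlat -> hexagon) (f : Qlat -> bool) :=
  forall x j, same3 c x ->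
    red (TSTile (h x) (f x)) j = ~~ red (TSTile (h (x + v j)) (f (x + v j))) (j + 3).

Lemma redE k f b : red (TSTile k f) (k + b) = red (TSTile 0 f) b.
Proof.
by rewrite /red (_ : k + b - black (TSTile k f) = b - black (TSTile 0 f)) //= addrC addKr subr0.
Qed.

Lemma cornerP h x j : corner h x j <-> h x = j + 5 \/ h x = j + 2.
Proof.
have H s k : (ccw s k && ~~ ccw s (k + 1)) = ((s == k + 5) || (s == k + 2)).
  by move: s k; do 2!apply: Z6_ind; vm_compute.
rewrite /corner H; split; first by case/orP=> /eqP; [left|right].
by case=> ->; rewrite eqxx ?orbT.
Qed.

Lemma Z6_neq (k a b : 'Z_6) : (k + a == k + b) = (a == b).
Proof. exact: (inj_eq (addrI k)). Qed.

Lemma span b (z : Qlat) : exists m n : int, z = u b *~ m + u (b + 1) *~ n.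
Proof.
have S m1 n1 m2 n2 m n : z = ((m1, n1) : Qlat) *~ m + ((m2, n2) : Qlat) *~ n ->
  exists m n : int, z = ((m1, n1) : Qlat) *~ m + ((m2, n2) : Qlat) *~ n by exists m, n.
move: b; apply: Z6_ind.
- apply: (S _ _ _ _ (z.1 - z.2) z.2); apply: Qext; rewrite !coordE /=; lia.
- apply: (S _ _ _ _ z.1 (z.2 - z.1)); apply: Qext; rewrite !coordE /=; lia.
- apply: (S _ _ _ _ z.2 (- z.1)); apply: Qext; rewrite !coordE /=; lia.
- apply: (S _ _ _ _ (z.2 - z.1) (- z.2)); apply: Qext; rewrite !coordE /=; lia.
- apply: (S _ _ _ _ (- z.1) (z.1 - z.2)); apply: Qext; rewrite !coordE /=; lia.
- apply: (S _ _ _ _ (- z.2) z.1); apply: Qext; rewrite !coordE /=; lia.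
Qed.

Section Deflation.
Variables (h : Qlat -> hexagon) (f : Qlat -> bool) (c : Qlat).
Hypotheses (hm : well_matched h) (hc : corners_close h) (he : stripes_end h) (hr : RT2on c h f).

Lemma after_ccw x j : ccw (h x) j -> [\/ h (x + u j) = j, h (x + u j) = j + 1 | h (x + u j) = j + 4].
Proof.
rewrite hm => /ccw_false; rewrite !Z6E => -[] H; rewrite H;
 [apply: Or33|apply: Or31|apply: Or32] => //; exact/eqP.
Qed.

Lemma after_cw x j : ~~ ccw (h x) j ->
  [\/ h (x + u j) = j + 2, h (x + u j) = j + 3 | h (x + u j) = j + 5].
Proof.
rewrite hm negbK => /ccw_true; rewrite !Z6E => -[] ->; [apply: Or32|apply: Or31|apply: Or33] => //.
Qed.

(** The triangle with corner (x, j) has side greater than 1 iff one, or the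
    other, of the neighbours on its sides is a stripe. *)
Lemma large_iff x j : corner h x j -> h (x + u j) = j <-> h (x + u (j + 1)) = j + 4.
Proof.
move=> /hc [n [n0 _ hs [s1 s2]]]; case: n n0 hs s1 s2 => [//|[|n]] _ hs; rewrite ?mulr1n //.
by have := hs 1%N isT; rewrite !mulr1n; case.
Qed.

(** Let w, x be the first two points of a side of a path triangle and let the
    triangle outside that side with corner x have side greater than 1.  Then the
    same situation occurs at w and at the first point of the outer triangle, so
    it occurs in every coset of 3P, and each time two equal stripes follow each
    other along a [v]-direction not perpendicular to them. *)
Lemma no_large_outside x k : h x = k -> corner h (x - u k) k -> h (x + u (k + 4)) <> k + 4.
Proof.
move=> hx cw hz'.
have cx : corner h x (k + 4) by apply/cornerP; rewrite !Z6E; right.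
have hz := proj1 (large_iff cx) hz'; rewrite !Z6E in hz.
have cz' : corner h (x + u (k + 4)) (k + 2) by apply/cornerP; rewrite !Z6E; right.
have e1 : x + u (k + 4) + u (k + 2) = x - u k by qvec.
have hw : h (x - u k) = k + 2.
  have /andP[+ _] := cz'; rewrite hm e1 Z6E.
  by case/cornerP: cw => ->; rewrite ?ccwE.
have := proj1 (large_iff cz'); rewrite e1 !Z6E hw => /(_ erefl) ha.
have := proj1 (large_iff cw); rewrite subrK hx => /(_ erefl) hb.
(* [x], [w] and the first point of the outer triangle are in three different
   cosets of 3P, and each starts a pair of equal consecutive stripes. *)
have clash y j : h y = j + 3 -> h (y + v j) = j + 3 -> same3 c y -> False.
  move=> h1 h2 /(hr j); rewrite h1 h2.
  have -> b : red (TSTile (j + 3) b) j = red (TSTile 0 b) 3.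
    by rewrite -(redE (j + 3)) !Z6E.
  have -> b : red (TSTile (j + 3) b) (j + 3) = red (TSTile 0 b) 0 by rewrite -(redE (j + 3)) addr0.
  by [].
have [s0|s1|s2] : [\/ same3 c x, same3 c (x - u k) | same3 c (x + u (k + 4))].
- have : [|| same3 c x, same3 c (x - u k) | same3 c (x + u (k + 4))].
    rewrite /same3 !coordE; move: k {hx cw hz' cx hz cz' e1 hw ha hb clash}; apply: Z6_ind => /=; lia.
  by case/or3P=> H; [apply: Or31|apply: Or32|apply: Or33].
- apply: (clash x (k + 3)) => //; rewrite !Z6E //.
  by rewrite -[RHS]ha; congr h; rewrite /v; qvec.
- apply: (clash (x - u k) (k + 5)) => //; rewrite !Z6E //.
  by rewrite -[RHS]hz; congr h; rewrite /v; qvec.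
- apply: (clash (x + u (k + 4)) (k + 1)) => //; rewrite !Z6E //.
  by rewrite -[RHS]hb; congr h; rewrite /v; qvec.
Qed.

(** The two triangles with corner x, which lie on either side of the stripe of x,
    are both of side 1 or both larger. *)
Definition equal_corners x :=
  h (x + u (h x + 1)) = h x + 1 <-> h (x + u (h x + 4)) = h x + 4.

(** Along a side, on the inside as on the outside, triangles of side 1 alternate
    with larger ones, since neighbouring triangles on the same side of the line
    share a point. *)
Lemma equal_corners_back x : h (x - u (h x)) = h x -> equal_corners (x - u (h x)) -> equal_corners x.
Proof.
set k := h x => hx' eq'.
have cx j : j = k + 1 \/ j = k + 4 -> corner h x j.
  by move=> H; apply/cornerP; rewrite -/k; case: H => ->; rewrite !Z6E; [left|right].
have cx' j : j = k + 1 \/ j = k + 4 -> corner h (x - u k) j.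
  by move=> H; apply/cornerP; rewrite hx'; case: H => ->; rewrite !Z6E; [left|right].
have e1 : x - u k + u (k + 1) = x + u (k + 2) by qvec.
have e2 : x - u k + u (k + 5) = x + u (k + 4) by qvec.
have a1 := large_iff (cx (k + 1) (or_introl erefl)).
have a4 := large_iff (cx (k + 4) (or_intror erefl)).
have b1 := large_iff (cx' (k + 1) (or_introl erefl)).
have b4 := large_iff (cx' (k + 4) (or_intror erefl)).
rewrite !Z6E ?e1 ?e2 in a1 a4 b1 b4.
(* x and x - u k share the points x + u (k + 2) and x + u (k + 4), whose stripes
   tell which of the two inner, and of the two outer, triangles is larger than 1 *)
have hp : h (x + u (k + 2)) = k + 1 \/ h (x + u (k + 2)) = k + 5.
  have /andP[/after_ccw + _] := cx' (k + 1) (or_introl erefl).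
  have /andP[_ /after_cw] := cx (k + 1) (or_introl erefl).
  by rewrite e1 !Z6E; case=> ->; [| right|left] => // -[] /eqP; rewrite Z6_neq.
have hq : h (x + u (k + 4)) = k + 4 \/ h (x + u (k + 4)) = k + 2.
  have /andP[/after_ccw + _] := cx (k + 4) (or_intror erefl).
  have /andP[_ /after_cw] := cx' (k + 4) (or_intror erefl).
  by rewrite !Z6E e2; case=> ->; [| right|left] => // -[] /eqP; rewrite Z6_neq.
move: eq'; rewrite /equal_corners hx' -/k e1.
have n1 : k + 1 <> k + 5 by apply/eqP; rewrite Z6_neq.
have n2 : k + 4 <> k + 2 by apply/eqP; rewrite Z6_neq.
case: hp hq a1 a4 b1 b4 => [-> [->|->]|-> [->|->]]; intuition congruence.
Qed.

(** Go back along the side through x to its first interior point.  There the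
    inner triangle is squeezed into the corner and has side 1. *)
Lemma all_equal_corners x : equal_corners x.
Proof.
have [n hn] := he x; elim: n x hn => [|n IH] x; first by rewrite mulr0n subr0.
move=> hn; set k := h x.
have e : x - u k - u k *+ n = x - u k *+ n.+1 by qvec.
have [hx'|/eqP hx'] := eqVneq (h (x - u k)) k.
  by apply: equal_corners_back => //; apply: IH; rewrite hx' e.
have cw : corner h (x - u k) k.
  have : ccw (h (x - u k)) k by rewrite hm subrK ccwE.
  by case/ccw_true=> // H; apply/cornerP; [left|right].
have hout := no_large_outside erefl cw.
have hin : h (x + u (k + 1)) <> k + 1.
  have cx : corner h x (k + 1) by apply/cornerP; left; rewrite Z6E.
  rewrite (large_iff cx) !Z6E.
  have := proj1 (large_iff cw); rewrite subrK => /(_ erefl).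
  rewrite (_ : x - u k + u (k + 1) = x + u (k + 2)); last by qvec.
  by move=> -> /eqP; rewrite Z6_neq.
by rewrite /equal_corners -/k; split.
Qed.

(** A corner of two path triangles of side 1. *)
Definition odd_point x := h (x + u (h x + 1)) <> h x + 1.

Lemma small_corner_odd x j : corner h x j -> h (x + u j) <> j -> odd_point x.
Proof.
case/cornerP=> e H; rewrite /odd_point; first by rewrite e Z6E.
by move/(proj1 (all_equal_corners x)); rewrite e Z6E.
Qed.

Lemma odd_small_corner x j : odd_point x -> corner h x j -> h (x + u j) <> j.
Proof.
move=> o /cornerP[] e H; apply: o; first by rewrite e Z6E.
by apply/(proj2 (all_equal_corners x)); rewrite e Z6E.
Qed.

(** Odd, with the stripe in direction a or a + 3. *)
Definition odd_with_stripe x a := odd_point x /\ (h x = a \/ h x = a + 3).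

Lemma odd_with_stripeN x a : odd_with_stripe x a <-> odd_with_stripe x (a + 3).
Proof. by rewrite /odd_with_stripe Z6E; tauto. Qed.

(** The other two vertices of a path triangle of side 1 at an odd point are odd,
    because that triangle is one of their two. *)
Lemma odd_with_stripe_step x a : odd_with_stripe x a -> odd_with_stripe (x + u (a + 1)) (a + 2) /\ odd_with_stripe (x + u (a + 2)) (a + 1).
Proof.
case=> o ha; set j := a + 1.
have cx : corner h x j by apply/cornerP; rewrite !Z6E; case: ha; [left|right].
have sm := odd_small_corner o cx.
have /andP[/after_ccw f1 /after_cw f2] := cx; rewrite ?Z6E in f1 f2.
have {}f1 : h (x + u j) = a + 2 \/ h (x + u j) = a + 5 by case: f1; rewrite ?Z6E; auto.
have {}f2 : h (x + u (a + 2)) = a + 1 \/ h (x + u (a + 2)) = a + 4.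
  case: f2; auto; move=> H; case: sm; apply/(large_iff cx); by rewrite !Z6E.
have e : x + u j + u (a + 3) = x + u (a + 2) by rewrite /j; qvec.
split; (split; last by rewrite !Z6E; tauto).
  apply: (@small_corner_odd _ (a + 3)).
    by apply/cornerP; rewrite !Z6E; tauto.
  by rewrite e; case: f2 => -> /eqP; rewrite Z6_neq.
apply: (@small_corner_odd _ (a + 5)).
  by apply/cornerP; rewrite !Z6E; tauto.
rewrite (_ : x + _ + _ = x); last by qvec.
by case: ha => -> /eqP; rewrite -?[a == _]/(_) ?Z6_neq //; rewrite -{1}[a]addr0 Z6_neq.
Qed.

Lemma odd_with_stripe_back x a : odd_with_stripe x a -> odd_with_stripe (x - u (a + 1)) (a + 2) /\ odd_with_stripe (x - u (a + 2)) (a + 1).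
Proof.
move/odd_with_stripeN/odd_with_stripe_step; rewrite !Z6E u4 u5 u2 => -[/odd_with_stripeN + /odd_with_stripeN].
by rewrite !Z6E (_ : u a - u (a + 1) = - (u (a + 1) - u a)) // opprB.
Qed.

(** Two steps in one direction return to the same class, and the two directions
    available generate Q. *)
Lemma odd_with_stripe_even x a (z : Qlat) : odd_with_stripe x a -> odd_with_stripe (x + z *+ 2) a.
Proof.
have s1 y : odd_with_stripe y a -> odd_with_stripe (y + u (a + 1) *+ 2) a.
  move=> /odd_with_stripe_step[/odd_with_stripe_back[_ /odd_with_stripeN +] _]; rewrite !Z6E.
  by rewrite (_ : _ - _ = y + u (a + 1) *+ 2) //; qvec.
have s2 y : odd_with_stripe y a -> odd_with_stripe (y + u (a + 2) *+ 2) a.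
  move=> /odd_with_stripe_step[_ /odd_with_stripe_step[/odd_with_stripeN + _]]; rewrite !Z6E.
  by rewrite (_ : _ + _ = y + u (a + 2) *+ 2) //; qvec.
have t1 y : odd_with_stripe y a -> odd_with_stripe (y - u (a + 1) *+ 2) a.
  move=> /odd_with_stripe_back[/odd_with_stripe_step[_ /odd_with_stripeN +] _]; rewrite !Z6E.
  by rewrite (_ : _ + _ = y - u (a + 1) *+ 2) //; qvec.
have t2 y : odd_with_stripe y a -> odd_with_stripe (y - u (a + 2) *+ 2) a.
  move=> /odd_with_stripe_back[_ /odd_with_stripe_back[/odd_with_stripeN + _]]; rewrite !Z6E.
  by rewrite (_ : _ - _ = y - u (a + 2) *+ 2) //; qvec.
have S w : (forall y, odd_with_stripe y a -> odd_with_stripe (y + w *+ 2) a) -> (forall y, odd_with_stripe y a -> odd_with_stripe (y - w *+ 2) a) ->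
    forall (m : int) y, odd_with_stripe y a -> odd_with_stripe (y + w *~ m *+ 2) a.
  move=> p1 p2; elim/int_ind => [|n IH|n IH] y ho; first by rewrite mulr0z mul0rn addr0.
  - rewrite (_ : y + _ = y + w *~ n *+ 2 + w *+ 2); last by qvec.
    exact/p1/IH.
  - rewrite (_ : y + _ = y + w *~ (- n%:Z) *+ 2 - w *+ 2); last by qvec.
    exact/p2/IH.
have [m [n ->]] := span (a + 1) z; rewrite Z6E => ho.
rewrite (_ : x + _ = x + u (a + 1) *~ m *+ 2 + u (a + 2) *~ n *+ 2); last by qvec.
by apply: (S _ s2 t2); apply: (S _ s1 t1).
Qed.

(** If the triangle at 0 is larger than 1, the first interior point of its side
    is odd. *)
Lemma odd_exists : exists x a, odd_with_stripe x a.
Proof.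
have [o|no] := pselect (odd_point 0); first by exists 0, (h 0); split=> //; left.
have {}no : h (0 + u (h 0 + 1)) = h 0 + 1 by apply: contrapT.
set k := h 0 in no; exists (0 + u (k + 1)), (k + 1); split; last by left.
have c0 : corner h 0 (k + 1) by apply/cornerP; rewrite Z6E; left.
have cx : corner h (0 + u (k + 1)) (k + 2) by apply/cornerP; rewrite Z6E no; left.
apply: (small_corner_odd cx); move=> /(proj1 (large_iff cx)).
rewrite (_ : _ + _ + _ = 0 + u (k + 1 + 1)); last by qvec.
by rewrite (proj1 (large_iff c0) no) !Z6E -[X in _ = X]addr0 => /eqP; rewrite Z6_neq.
Qed.

(** The odd points are the three non-trivial classes modulo 2Q as seen from l;
    the stripe of each runs along the edge of l + 2Q of which it is the midpoint,
    displaced to the same side as that edge. *)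
Lemma deflation_centre : exists l, forall z j,
  h (l + z *+ 2 + u j) = if ccw (h (l + z *+ 2)) j then j else j + 3.
Proof.
have [x [a ho]] := odd_exists; exists (x + u a) => z j.
have H : odd_with_stripe (x + u a + z *+ 2 + u j) j.
  have [i ->] : exists i, j = a + i by exists (j - a); ring.
  have [p1 p2] := odd_with_stripe_step ho; have [q1 q2] := odd_with_stripe_back ho.
  move: i; apply: Z6_ind.
  - by rewrite addr0 (_ : _ + _ = x + (u a + z) *+ 2); [exact: odd_with_stripe_even|qvec].
  - by rewrite (_ : _ + _ = x + u (a + 2) + (u a + z) *+ 2); [exact: odd_with_stripe_even|qvec].
  - by rewrite (_ : _ + _ = x + u (a + 1) + z *+ 2); [exact: odd_with_stripe_even|qvec].
  - by rewrite -odd_with_stripeN (_ : _ + _ = x + z *+ 2); [exact: odd_with_stripe_even|qvec].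
  - apply/odd_with_stripeN; rewrite Z6E (_ : _ + _ = x - u (a + 2) + z *+ 2); [exact: odd_with_stripe_even|qvec].
  - apply/odd_with_stripeN; rewrite Z6E (_ : _ + _ = x - u (a + 1) + (u a + z) *+ 2); [exact: odd_with_stripe_even|qvec].
case: H => _; rewrite hm; set b := ccw _ _; rewrite /b.
by case=> ->; rewrite ccwE.
Qed.
End Deflation.

(** * Deflation *)

(** The hexagons on l + 2Q determine all others. *)
Definition inflates (l : Qlat) (h : Qlat -> hexagon) := forall z j,
  h (l + z *+ 2 + u j) = if ccw (h (l + z *+ 2)) j then j else j + 3.

Definition deflate T (l : Qlat) (h : Qlat -> T) (z : Qlat) : T := h (l + z *+ 2).

(** Only the diameter perpendicular to the stripe has ends of two colours. *)
Lemma red_perp a b j : a = j + 5 \/ a = j + 2 -> red (TSTile a b) j = ~~ red (TSTile a b) (j + 3).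
Proof.
have : ((a == j + 5) || (a == j + 2)) ==> (red (TSTile a b) j == ~~ red (TSTile a b) (j + 3)).
  by move: a j; do 2!apply: Z6_ind; case: b; vm_compute.
by move=> /implyP H e; apply/eqP/H; case: e => ->; rewrite eqxx ?orbT.
Qed.

Section Deflate.
Variables (h : Qlat -> hexagon) (l : Qlat).
Hypothesis hi : inflates l h.

Lemma deflate_wm : well_matched (deflate l h).
Proof.
move=> z k; rewrite /deflate; have := hi z k; have := hi (z + u k) (k + 3).
rewrite (_ : _ + u (k + 3) = l + z *+ 2 + u k); last by qvec.
move=> ->; rewrite Z6E; have n3 : k <> k + 3 by rewrite -[X in X = _]addr0 => /eqP; rewrite Z6_neq.
by do 2!case: ccw => //=; congruence.
Qed.

(** The side of a triangle with vertices in l + 2Q has even length, since it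
    cannot stop at an odd point. *)
Lemma deflate_corners_close : corners_close h -> corners_close (deflate l h).
Proof.
move=> hc x j cx; have [n [n0 _ hs st]] := hc _ _ cx.
have step i : (i.*2.+1 <= n)%N -> h (l + x *+ 2 + u j *+ i.*2.+1) = j.
  move=> le; rewrite [u j *+ _]mulrSr addrA.
  have -> : l + x *+ 2 + u j *+ i.*2 = l + (x + u j *+ i) *+ 2 by rewrite -muln2; qvec.
  rewrite hi; case: ifP => // /negP[].
  have [->|i0] := posnP i; first by rewrite mulr0n addr0; case/andP: cx.
  rewrite (_ : l + _ = l + x *+ 2 + u j *+ i.*2); last by rewrite -muln2; qvec.
  by rewrite (proj1 (hs _ _)) ?ccwE //; lia.
have [i en] : exists i, n = i.*2.
  exists n./2; have [on|ev] := boolP (odd n); last first.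
    by rewrite -[LHS]odd_double_half (negbTE ev).
  have en : n./2.*2.+1 = n by rewrite -[RHS]odd_double_half on.
  by case: st => + _; case; rewrite -{1}en; apply: step; rewrite en.
have E w k : l + (x + u w *+ k) *+ 2 = l + x *+ 2 + u w *+ k.*2 by rewrite -muln2; qvec.
exists i; rewrite en in n0 hs st; split=> //; first by lia.
- by move=> k hk; rewrite /deflate !E; apply: hs; lia.
- by rewrite /stops /deflate !E.
Qed.

Lemma deflate_stripes_end : stripes_end h -> stripes_end (deflate l h).
Proof.
move=> he x; have [n hn] := he (l + x *+ 2); rewrite -/(deflate l h x) in hn *.
set k := deflate l h x in hn *.
have E i : deflate l h (x - u k *+ i) = h (l + x *+ 2 - u k *+ i.*2).
  by rewrite /deflate; congr h; rewrite -muln2; qvec.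
have [eo|] := boolP (odd n); last first.
  by move=> ev; exists n./2; rewrite E (_ : n./2.*2 = n) // -[RHS]odd_double_half (negbTE ev).
exists n./2.+1 => H; apply: hn.
have := hi (x - u k *+ n./2.+1) k; move: H; rewrite {1}/deflate => ->; rewrite ccwE => e; rewrite -[RHS]e.
congr h; rewrite -[in LHS](odd_double_half n) eo -muln2 add1n; qvec.
Qed.

(** The midpoint between two tiles of l + 2Q that are opposite across a long
    diagonal has its stripe perpendicular to it and swaps the colours, so applying
    the rule twice gives the rule for the sublattice. *)
Lemma deflate_RT2on c f : RT2on c h f -> RT2on ((c - l) *+ 2) (deflate l h) (deflate l f).
Proof.
move=> hr x j s3; rewrite /deflate.
have s1 : same3 c (l + x *+ 2) by move: s3; rewrite /same3 !coordE; lia.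
have s2 : same3 c (l + x *+ 2 + v j).
  by move: s1; rewrite /same3 /v !coordE; move: j; apply: Z6_ind => /=; lia.
rewrite (hr _ _ s1); have := hr _ j s2.
rewrite (_ : l + x *+ 2 + v j + v j = l + (x + v j) *+ 2); last by qvec.
move=> <-; have := hi (x + u (j + 1)) (j + 5).
rewrite (_ : _ + u (j + 5) = l + x *+ 2 + v j); last by rewrite /v; qvec.
by move=> ->; case: ifP => _; rewrite ?Z6E -red_perp //; [left|right].
Qed.
End Deflate.

(** [c k] is a representative of the coset L_k of 2^k Q.  The second part says
    that the midpoint of an edge of L_(k+1) continues the black line of that
    edge. *)
Definition nest (h : Qlat -> hexagon) (c : nat -> Qlat) :=
  (forall k, exists d, c k.+1 = c k + d *+ 2 ^ k) /\
  (forall k z j, h (c k.+1 + z *+ 2 ^ k.+1 + u j *+ 2 ^ k) =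
     if ccw (h (c k.+1 + z *+ 2 ^ k.+1)) j then j else j + 3).

Definition deflatable (h : Qlat -> hexagon) f := [/\ well_matched h, corners_close h, stripes_end h & exists c, RT2on c h f].

Lemma deflatable_inflates h f : deflatable h f -> exists l, inflates l h /\ deflatable (deflate l h) (deflate l f).
Proof.
case=> hm hc he [c hr]; have [l hl] := deflation_centre hm hc he hr; exists l; split=> //.
split; [exact: deflate_wm|exact: deflate_corners_close|exact: deflate_stripes_end|].
by exists ((c - l) *+ 2); exact: deflate_RT2on.
Qed.

(** Repeated deflation, in the coordinates of the original tiling. *)
Definition zoom T (k : nat) (c : Qlat) (h : Qlat -> T) z := h (c + z *+ 2 ^ k).

Lemma deflatable_nest h f : deflatable h f -> exists c, nest h c.
Proof.
move=> g.
have step k c : exists d, deflatable (zoom k c h) (zoom k c f) -> inflates d (zoom k c h) /\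
    deflatable (zoom k.+1 (c + d *+ 2 ^ k) h) (zoom k.+1 (c + d *+ 2 ^ k) f).
  have [g'|ng] := pselect (deflatable (zoom k c h) (zoom k c f)); last by exists 0.
  have [l [hl gl]] := deflatable_inflates g'; exists l => _; split=> //.
  have E T (F : Qlat -> T) : zoom k.+1 (c + l *+ 2 ^ k) F = deflate l (zoom k c F).
    by apply: funext => z; rewrite /zoom /deflate; congr F; qvec.
  by rewrite !E.
pose D k c := projT1 (cid (step k c)).
pose C := fix C k := if k is k'.+1 then C k' + D k' (C k') *+ 2 ^ k' else 0.
have G k : deflatable (zoom k (C k) h) (zoom k (C k) f).
  elim: k => [|k IH]; last by have := projT2 (cid (step k (C k))); case/(_ IH).
  have E T (F : Qlat -> T) : zoom 0 (C 0%N) F = F.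
    by apply: funext => z; rewrite /zoom /= add0r expn0 mulr1n.
  by rewrite !E.
exists C; split=> [k|k z j]; first by exists (D k (C k)).
have [H _] := projT2 (cid (step k (C k))) (G k); have := H z j; rewrite /zoom /=.
rewrite -/(D _ _); set d := D _ _.
rewrite (_ : C k + d *+ 2 ^ k + z *+ 2 ^ k.+1 = C k + (d + z *+ 2) *+ 2 ^ k); last by qvec.
by rewrite (_ : _ + u j *+ _ = C k + (d + z *+ 2 + u j) *+ 2 ^ k); last by qvec.
Qed.

Local Open Scope classical_set_scope.

(** * The nested levels *)

Local Open Scope classical_set_scope.

Section Nest.
Variables (h : Qlat -> hexagon) (c : nat -> Qlat).
Hypothesis hn : nest h c.

Definition level k : set Qlat := coset2Q k (c k).

Lemma level0 x : level 0 x.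
Proof. by exists (x - c 0%N); rewrite expn0 mulr1n addrC subrK. Qed.

Lemma levelD k x z : level k x -> level k (x + z *+ 2 ^ k).
Proof. by case=> w ->; exists (w + z); qvec. Qed.

Lemma level_diff k x y : level k x -> level k y -> exists z, y = x + z *+ 2 ^ k.
Proof. by case=> w -> [w' ->]; exists (w' - w); qvec. Qed.

Lemma levelS k x : level k.+1 x -> level k x.
Proof. by case=> z ->; case: hn => /(_ k)[d ->] _; exists (d + z *+ 2); qvec. Qed.

Lemma level_le k m x : (k <= m)%N -> level m x -> level k x.
Proof.
elim: m => [|m IH]; first by rewrite leqn0 => /eqP->.
by rewrite leq_eqVlt => /orP[/eqP->//|/IH H /levelS].
Qed.

Lemma nest_mid k p j : level k.+1 p -> h (p + u j *+ 2 ^ k) = if ccw (h p) j then j else j + 3.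
Proof. by case=> z ->; case: hn => _; apply. Qed.

(** By induction on k: the midpoint of an edge of L_k continues its black line,
    and so do its two halves, which are edges of L_(k-1). *)
Lemma nest_line k p j i : level k p -> (0 < i < 2 ^ k)%N ->
  h (p + u j *+ i) = if ccw (h p) j then j else j + 3.
Proof.
elim: k p i => [|k IH] p i Lp; first by rewrite expn0; lia.
move=> /andP[i0 i1]; case: (ltngtP i (2 ^ k)) => [lt|gt|->]; last exact: nest_mid.
  by apply: IH; [exact: levelS|rewrite i0].
have e : h (p + u j *+ i) = h (p + u j *+ 2 ^ k + u j *+ (i - 2 ^ k)).
  by congr h; rewrite -addrA -mulrnDr subnKC // ltnW.
rewrite e IH.
- by rewrite nest_mid //; case: (ccw (h p) j); rewrite ?ccwE.
- exact/levelD/levelS.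
- by move: i1; rewrite expnS; lia.
Qed.

Lemma parity (z : Qlat) : (exists w, z = w *+ 2) \/ exists a w, z = u a + w *+ 2.
Proof.
case: z => m n.
pose q (m : int) := (m %/ 2)%Z; pose r (m : int) := (m %% 2)%Z.
have d s : s = r s + q s * 2 by rewrite /r /q; lia.
have b s : r s = 0 \/ r s = 1 by rewrite /r; lia.
have := d m; have := d n; case: (b m) => ->; case: (b n) => -> en em.
- by left; exists (q m, q n); apply: Qext; rewrite !coordE /=; lia.
- by right; exists 2, (q m, q n); apply: Qext; rewrite !coordE /=; lia.
- by right; exists 0, (q m, q n); apply: Qext; rewrite !coordE /=; lia.
- by right; exists 1, (q m, q n); apply: Qext; rewrite !coordE /=; lia.
Qed.

(** A point of L_k outside L_(k+1) is the midpoint of an edge of L_(k+1), and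
    its stripe runs along that edge. *)
Lemma nest_stripe k x : level k x -> ~ level k.+1 x ->
  exists a, level k.+1 (x + u a *+ 2 ^ k) /\ (h x = a \/ h x = a + 3).
Proof.
move=> Lx nL; have Lc : level k.+1 (c k.+1) by exists 0; rewrite mul0rn addr0.
have [z ex] := level_diff (levelS Lc) Lx.
case: (parity z) => [[w ez]|[a [w ez]]].
  by case: nL; exists w; rewrite ex ez expnS mulrnA.
have Lp : level k.+1 (x - u a *+ 2 ^ k) by exists w; rewrite ex ez; qvec.
exists a; split; first by rewrite (_ : _ + _ = x - u a *+ 2 ^ k + u a *+ 2 ^ k.+1); [exact: levelD|qvec].
by have := nest_mid a Lp; rewrite subrK; case: ifP => _; [left|right].
Qed.

Lemma nest_class k p a x : level k.+1 p -> (exists w, x = p + u a *+ 2 ^ k + w *+ 2 ^ k.+1) ->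
  h x = a \/ h x = a + 3.
Proof.
move=> Lp [w ->]; have := nest_mid a (levelD w Lp).
by rewrite addrAC => ->; case: ifP; [left|right].
Qed.

(** The sides run along edges of L_k and stop after one of them, where the
    stripe has another direction. *)
Lemma nest_tri k x j : level k x -> ~ level k.+1 x -> corner h x j -> triangle_at h x j (2 ^ k).
Proof.
move=> Lx nL cx; split=> //; first by rewrite expn_gt0.
  move=> i hi; rewrite !(nest_line _ Lx) //; case/andP: cx => -> /negbTE ->.
  by rewrite !Z6E.
have [a [Lp ha]] := nest_stripe Lx nL.
set p := x + _ in Lp.
have n05 (b : 'Z_6) : b <> b + 1 by rewrite -[X in X = _]addr0 => /eqP; rewrite Z6_neq.
have ja : j = a + 1 \/ j = a + 4.
  case/cornerP: cx => e; [have : h x + 1 = j by rewrite e Z6E|have : h x + 4 = j by rewrite e Z6E].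
    by case: ha => -> <-; rewrite ?Z6E; auto.
  by case: ha => -> <-; rewrite ?Z6E; auto.
split=> H.
- have /(nest_class Lp) : exists w, x + u j *+ 2 ^ k = p + u (a + 2) *+ 2 ^ k + w *+ 2 ^ k.+1.
    case: ja => ->; [exists 0|exists (- u (a + 1))]; rewrite /p; qvec.
  by rewrite H; case: ja => ->; rewrite !Z6E; case=> /eqP; rewrite Z6_neq.
have /(nest_class Lp) : exists w, x + u (j + 1) *+ 2 ^ k = p + u (a + 1) *+ 2 ^ k + w *+ 2 ^ k.+1.
  case: ja => ->; rewrite Z6E; [exists (- u a)|exists (- u (a + 1))]; rewrite /p; qvec.
by rewrite H; case: ja => ->; rewrite !Z6E; case=> /eqP; rewrite Z6_neq.
Qed.

Definition points_escape := forall x, exists k, ~ level k x.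

Lemma escape_level x : (exists k, ~ level k x) -> exists k, level k x /\ ~ level k.+1 x.
Proof.
case=> k; elim: k => [|k IH] nL; first by case: nL; exact: level0.
by have [Lk|/IH//] := pselect (level k x); exists k.
Qed.

(** A point of all levels would be the corner of an infinite path. *)
Lemma corners_close_escape : corners_close h -> points_escape.
Proof.
move=> hc x; apply: contrapT => H.
have cx : corner h x (h x + 1) by apply/cornerP; left; rewrite Z6E.
have [n [n0 _ _ [st _]]] := hc _ _ cx; apply: st.
have Lx : level n x by apply: contrapT => nL; apply: H; exists n.
have ltn : (0 < n < 2 ^ n)%N by rewrite n0 ltn_expl.
by rewrite (nest_line _ Lx ltn); case/andP: cx => ->.
Qed.

Lemma nest_corners_close : points_escape -> corners_close h.
Proof.
move=> he x j cx; have [k [Lx nL]] := escape_level (he x).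
by exists (2 ^ k)%N; exact: nest_tri.
Qed.

Lemma tri_uniq x j m n : triangle_at h x j m -> triangle_at h x j n -> m = n.
Proof.
have W m' n' : triangle_at h x j m' -> triangle_at h x j n' -> (m' <= n')%N.
  move=> [m0 _ sm [tm _]] [n0 _ sn [tn _]]; rewrite leqNgt; apply/negP => lt.
  by apply: tn; apply: (proj1 (sm _ _)); rewrite n0.
by move=> H1 H2; apply/eqP; rewrite eqn_leq !W.
Qed.

Lemma nest_wm : well_matched h.
Proof.
move=> x k.
have key y b : level 1 y -> ccw (h y) b = ~~ ccw (h (y + u b)) (b + 3).
  by move=> Ly; have := nest_mid b Ly; rewrite expn0 mulr1n => ->; case: ifP; rewrite ?ccwE.
have [Lx|nx] := pselect (level 1 x); first exact: key.
have [Ly|ny] := pselect (level 1 (x + u k)).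
  have := key _ (k + 3) Ly; rewrite Z6E => ->; rewrite negbK; congr (ccw (h _)); qvec.
have [a [Lp ha]] := nest_stripe (level0 x) nx.
rewrite expn0 mulr1n in Lp.
have [i ek] : exists i, k = a + i by exists (k - a); ring.
have n0 : i <> 0 by move=> i0; apply: ny; rewrite ek i0 addr0.
have n3 : i <> 3.
  move=> i3; apply: ny; have := levelD (- u a) Lp; rewrite expn1.
  by rewrite ek i3 (_ : _ + _ = x + u (a + 3)); last by qvec.
have N1 (b : 'Z_6) : exists w, x + u (a + 1) = x + u a + u (a + 2) *+ 2 ^ 0 + w *+ 2 ^ 1 by exists 0; qvec.
have N4 : exists w, x + u (a + 4) = x + u a + u (a + 2) *+ 2 ^ 0 + w *+ 2 ^ 1 by exists (- u (a + 1)); qvec.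
have N2 : exists w, x + u (a + 2) = x + u a + u (a + 1) *+ 2 ^ 0 + w *+ 2 ^ 1 by exists (- u a); qvec.
have N5 : exists w, x + u (a + 5) = x + u a + u (a + 1) *+ 2 ^ 0 + w *+ 2 ^ 1 by exists (- u (a + 1)); qvec.
move: n0 n3; rewrite ek; move: i {ek}; apply: Z6_ind => // _ _.
- by case: (nest_class Lp (N1 a)) => ->; case: ha => ->; rewrite ?Z6E ?ccwE.
- by case: (nest_class Lp N2) => ->; case: ha => ->; rewrite ?Z6E ?ccwE.
- by case: (nest_class Lp N4) => ->; case: ha => ->; rewrite ?Z6E ?ccwE.
- by case: (nest_class Lp N5) => ->; case: ha => ->; rewrite ?Z6E ?ccwE.
Qed.

Lemma level_inv_lim : inv_lim_Q level.
Proof. by split=> k; [exists (c k)|move=> x /levelS]. Qed.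

(** For the element q of the inverse limit: q is in no x + Z_2 a. *)
Definition lattice_lines_escape := forall x j, exists k, forall t : int, ~ level k (x + u j *~ t).

Lemma lattice_lines_points_escape : lattice_lines_escape -> points_escape.
Proof. by move=> H x; have [k /(_ 0)] := H x 0; rewrite mulr0z addr0; exists k. Qed.

End Nest.

(** * The plane in lattice coordinates *)

Section Plane.
Variable R : realType.
Implicit Types (p q d : plane R) (x y z : Qlat) (j k : 'Z_6).
Notation s3 := (Num.sqrt 3 : R).

Lemma plane_ext p q : p.1 = q.1 -> p.2 = q.2 -> p = q.
Proof. by case: p q => [? ?] [? ?] /= -> ->. Qed.

Lemma p1D p q : (p + q).1 = p.1 + q.1. Proof. by []. Qed.
Lemma p2D p q : (p + q).2 = p.2 + q.2. Proof. by []. Qed.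
Lemma p1N p : (- p).1 = - p.1. Proof. by []. Qed.
Lemma p2N p : (- p).2 = - p.2. Proof. by []. Qed.
Lemma p1Z (a : R) p : (a *: p).1 = a * p.1. Proof. by []. Qed.
Lemma p2Z (a : R) p : (a *: p).2 = a * p.2. Proof. by []. Qed.
Lemma p1M p n : (p *+ n).1 = p.1 *+ n. Proof. exact: (raddfMn fst). Qed.
Lemma p2M p n : (p *+ n).2 = p.2 *+ n. Proof. exact: (raddfMn snd). Qed.
Definition plane_coordE := (p1D, p2D, p1N, p2N, p1Z, p2Z, p1M, p2M).

Lemma pos1 x : (pos R x).1 = x.1%:~R - 2^-1 * x.2%:~R.
Proof. by rewrite /pos /a1 /a2 !plane_coordE /=; ring. Qed.
Lemma pos2 x : (pos R x).2 = x.2%:~R * (s3 / 2).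
Proof. by rewrite /pos /a1 /a2 !plane_coordE /=; ring. Qed.

Lemma posD x y : pos R (x + y) = pos R x + pos R y.
Proof. by apply: plane_ext; rewrite !plane_coordE !coordE; ring. Qed.
Lemma posN x : pos R (- x) = - pos R x.
Proof. by apply: plane_ext; rewrite !plane_coordE !coordE; ring. Qed.
Lemma posM x n : pos R (x *+ n) = n%:R *: pos R x.
Proof. by apply: plane_ext; rewrite !plane_coordE !coordE; ring. Qed.
Lemma posZ x (n : int) : pos R (x *~ n) = n%:~R *: pos R x.
Proof. by apply: plane_ext; rewrite !plane_coordE !coordE; ring. Qed.

(** Locked, since unfolding [pos] exposes sums that rewriting rules would
    match. *)
Definition U k : plane R := locked (pos R (u k)).
Lemma UE k : U k = pos R (u k). Proof. by rewrite /U -lock. Qed.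
Lemma U2 k : U (k + 2) = U (k + 1) - U k. Proof. by rewrite !UE u2 posD posN. Qed.
Lemma U3 k : U (k + 3) = - U k. Proof. by rewrite !UE u3 posN. Qed.
Lemma U4 k : U (k + 4) = - U (k + 1). Proof. by rewrite !UE u4 posN. Qed.
Lemma U5 k : U (k + 5) = U k - U (k + 1). Proof. by rewrite !UE u5 posD posN. Qed.

Lemma s3s3 : s3 * s3 = 3.
Proof. by rewrite -expr2 sqr_sqrtr. Qed.

Lemma dot_pos x y : dot (pos R x) (pos R y) =
  (x.1 * y.1 + x.2 * y.2)%:~R - 2^-1 * (x.1 * y.2 + x.2 * y.1)%:~R.
Proof.
rewrite /dot !(pos1, pos2).
have -> : x.2%:~R * (s3 / 2) * (y.2%:~R * (s3 / 2)) = x.2%:~R * y.2%:~R * (s3 * s3) / 4 by field.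
by rewrite s3s3; field.
Qed.

Lemma dotDl p q d : dot (p + q) d = dot p d + dot q d.
Proof. by rewrite /dot !plane_coordE; ring. Qed.
Lemma dotZl (a : R) p d : dot (a *: p) d = a * dot p d.
Proof. by rewrite /dot !plane_coordE; ring. Qed.
Lemma dotNl p d : dot (- p) d = - dot p d.
Proof. by rewrite /dot !plane_coordE; ring. Qed.
Lemma dotC p q : dot p q = dot q p.
Proof. by rewrite /dot; ring. Qed.
Lemma dotDr p q d : dot d (p + q) = dot d p + dot d q.
Proof. by rewrite /dot !plane_coordE; ring. Qed.
Lemma dotZr (a : R) p d : dot d (a *: p) = a * dot d p.
Proof. by rewrite /dot !plane_coordE; ring. Qed.
Lemma dotNr p d : dot d (- p) = - dot d p.
Proof. by rewrite /dot !plane_coordE; ring. Qed.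
Definition dotE := (dotDl, dotZl, dotNl, dotDr, dotZr, dotNr).

Lemma dotUU k : dot (U k) (U k) = 1.
Proof. by move: k; apply: Z6_ind; rewrite !UE dot_pos /=; lra. Qed.
Lemma dotU1 k : dot (U k) (U (k + 1)) = 2^-1.
Proof. by move: k; apply: Z6_ind; rewrite !UE dot_pos /=; lra. Qed.

Lemma side_midE k : side_mid R k = 2^-1 *: U k. Proof. by rewrite UE. Qed.

(** A multiple of [v (k + 1)]. *)
Lemma side_dirE k : side_dir R k = (s3 / 3) *: (2 *: U (k + 1) - U k).
Proof.
rewrite /side_dir /vert; have := U5 k; rewrite !UE subrK !posD => e.
have -> : k - 1 = k + 5 by apply/eqP; move: k {e}; apply: Z6_ind; vm_compute.
by rewrite e; apply: plane_ext; rewrite !plane_coordE; field.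
Qed.

(** In these units the displacement involves no square root, and the hypothesis
    on eps becomes offset < 1 / 2. *)
Definition offset (eps : R) : R := eps * s3.

Variable eps : R.
Hypothesis heps : 0 < eps < (2 * s3)^-1.
Notation e := (offset eps).

Lemma offset_gt0 : 0 < e.
Proof. by case/andP: heps => *; rewrite /offset mulr_gt0 // sqrtr_gt0. Qed.
Lemma offset_lt : e < 2^-1.
Proof.
rewrite /offset; case/andP: heps => _; rewrite -(ltr_pM2r (x := s3)) ?sqrtr_gt0 // => /lt_le_trans; apply.
by rewrite invfM -mulrA mulVf ?mulr1 // sqrtr_eq0 -ltNge.
Qed.

Lemma marked_pointE s k : marked_point eps s k =
  2^-1 *: U k + (if ccw s k then e / 3 else - (e / 3)) *: (2 *: U (k + 1) - U k).
Proof.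
by rewrite /marked_point side_midE side_dirE /offset; case: ifP => _; apply: plane_ext; rewrite !plane_coordE; field.
Qed.

(** The point where the corner marking between directions j and j + 1 bends. *)
Definition bend j : plane R := (2 * e / 3) *: (U j + U (j + 1)).

(** The two arms of the corner marking at (x, j), prolonged to lines; [ray]
    contains a whole side of the path triangle with that corner. *)
Definition ray x j (t : R) : plane R := pos R x + bend j + t *: U j.
Definition ray' x j (t : R) : plane R := pos R x + bend j + t *: U (j + 1).

Definition det p q : R := p.1 * q.2 - p.2 * q.1.

Lemma detUU k : det (U k) (U (k + 1)) = s3 / 2.
Proof. by rewrite /det !UE; move: k; apply: Z6_ind; rewrite !(pos1, pos2) /=; field. Qed.

Lemma dotU_inj d j : dot d (U j) = 0 -> dot d (U (j + 1)) = 0 -> d = 0.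
Proof.
have s0 : s3 / 2 != 0 by apply: lt0r_neq0; rewrite divr_gt0 ?sqrtr_gt0.
rewrite /dot => h1 h2; have := detUU j; rewrite /det; set D := s3 / 2 in s0 *.
move: h1 h2; case: (U j) (U (j + 1)) => [a b] [a' b'] /= h1 h2 hD.
apply: plane_ext; apply: (mulIf s0); rewrite mul0r -hD /=.
  by transitivity (b' * (d.1 * a + d.2 * b) - b * (d.1 * a' + d.2 * b')); [ring|rewrite h1 h2; ring].
by transitivity (a * (d.1 * a' + d.2 * b') - a' * (d.1 * a + d.2 * b)); [ring|rewrite h1 h2; ring].
Qed.

Lemma segment_line p d (a b : R) r : a <= b ->
  segment (p + a *: d) (p + b *: d) r <-> exists t, a <= t <= b /\ r = p + t *: d.
Proof.
move=> ab; split=> [[t [/andP[t0 t1] ->]]|[t [/andP[at_ tb] ->]]].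
  exists ((1 - t) * a + t * b); split; first by apply/andP; split; nra.
  by apply: plane_ext; rewrite !plane_coordE; ring.
have [e0|ne] := eqVneq a b.
  exists 0; split; first by rewrite lexx ler01.
  have -> : t = a by lra.
  by apply: plane_ext; rewrite !plane_coordE; ring.
have ba : 0 < b - a by lra.
exists ((t - a) / (b - a)); split.
  rewrite divr_ge0 ?ler_pdivrMr //=; lra.
by apply: plane_ext; rewrite !plane_coordE; field; lra.
Qed.

Lemma segmentC p q : segment p q = segment q p.
Proof.
have S p' q' r : segment p' q' r -> segment q' p' r.
  case=> t [/andP[t0 t1] ->]; exists (1 - t); split; first by apply/andP; split; lra.
  by apply: plane_ext; rewrite !plane_coordE; ring.
by apply/seteqP; split=> r; apply: S.
Qed.

End Plane.

(** * Markings as segments *)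

(** The marking of a hexagon that ends on its side k. *)
Definition mkof (s : hexagon) (k : 'Z_6) : marking :=
  if k - s \in [:: 0; 3] then Stripe else if k - s \in [:: 1; 2] then Corner12 else Corner45.

Lemma mkofD s a : mkof s (s + a) = mkof 0 a.
Proof. by rewrite /mkof addrC addKr subr0. Qed.

Lemma mk_endsP s m k : (k \in [:: (mk_ends s m).1; (mk_ends s m).2]) <-> m = mkof s k.
Proof.
by case: m; move: s k; do 2!apply: Z6_ind; vm_compute; split.
Qed.

Lemma addB3 (V : zmodType) (a b c : V) : a + b + c - a = b + c.
Proof. by rewrite addrAC [a + b]addrC addrK. Qed.

Section Pieces.
Variables (R : realType) (eps : R) (h : Qlat -> hexagon).
Hypothesis heps : 0 < eps < (2 * Num.sqrt 3)^-1.
Notation e := (offset eps).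
Implicit Types (p q d : plane R) (x y z : Qlat) (j k : 'Z_6).

Lemma stripe_piece x j p : h x = j ->
  placed_mk eps h (x, Stripe) p <-> exists t, - (2^-1 + e) <= t <= 2^-1 - e /\ p = ray eps x j t.
Proof.
move=> hx; rewrite /placed_mk /mk_set /= hx.
rewrite (_ : marked_point eps j j = bend eps j + (2^-1 - e) *: U R j); last first.
  by rewrite marked_pointE ccwE; apply: plane_ext; rewrite /bend !plane_coordE; field.
rewrite (_ : marked_point eps j (j + 3) = bend eps j + (- (2^-1 + e)) *: U R j); last first.
  by rewrite marked_pointE ccwE !Z6E U3 U4; apply: plane_ext; rewrite /bend !plane_coordE /=; field.
rewrite segmentC.
have le : - (2^-1 + e) <= 2^-1 - e by lra.
split=> [/(segment_line _ _ _ le)[t [ht et]]|[t [ht ->]]].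
  by exists t; split=> //; rewrite /ray -addrA -et addrC subrK.
by apply/(segment_line _ _ _ le); exists t; split=> //; rewrite /ray addB3.
Qed.

(** The two perpendicularity conditions determine the bend of a corner
    marking. *)
Lemma corner_piece x j p : corner h x j ->
  placed_mk eps h (x, mkof (h x) j) p <->
  (exists t, 0 <= t <= 2^-1 - e /\ p = ray eps x j t) \/
  (exists t, 0 <= t <= 2^-1 - e /\ p = ray' eps x j t).
Proof.
move=> cx; have [cj cj1] := andP cx.
have e1 := offset_gt0 heps; have e2 := offset_lt heps.
have mj : marked_point eps (h x) j = bend eps j + (2^-1 - e) *: U R j.
  by rewrite marked_pointE cj; apply: plane_ext; rewrite /bend !plane_coordE; field.
have mj1 : marked_point eps (h x) (j + 1) = bend eps j + (2^-1 - e) *: U R (j + 1).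
  by rewrite marked_pointE (negbTE cj1) !Z6E U2; apply: plane_ext; rewrite /bend !plane_coordE /=; field.
have -> : placed_mk eps h (x, mkof (h x) j) p = bent_line eps (h x) j (j + 1) (p - pos R x).
  rewrite /placed_mk /mk_set /=; case/cornerP: cx => -> /=.
    by rewrite (_ : mkof _ _ = Corner12) /= ?Z6E // -[j in mkof _ j](_ : j + 5 + 1 = j) ?mkofD ?Z6E.
  by rewrite (_ : mkof _ _ = Corner45) /= ?Z6E // -[j in mkof _ j](_ : j + 2 + 4 = j) ?mkofD ?Z6E.
have s0 : Num.sqrt 3 / 3 != 0 :> R by apply: lt0r_neq0; rewrite divr_gt0 ?sqrtr_gt0.
have hb c : dot (c - marked_point eps (h x) j) (side_dir R j) = 0 /\
    dot (c - marked_point eps (h x) (j + 1)) (side_dir R (j + 1)) = 0 <-> c = bend eps j.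
  rewrite !side_dirE mj mj1 !Z6E U2 /bend !dotE; set X := dot c (U R j); set Y := dot c (U R (j + 1)).
  rewrite !dotUU (dotC (U R (j + 1)) (U R j)) !dotU1.
  split=> [[/eqP + /eqP]|ec]; last first.
    by rewrite /X /Y ec /bend !dotE !dotUU (dotC (U R (j + 1)) (U R j)) !dotU1; split; field.
  rewrite !(mulf_eq0 (Num.sqrt 3 / 3)) !(negbTE s0) /= => /eqP h1 /eqP h2.
  apply/eqP; rewrite -subr_eq0; apply/eqP.
  by apply: (@dotU_inj _ _ j); rewrite /bend !dotE !dotUU ?(dotC (U R (j + 1)) (U R j)) ?dotU1 -/X -/Y; lra.
have le : 0 <= 2^-1 - e by lra.
have arm d : segment (bend eps j + (2^-1 - e) *: d) (bend eps j) (p - pos R x) <->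
    exists t, 0 <= t <= 2^-1 - e /\ p = pos R x + bend eps j + t *: d.
  rewrite segmentC -{1}[bend eps j]addr0 -(scale0r d).
  split=> [/(segment_line _ _ _ le)[t [ht et]]|[t [ht ->]]].
    by exists t; split=> //; rewrite -addrA -et addrC subrK.
  by apply/(segment_line _ _ _ le); exists t; split=> //; rewrite addB3.
rewrite /bent_line /= mj mj1 in hb *; split.
  by case=> c [c1 c2]; rewrite (proj1 (hb c) (conj c1 c2)) => -[/arm|]; [left|rewrite segmentC => /arm; right].
move=> H; have [b1 b2] := proj2 (hb _) erefl; exists (bend eps j); split=> //.
by case: H => /arm H; [left|right; rewrite segmentC].
Qed.

End Pieces.

(** * Closed paths *)

Section Paths.
Variable h : Qlat -> hexagon.
Hypotheses (hm : well_matched h).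
Implicit Types (x y z : Qlat) (j k : 'Z_6) (m : Qlat * marking).

Lemma joinedE m m' : joined h m m' <->
  exists k, [/\ m'.1 = m.1 + u k, m.2 = mkof (h m.1) k & m'.2 = mkof (h m'.1) (k + 3)].
Proof.
by split=> -[k [e1 /mk_endsP e2 /mk_endsP e3]]; exists k.
Qed.

Lemma joined_sym m m' : joined h m m' -> joined h m' m.
Proof.
move=> /joinedE[k [e1 e2 e3]]; apply/joinedE; exists (k + 3); rewrite Z6E; split=> //.
by rewrite e1 u3 addrK.
Qed.

Notation linked := (clos_refl_trans _ (joined h)).

Lemma linked_sym m m' : linked m m' -> linked m' m.
Proof.
elim=> [a b /joined_sym H|a|a b d _ H1 _ H2]; [exact: rt_step|exact: rt_refl|exact: rt_trans H2 H1].
Qed.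

(** Markings on the line through x in direction j, named by the end at which
    they leave. *)
Definition side_mk x j i : Qlat * marking := (x + u j *+ i, mkof (h (x + u j *+ i)) j).

(** Each corner is listed once, as the start of the side that leaves it. *)
Definition on_tri x j n m := exists2 i, (i < n)%N &
  [\/ m = side_mk x j i, m = side_mk (x + u j *+ n) (j + 2) i
    | m = side_mk (x + u (j + 1) *+ n) (j + 4) i].

Lemma mkof_stripe j k : mkof j k = mkof j j -> k = j \/ k = j + 3.
Proof.
have : (mkof j k = mkof j j) -> (k == j) || (k == j + 3).
  by move: j k; do 2!apply: Z6_ind; vm_compute.
by move=> H /H /orP[/eqP|/eqP]; auto.
Qed.

Lemma mkof_corner x j k : corner h x j -> mkof (h x) k = mkof (h x) j -> k = j \/ k = j + 1.
Proof.
have H a : (a == j + 5) || (a == j + 2) -> mkof a k = mkof a j -> (k == j) || (k == j + 1).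
  by move: a j k; do 3!apply: Z6_ind; vm_compute.
move=> /cornerP c /H -/(_ _)/orP; rewrite -(rwP orP).
by case=> [|/eqP|/eqP]; [case: c => ->; rewrite eqxx; auto|left|right].
Qed.

Lemma mkof_corner1 x j : corner h x j -> mkof (h x) (j + 1) = mkof (h x) j.
Proof.
have H a : (a == j + 5) || (a == j + 2) -> mkof a (j + 1) = mkof a j.
  by move: a j; do 2!apply: Z6_ind; vm_compute.
by move=> /cornerP c; apply: H; case: c => ->; rewrite eqxx ?orbT.
Qed.

Lemma mkof_opp j : mkof j (j + 3) = mkof j j.
Proof. by move: j; apply: Z6_ind. Qed.

(** A path that does not go straight on turns left, by 120 degrees. *)
Lemma turn x j : ccw (h x) j -> h (x + u j) <> j -> corner h (x + u j) (j + 2).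
Proof. by move=> /(after_ccw hm)[//|H _|H _]; apply/cornerP; rewrite H !Z6E; auto. Qed.

Section Tri.
Variables (x : Qlat) (j : 'Z_6) (n : nat).
Hypothesis ht : triangle_at h x j n.

Lemma tri_ccw i : (i < n)%N -> ccw (h (x + u j *+ i)) j.
Proof.
case: ht => n0 cx hs _ lt; have [->|i0] := posnP i; first by rewrite addr0; case/andP: cx.
by rewrite (proj1 (hs i _)) ?ccwE // i0.
Qed.

Lemma tri_turn : corner h (x + u j *+ n) (j + 2).
Proof.
case: ht => n0 cx hs [st _]; have en : n = n.-1.+1 by rewrite prednK.
have := turn (tri_ccw (i := n.-1) _); rewrite -addrA -mulrSr -en; apply=> //.
Qed.

Hypothesis hc : corners_close h.

(** The triangle starting at the second vertex has the same side, because its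
    second side is the first side of the original triangle run backwards. *)
Lemma tri_rot : triangle_at h (x + u j *+ n) (j + 2) n.
Proof.
have [n' tn'] := hc tri_turn; suff en : n' = n by rewrite en in tn'.
case: (tn') => n0' _ hs' [_ st']; case: ht => n0 cx hs _.
rewrite !Z6E in hs' st'.
have back i : (i <= n)%N -> x + u j *+ n + u (j + 3) *+ i = x + u j *+ (n - i).
  by move=> le; rewrite -{1}(subnK le) mulrnDr u3 mulNrn addrA addrK.
apply/eqP; rewrite eqn_leq; apply/andP; split; rewrite leqNgt; apply/negP => lt.
  have := proj2 (hs' n _); rewrite n0 lt => /(_ isT); rewrite !Z6E back // subnn addr0 => ex.
  by have /andP[_] := cx; rewrite ex ccwE.
apply: st'; rewrite back 1?ltnW // (proj1 (hs _ _)) ?Z6E //.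
by rewrite subn_gt0 lt -{2}(subn0 n) ltn_sub2l.
Qed.

Lemma third_vertex : x + u j *+ n + u (j + 2) *+ n = x + u (j + 1) *+ n.
Proof. qvec. Qed.

Definition next_mk i := (x + u j *+ i.+1, mkof (h (x + u j *+ i.+1)) (j + 3)).

Lemma next_mkP i : (i < n)%N ->
  (i.+1 < n)%N /\ next_mk i = side_mk x j i.+1 \/
  i.+1 = n /\ next_mk i = side_mk (x + u j *+ n) (j + 2) 0.
Proof.
move=> lt; have [en|ne] := eqVneq i.+1 n; [right|left].
  by split=> //; rewrite /next_mk en /side_mk mulr0n addr0 -(mkof_corner1 tri_turn) Z6E.
have i1 : (i.+1 < n)%N by rewrite ltn_neqAle ne.
by split=> //; case: ht => _ _ hs _; rewrite /next_mk /side_mk (proj1 (hs i.+1 i1)) mkof_opp.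
Qed.

Lemma joined_next i : joined h (side_mk x j i) (next_mk i).
Proof. by apply/joinedE; exists j; split=> //=; rewrite mulrSr addrA. Qed.

Lemma linked_side i : (i < n)%N -> linked (side_mk x j 0) (side_mk x j i).
Proof.
elim: i => [|i IH] lt; first exact: rt_refl.
apply: rt_trans (IH (ltnW lt)) _; apply: rt_step; have := joined_next i.
by case: (next_mkP (ltnW lt)) => -[en ->] //; rewrite en ltnn in lt.
Qed.

Lemma linked_turn : linked (side_mk x j 0) (side_mk (x + u j *+ n) (j + 2) 0).
Proof.
have n0 : (0 < n)%N by case: ht.
have lt : (n.-1 < n)%N by rewrite ltn_predL.
apply: rt_trans (linked_side lt) _; apply: rt_step; have := joined_next n.-1.
by case: (next_mkP lt) => -[+ ->] //; rewrite prednK // ltnn.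
Qed.
End Tri.

Section TriClosed.
Hypothesis hc : corners_close h.
Variables (x : Qlat) (j : 'Z_6) (n : nat).
Hypothesis ht : triangle_at h x j n.

Lemma tri_rot2 : triangle_at h (x + u (j + 1) *+ n) (j + 4) n.
Proof. by have := tri_rot (tri_rot ht hc) hc; rewrite third_vertex Z6E. Qed.

Lemma on_tri_rot m : on_tri (x + u j *+ n) (j + 2) n m <-> on_tri x j n m.
Proof.
rewrite /on_tri !Z6E third_vertex (_ : x + u j *+ n + u (j + 3) *+ n = x); last by qvec.
by split=> -[i lt []]; exists i => //; by [apply: Or31|apply: Or32|apply: Or33].
Qed.

Lemma on_tri_joined1 i m' : (i < n)%N -> joined h (side_mk x j i) m' -> on_tri x j n m'.
Proof.
move=> lt /joinedE[k [/= e1 e2 e3]]; have [n0 cx hs _] := ht.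
have kj : on_tri x j n (next_mk x j i).
  by case: (next_mkP ht lt) => -[en ->]; [exists i.+1 => //; apply: Or31|exists 0%N => //; apply: Or32].
case: m' e1 e3 => q t /= -> ->.
have [i0|i0] := posnP i.
  subst i; rewrite addr0 in e2 *; rewrite /next_mk mulr1n in kj.
  case: (mkof_corner cx (esym e2)) => ek; subst k => //.
  exists n.-1; first by rewrite prednK.
  apply: Or33; rewrite /side_mk (_ : x + u (j + 1) *+ n + _ = x + u (j + 1)) ?Z6E //.
  by rewrite u4 -{1}(prednK n0) mulrSr mulNrn addrA addrAC addrK.
have hi : h (x + u j *+ i) = j by apply: (proj1 (hs i _)); rewrite i0.
move: e2; rewrite hi => /esym/mkof_stripe[] ek; subst k; first by move: kj; rewrite /next_mk mulrSr addrA.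
exists i.-1; first exact: leq_ltn_trans (leq_pred _) lt.
apply: Or31; rewrite /side_mk Z6E (_ : x + u j *+ i + u (j + 3) = x + u j *+ i.-1) //.
by rewrite -{1}(prednK i0) u3 mulrSr addrA addrK.
Qed.
End TriClosed.

Lemma on_tri_joined x j n m m' : corners_close h -> triangle_at h x j n -> on_tri x j n m -> joined h m m' -> on_tri x j n m'.
Proof.
move=> hc ht [i lt [] ->].
- exact: on_tri_joined1.
- by move/(on_tri_joined1 (tri_rot ht hc) lt)/on_tri_rot.
- move/(on_tri_joined1 (tri_rot2 hc ht) lt)=> H; do 2!apply: (proj1 (on_tri_rot _ _ _ _)).
  by move: H; rewrite third_vertex Z6E.
Qed.

Lemma on_tri_start x j n m : corners_close h -> triangle_at h x j n -> on_tri x j n m -> linked (side_mk x j 0) m.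
Proof.
move=> hc ht [i lt [] ->].
- exact: (linked_side ht).
- exact: rt_trans (linked_turn ht) (linked_side (tri_rot ht hc) lt).
- apply: rt_trans (linked_turn ht) _; have := linked_turn (tri_rot ht hc).
  rewrite third_vertex Z6E => H; apply: rt_trans H _.
  exact: (linked_side (tri_rot2 hc ht)).
Qed.

(** Every marking has two neighbours along its path, and those of a marking of
    the triangle are again on the triangle. *)
Lemma linked_tri x j n m m' : corners_close h -> triangle_at h x j n -> on_tri x j n m ->
  linked m m' <-> on_tri x j n m'.
Proof.
move=> hc ht o; split; last first.
  by move=> o'; apply: rt_trans (linked_sym (on_tri_start hc ht o)) (on_tri_start hc ht o').
move=> l; elim: l o => [a b H o|//|a b d _ IH1 _ IH2 o]; first exact: on_tri_joined ht o H.
exact/IH2/IH1.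
Qed.
End Paths.

(** * Closed paths as triangle boundaries *)

Section PathTri.
Variables (R : realType) (eps : R) (h : Qlat -> hexagon).
Hypothesis heps : 0 < eps < (2 * Num.sqrt 3)^-1.
Hypotheses (hm : well_matched h) (hc : corners_close h).
Notation e := (offset eps).
Implicit Types (p q d : plane R) (x y z : Qlat) (j k : 'Z_6) (m : Qlat * marking).

(** The vertex of a path triangle near x; x itself is a vertex of the expanded
    triangle. *)
Definition tip x j : plane R := pos R x + bend eps j.

Lemma tip_end x j n : tip (x + u j *+ n) (j + 2) = ray eps x j (n%:R - 2 * e).
Proof.
rewrite /tip /ray /bend posD posM -UE !Z6E U2 U3.
by apply: plane_ext; rewrite !plane_coordE; field.
Qed.

Lemma ray0 x j : ray eps x j 0 = tip x j.
Proof. by rewrite /ray scale0r addr0. Qed.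

Lemma ray'_end x j n t : ray' eps (x + u j *+ n) (j + 2) t = ray eps x j (n%:R - 2 * e - t).
Proof.
rewrite /ray' -/(tip _ _) tip_end Z6E U3 /ray.
by apply: plane_ext; rewrite !plane_coordE; ring.
Qed.

Lemma ray_shift x j i t : ray eps (x + u j *+ i) j t = ray eps x j (i%:R + t).
Proof.
rewrite /ray posD posM -UE; by apply: plane_ext; rewrite !plane_coordE; ring.
Qed.

Lemma side_segment x j n q : (0 < n)%N ->
  segment (tip x j) (tip (x + u j *+ n) (j + 2)) q <->
  exists t, 0 <= t <= n%:R - 2 * e /\ q = ray eps x j t.
Proof.
move=> n0; rewrite tip_end -ray0 /ray; apply: segment_line.
have := offset_lt heps; have : 1 <= n%:R :> R by rewrite ler1n.
lra.
Qed.

Definition side_set x j n : set (plane R) := segment (tip x j) (tip (x + u j *+ n) (j + 2)).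

(** Between the two corner markings, the stripes on a side cover it by intervals
    of length 1. *)
Lemma middle_cell n (t : R) : 2^-1 - e < t < n%:R - 2^-1 - e ->
  exists i, (0 < i < n)%N /\ i%:R - 2^-1 - e <= t <= i%:R + 2^-1 - e.
Proof.
elim: n => [|n IH]; first by rewrite mulr0n; lra.
move=> ht; have [lt|ge] := ltP t (n%:R - 2^-1 - e).
  have [|i [hi hi']] := IH; first by lra.
  by exists i; split=> //; move: hi; lia.
exists n; split.
  rewrite ltnSn andbT lt0n; apply/eqP => n0; move: ge ht; rewrite n0 mulr0n mulr1n; lra.
move: ge ht; rewrite -(natr1 n); lra.
Qed.

Section OneSide.
Variables (x : Qlat) (j : 'Z_6) (n : nat).
Hypothesis ht : triangle_at h x j n.

Lemma side_cover q : side_set x j n q ->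
  (exists i, (i < n)%N /\ placed_mk eps h (side_mk h x j i) q) \/
  placed_mk eps h (side_mk h (x + u j *+ n) (j + 2) 0) q.
Proof.
have [n0 cx hs _] := ht; have he := offset_lt heps; have he0 := offset_gt0 heps.
move/side_segment => /(_ n0)[t [tt ->]].
have [t1|t1] := leP t (2^-1 - e).
  left; exists 0%N; split=> //; rewrite /side_mk addr0; apply/corner_piece => //.
  by left; exists t; split=> //; lra.
have [t2|t2] := leP (n%:R - 2^-1 - e) t.
  right; rewrite /side_mk addr0; apply/corner_piece => //; first exact: tri_turn ht.
  right; exists (n%:R - 2 * e - t); split; first by lra.
  by rewrite ray'_end; congr ray; ring.
have [|i [hi hit]] := @middle_cell n t; first by lra.
left; exists i; split; first by case/andP: hi.
have ei := proj1 (hs _ hi).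
rewrite /side_mk ei (_ : mkof j j = Stripe); last by rewrite -{2}[j]addr0 mkofD.
apply/stripe_piece => //; exists (t - i%:R); split; first by lra.
by rewrite ei ray_shift addrC subrK.
Qed.

Lemma side_sub i q : (i < n)%N -> placed_mk eps h (side_mk h x j i) q ->
  side_set x j n q \/ side_set (x + u (j + 1) *+ n) (j + 4) n q.
Proof.
have [n0 cx hs _] := ht; have he := offset_lt heps; have he0 := offset_gt0 heps.
have n1 : 1 <= n%:R :> R by rewrite ler1n.
move=> lt; have [i0|i0] := posnP i.
  subst i; rewrite /side_mk addr0 => /corner_piece => /(_ heps cx)[] [t [tt ->]].
    by left; apply/side_segment => //; exists t; split=> //; lra.
  right; apply/side_segment => //; exists (n%:R - 2 * e - t); split; first by lra.
  have := ray'_end (x + u (j + 1) *+ n) (j + 4) n t; rewrite !Z6E => <-.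
  by congr ray'; qvec.
have hi : (0 < i < n)%N by rewrite i0.
have ei := proj1 (hs _ hi).
rewrite /side_mk ei (_ : mkof j j = Stripe); last by rewrite -{2}[j]addr0 mkofD.
move=> /stripe_piece => /(_ _ ei)[t [tt ->]]; left; apply/side_segment => //.
have i1 : 1 <= i%:R :> R by rewrite ler1n.
have i2 : i%:R + 1 <= n%:R :> R by rewrite natr1 ler_nat.
by exists (i%:R + t); split; [lra|rewrite ray_shift].
Qed.
End OneSide.

Definition tri_boundary x j n : set (plane R) :=
  triangle_boundary (tip x j) (tip (x + u j *+ n) (j + 2)) (tip (x + u (j + 1) *+ n) (j + 4)).

Lemma tri_boundaryE x j n q : tri_boundary x j n q <->
  [\/ side_set x j n q, side_set (x + u j *+ n) (j + 2) n q | side_set (x + u (j + 1) *+ n) (j + 4) n q].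
Proof.
rewrite /tri_boundary /triangle_boundary /side_set third_vertex !Z6E.
rewrite (_ : x + u (j + 1) *+ n + u (j + 4) *+ n = x); last by qvec.
split; first by case=> [[]|]; [apply: Or31|apply: Or32|apply: Or33].
by case=> H; [left; left|left; right|right].
Qed.

(** Each marking of the triangle lies on one or two sides, and the markings with
    an end on a side cover it. *)
Lemma path_tri x j n m : triangle_at h x j n -> on_tri h x j n m -> mk_path eps h m = tri_boundary x j n.
Proof.
move=> ht o; have t2 := tri_rot hm ht hc; have t3 := tri_rot2 hm hc ht.
have e3 : x + u (j + 1) *+ n + u (j + 4) *+ n = x by qvec.
have e4 : x + u (j + 1) *+ n + u (j + 5) *+ n = x + u j *+ n by qvec.
have e5 : x + u j *+ n + u (j + 3) *+ n = x by qvec.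
apply/seteqP; split=> q.
  case=> m' /(linked_tri hm _ hc ht o) [i lt [] ->] H; apply/tri_boundaryE.
  - by case: (side_sub ht lt H); [apply: Or31|apply: Or33].
  - by have := side_sub t2 lt H; rewrite !Z6E e5; case; [apply: Or32|apply: Or31].
  - by have := side_sub t3 lt H; rewrite !Z6E e4; case; [apply: Or33|apply: Or32].
have n0 : (0 < n)%N by case: ht.
have W m' : on_tri h x j n m' -> placed_mk eps h m' q -> mk_path eps h m q.
  by move=> o' H; exists m' => //; apply/(linked_tri hm m' hc ht o).
case/tri_boundaryE => H.
- case: (side_cover ht H) => [[i [lt]]|]; apply: W; first by exists i => //; apply: Or31.
  by exists 0%N => //; apply: Or32.
- have := side_cover t2 H; rewrite third_vertex Z6E => -[[i [lt]]|]; apply: W.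
    by exists i => //; apply: Or32.
  by exists 0%N => //; apply: Or33.
- have := side_cover t3 H; rewrite e3 Z6E => -[[i [lt]]|]; apply: W.
    by exists i => //; apply: Or33.
  by exists 0%N => //; apply: Or31.
Qed.

End PathTri.

(** * Vertices of a triangle boundary *)

Section Vertex.
Variable R : realType.
Implicit Types (a b c d p q : plane R).

Lemma dist_dot a b c d : dist a b = dist c d -> dot (a - b) (a - b) = dot (c - d) (c - d).
Proof.
by move/eqP; rewrite /dist eqr_sqrt ?/dot ?addr_ge0 -?expr2 ?sqr_ge0 // => /eqP.
Qed.

(** Lagrange's identity: the square of twice the area is 3 / 4 of the fourth power
    of the side. *)
Lemma equilateral_det a b c : equilateral a b c -> det (b - a) (c - a) != 0.
Proof.
case=> ab /dist_dot e1 /dist_dot e2; apply/eqP => D0; apply: ab.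
move: e1 e2 D0; rewrite /det /dot !plane_coordE.
case: a b c => [a1 a2] [b1 b2] [c1 c2] /= e1 e2 D0.
set L := (b1 - a1) ^+ 2 + (b2 - a2) ^+ 2.
have hw : (c1 - a1) ^+ 2 + (c2 - a2) ^+ 2 = L by rewrite /L; lra.
have hd : (b1 - a1) * (c1 - a1) + (b2 - a2) * (c2 - a2) = L / 2 by rewrite /L; lra.
have : L * L = ((b1 - a1) * (c2 - a2) - (b2 - a2) * (c1 - a1)) ^+ 2 +
    ((b1 - a1) * (c1 - a1) + (b2 - a2) * (c2 - a2)) ^+ 2.
  by rewrite -{2}hw /L; ring.
rewrite D0 hd => LL; have : L ^+ 2 = 0 by lra.
rewrite /L; move=> /eqP; rewrite expf_eq0 /= paddr_eq0 ?sqr_ge0 // !sqrf_eq0 => /andP[/eqP h1 /eqP h2].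
by congr pair; lra.
Qed.

(** A cubic that vanishes on the three side lines. *)
Definition side_product a b c p := det (b - a) (p - a) * det (c - b) (p - b) * det (a - c) (p - c).

Lemma side_product_rot a b c p : side_product b c a p = side_product a b c p.
Proof. by rewrite /side_product; ring. Qed.

Lemma boundary_product a b c p : triangle_boundary a b c p -> side_product a b c p = 0.
Proof.
have S a' b' c' : segment a' b' p -> side_product a' b' c' p = 0.
  case=> t [_ ->]; rewrite /side_product (_ : det (b' - a') _ = 0) ?mul0r //.
  by rewrite /det !plane_coordE; ring.
case=> [[/S ->//|/S H]|/S H]; first by rewrite -side_product_rot.
by rewrite -side_product_rot -side_product_rot.
Qed.

(** The two other factors are affine along the ray, so each of them vanishes for
    at most one of three parameters. *)
Lemma side_direction a b c p d : det (b - a) (p - a) = 0 -> det (c - b) (p - b) != 0 ->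
  det (a - c) (p - c) != 0 ->
  (forall t, 0 <= t <= 1 -> side_product a b c (p + t *: d) = 0) -> det (b - a) d = 0.
Proof.
move=> h0 ha hb H; apply/eqP; apply: contraT => hd.
have E a' b' t : det (b' - a') (p + t *: d - a') = det (b' - a') (p - a') + t * det (b' - a') d.
  by rewrite /det !plane_coordE; ring.
set A := det (c - b) d; set B := det (a - c) d.
set x := det (c - b) (p - b) in ha; set y := det (a - c) (p - c) in hb.
have K t : 0 < t <= 1 -> x + t * A = 0 \/ y + t * B = 0.
  move=> /andP[t0 t1]; have := H t; rewrite /side_product !E h0 add0r (ltW t0) t1 => /(_ isT) /eqP.
  rewrite !mulf_eq0 (gt_eqF t0) (negbTE hd) /= => /orP[/eqP|/eqP]; auto.
(* the pigeonhole principle for two affine functions and three points *)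
have x0 : x = 0 \/ y = 0.
  have k1 : x + 1 * A = 0 \/ y + 1 * B = 0 by apply: K; lra.
  have k2 : x + 2^-1 * A = 0 \/ y + 2^-1 * B = 0 by apply: K; lra.
  have k3 : x + 3^-1 * A = 0 \/ y + 3^-1 * B = 0 by apply: K; lra.
  case: k1 k2 k3 => e1 [e2|e2] [e3|e3]; first [left; lra|right; lra].
by move: ha hb; case: x0 => ->; rewrite eqxx.
Qed.

(** At a point that is not a vertex, a boundary segment has to follow the only
    side line through the point, so all such segments are parallel. *)
Lemma boundary_vertex a b c p d1 d2 : det (b - a) (c - a) != 0 -> det d1 d2 != 0 ->
  triangle_boundary a b c p ->
  (forall t, 0 <= t <= 1 -> triangle_boundary a b c (p + t *: d1)) ->
  (forall t, 0 <= t <= 1 -> triangle_boundary a b c (p + t *: d2)) ->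
  [\/ p = a, p = b | p = c].
Proof.
move=> hD hd hp H1 H2.
have {}H1 t ht := boundary_product (H1 t ht).
have {}H2 t ht := boundary_product (H2 t ht).
have S a' b' c' : det (b' - a') (c' - a') != 0 -> segment a' b' p ->
    (forall q, side_product a' b' c' q = side_product a b c q) -> p = a' \/ p = b'.
  move=> hD' [t [tt ep]] hs.
  have [t0|t0] := eqVneq t 0; first by left; rewrite ep t0 subr0 scale1r scale0r addr0.
  have [t1|t1] := eqVneq t 1; first by right; rewrite ep t1 subrr scale1r scale0r add0r.
  have h0 : det (b' - a') (p - a') = 0 by rewrite ep /det !plane_coordE; ring.
  have ha : det (c' - b') (p - b') != 0.
    rewrite (_ : det _ _ = (1 - t) * det (b' - a') (c' - a')).
      by rewrite mulf_neq0 // subr_eq0 eq_sym.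
    by rewrite ep /det !plane_coordE; ring.
  have hb : det (a' - c') (p - c') != 0.
    rewrite (_ : det _ _ = t * det (b' - a') (c' - a')); first by rewrite mulf_neq0.
    by rewrite ep /det !plane_coordE; ring.
  have e1 := side_direction h0 ha hb (d := d1) _; have e2 := side_direction h0 ha hb (d := d2) _.
  have {}e1 : det (b' - a') d1 = 0 by apply: e1 => s hs'; rewrite hs H1.
  have {}e2 : det (b' - a') d2 = 0 by apply: e2 => s hs'; rewrite hs H2.
  have z1 : (b' - a').1 = 0.
    apply: (mulIf hd); rewrite mul0r; transitivity (d1.1 * det (b' - a') d2 - d2.1 * det (b' - a') d1).
      by rewrite /det; ring.
    by rewrite e1 e2; ring.
  have z2 : (b' - a').2 = 0.
    apply: (mulIf hd); rewrite mul0r; transitivity (d1.2 * det (b' - a') d2 - d2.2 * det (b' - a') d1).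
      by rewrite /det; ring.
    by rewrite e1 e2; ring.
  by move: hD'; rewrite /det z1 z2 !mul0r subrr eqxx.
case: hp => [[h|h]|h].
- by case: (S a b c hD h) => // ->; [apply: Or31|apply: Or32].
- case: (S b c a) => // [|q|->|->]; [|exact: side_product_rot|exact: Or32|exact: Or33].
  by rewrite (_ : det _ _ = det (b - a) (c - a)) //; rewrite /det !plane_coordE; ring.
- case: (S c a b) => // [|q|->|->]; [|by rewrite -side_product_rot|exact: Or33|exact: Or31].
  by rewrite (_ : det _ _ = det (b - a) (c - a)) //; rewrite /det !plane_coordE; ring.
Qed.

Lemma boundary_bounded a b c q d : dot d d = 1 ->
  (forall i : nat, triangle_boundary a b c (q + i.+1%:R *: d)) -> False.
Proof.
move=> hd H.
pose M := `|dot a d| + `|dot b d| + `|dot c d|.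
have S a' b' p : segment a' b' p -> dot p d <= `|dot a' d| + `|dot b' d|.
  case=> t [/andP[t0 t1] ->]; rewrite !dotE.
  have := ler_norm (dot a' d); have := ler_norm (dot b' d).
  have := normr_ge0 (dot a' d); have := normr_ge0 (dot b' d).
  nra.
have B p : triangle_boundary a b c p -> dot p d <= M.
  have := normr_ge0 (dot a d); have := normr_ge0 (dot b d); have := normr_ge0 (dot c d).
  by rewrite /M => ? ? ? -[[/S|/S]|/S] ?; lra.
have := B _ (H (Num.truncn `|M - dot q d|)).
rewrite !dotE hd mulr1 => le.
have := truncnS_gt `|M - dot q d|; have := ler_norm (M - dot q d); lra.
Qed.
End Vertex.

(** * Geometric and combinatorial triangles *)

Lemma three_points T (p q r a b c : T) : q <> p -> r <> p -> q <> r ->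
  [\/ p = a, p = b | p = c] -> [\/ q = a, q = b | q = c] -> [\/ r = a, r = b | r = c] ->
  [/\ [\/ a = p, a = q | a = r], [\/ b = p, b = q | b = r] & [\/ c = p, c = q | c = r]].
Proof.
move=> n1 n2 n3 [] e1 [] e2 [] e3; try congruence; split;
  first [by apply: Or31|by apply: Or32|by apply: Or33].
Qed.

Lemma umul_neq0 k n : (0 < n)%N -> u k *+ n <> 0.
Proof.
move=> n0 H; have := congr1 fst H; have := congr1 snd H.
rewrite c1M c2M; move: k H; apply: Z6_ind => _ /=; lia.
Qed.

(** The squared length, in lattice coordinates. *)
Definition norm2 (z : Qlat) : int := z.1 * z.1 - z.1 * z.2 + z.2 * z.2.

Lemma le_norm (m n : int) : m <= m * m - m * n + n * n.
Proof.
have h1 : 4 * (m * m - m * n + n * n) = (2 * n - m) * (2 * n - m) + 3 * (m * m) by ring.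
have sq : 0 <= (2 * n - m) * (2 * n - m) by rewrite -expr2 sqr_ge0.
have [m1|m1] := leP m 1; last by nia.
have [m0|m0] := leP m 0; first by nia.
have -> : m = 1 by lia.
have [n0|n0] := leP n 0; nia.
Qed.

Section Geo.
Variables (R : realType) (eps : R) (h : Qlat -> hexagon).
Hypothesis heps : 0 < eps < (2 * Num.sqrt 3)^-1.
Hypotheses (hm : well_matched h).
Notation e := (offset eps).
Notation tip := (tip eps).
Notation linked := (clos_refl_trans _ (joined h)).
Implicit Types (p q d a b c : plane R) (x y z : Qlat) (j k s : 'Z_6) (m : Qlat * marking).

Lemma mkof_line s k : s = k \/ s = k + 3 -> mkof s (k + 3) = mkof s k /\ mkof s k = Stripe.
Proof.
have H : (s == k) || (s == k + 3) -> mkof s (k + 3) = mkof s k /\ mkof s k = Stripe.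
  by move: s k; do 2!apply: Z6_ind; vm_compute.
by case=> e1; apply: H; rewrite e1 eqxx ?orbT.
Qed.

Lemma linked_run x k s n : s = k \/ s = k + 3 ->
  (forall i, (0 < i < n)%N -> h (x + u k *+ i) = s) -> forall i, (i < n)%N ->
  linked (side_mk h x k 0) (side_mk h x k i) /\
  linked (side_mk h x k 0) (x + u k *+ i.+1, mkof (h (x + u k *+ i.+1)) (k + 3)).
Proof.
move=> hs H; elim=> [|i IH] lt.
  by split; [exact: rt_refl|apply: rt_step; exact: joined_next].
have [_ l2] := IH (ltnW lt); have e1 := H i.+1 lt.
have l3 : linked (side_mk h x k 0) (side_mk h x k i.+1).
  by move: l2; rewrite /side_mk e1 (proj1 (mkof_line hs)).
by split=> //; apply: rt_trans l3 _; apply: rt_step; exact: joined_next.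
Qed.

Lemma stripe_centre x k s : s = k \/ s = k + 3 -> h x = s ->
  placed_mk eps h (x, mkof (h x) k) (pos R x + bend eps s).
Proof.
move=> hs hx; rewrite hx (proj2 (mkof_line hs)); apply/stripe_piece => //.
have := offset_gt0 heps; have := offset_lt heps => e1 e2.
by exists 0; rewrite hx /ray scale0r addr0; split=> //; lra.
Qed.

(** An infinite straight run would be unbounded. *)
Lemma run_ends x k s a b c : s = k \/ s = k + 3 ->
  mk_path eps h (side_mk h x k 0) = triangle_boundary a b c ->
  exists n, (0 < n)%N /\ h (x + u k *+ n) <> s.
Proof.
move=> hs hp; apply: contrapT => no.
have H i : h (x + u k *+ i.+1) = s by apply: contrapT => ne; apply: no; exists i.+1.
apply: (@boundary_bounded _ a b c (pos R x + bend eps s) (U R k)); first exact: dotUU.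
move=> i; rewrite -hp; exists (side_mk h x k i.+1).
  apply: (proj1 (@linked_run x k s i.+2 hs _ i.+1 _)) => // -[//|l] _; exact: H.
have := @stripe_centre (x + u k *+ i.+1) k s hs (H i).
by rewrite posD posM -UE addrAC.
Qed.

(** A path has two arms at the bend of a corner marking. *)
Lemma tip_vertex x j m a b c : det (b - a) (c - a) != 0 -> mk_path eps h m = triangle_boundary a b c ->
  corner h x j -> linked m (x, mkof (h x) j) -> [\/ tip x j = a, tip x j = b | tip x j = c].
Proof.
move=> hD hp cx l; have e1 := offset_lt heps.
have W q : placed_mk eps h (x, mkof (h x) j) q -> triangle_boundary a b c q.
  by move=> H; rewrite -hp; exists (x, mkof (h x) j).
apply: (@boundary_vertex _ a b c (tip x j) ((2^-1 - e) *: U R j) ((2^-1 - e) *: U R (j + 1))) => //.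
- rewrite (_ : det _ _ = (2^-1 - e) ^+ 2 * det (U R j) (U R (j + 1))); last by rewrite /det !plane_coordE; ring.
  rewrite detUU; apply: lt0r_neq0; rewrite mulr_gt0 ?exprn_gt0 ?divr_gt0 ?sqrtr_gt0 //; lra.
- apply: W; apply/corner_piece => //; left; exists 0; rewrite ray0; split=> //; lra.
- move=> t ht; apply: W; apply/corner_piece => //; left; exists (t * (2^-1 - e)).
  by split; [nra|rewrite /ray scalerA].
- move=> t ht; apply: W; apply/corner_piece => //; right; exists (t * (2^-1 - e)).
  by split; [nra|rewrite /ray' scalerA].
Qed.

Lemma vertices_equilateral a b c p q r : equilateral a b c -> p <> q -> q <> r -> r <> p ->
  [\/ p = a, p = b | p = c] -> [\/ q = a, q = b | q = c] -> [\/ r = a, r = b | r = c] ->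
  dist p q = dist p r.
Proof.
have C a' b' : dist a' b' = dist b' a' by rewrite /dist /dot !plane_coordE; congr Num.sqrt; ring.
case=> _ e1 e2 n1 n2 n3 [] hp [] hq [] hr; subst p q r => //; rewrite ?(C b a) ?(C c b) ?(C a c); congruence.
Qed.

Lemma first_time (A : pred nat) : (exists n, (0 < n)%N /\ A n) ->
  exists n, [/\ (0 < n)%N, A n & forall i, (0 < i < n)%N -> ~~ A i].
Proof.
case=> n [n0 pn]; have ex : exists n, (0 < n)%N && A n by exists n; rewrite n0.
exists (ex_minn ex); case: ex_minnP => l /andP[l0 pl] hl; split=> // i /andP[i0 il].
by apply/negP => pi; move: il; rewrite ltnNge hl // i0.
Qed.

Lemma N1_stripes_end : N1 eps h -> stripes_end h.
Proof.
move=> n1 x; set k := h x.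
have [a [b [c [_ hp]]]] := n1 (side_mk h x (k + 3) 0).
have [|n [n0 hn]] := @run_ends x (k + 3) k a b c _ hp; first by right; rewrite Z6E.
by exists n; rewrite -mulNrn -u3.
Qed.

(** The two straight runs that leave a corner end at bends, so the corner and
    the two ends are the vertices of the path, which is equilateral. *)
Lemma N1_corners_close : N1 eps h -> corners_close h.
Proof.
move=> n1 x j cx; have [a [b [c [heq hp]]]] := n1 (side_mk h x j 0).
have e1 := offset_lt heps; have e0 := offset_gt0 heps; have hD := equilateral_det heq.
have sj : j = j \/ j = j + 3 by left.
have sj1 : j + 4 = j + 1 \/ j + 4 = j + 1 + 3 by right; rewrite Z6E.
have m1 : side_mk h x (j + 1) 0 = side_mk h x j 0 by rewrite /side_mk addr0 mkof_corner1.
have [n' [n'0 hn']] := run_ends sj hp.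
have hp1 := hp; rewrite -m1 in hp1; have [k' [k'0 hk']] := run_ends sj1 hp1.
have [|n [n0 hn nmin]] := @first_time (fun i => h (x + u j *+ i) != j); first by exists n'; split=> //; apply/eqP.
have [|k [k0 hk kmin]] := @first_time (fun i => h (x + u (j + 1) *+ i) != j + 4).
  by exists k'; split=> //; apply/eqP.
have {}nmin i : (0 < i < n)%N -> h (x + u j *+ i) = j by move/nmin/negPn/eqP.
have {}kmin i : (0 < i < k)%N -> h (x + u (j + 1) *+ i) = j + 4 by move/kmin/negPn/eqP.
have [|_ ly] := linked_run sj nmin (i := n.-1); first by rewrite prednK.
have [|_ lz] := linked_run sj1 kmin (i := k.-1); first by rewrite prednK.
rewrite !prednK // ?Z6E in ly lz; rewrite m1 in lz.
have cy : corner h (x + u j *+ n) (j + 2).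
  have := @turn h hm (x + u j *+ n.-1) j; rewrite -addrA -mulrSr prednK //; apply; last exact/eqP.
  have [->|i0] := posnP n.-1; first by rewrite addr0; case/andP: cx.
  by rewrite nmin ?ccwE // i0 ltn_predL.
have cz : corner h (x + u (j + 1) *+ k) (j + 4).
  have F : ~~ ccw (h (x + u (j + 1) *+ k.-1)) (j + 1).
    have [->|i0] := posnP k.-1; first by rewrite addr0; case/andP: cx.
    by rewrite kmin ?ccwE // i0 ltn_predL.
  have := after_cw hm F; rewrite -addrA -mulrSr prednK // !Z6E => H; apply/cornerP; rewrite !Z6E.
  by case: H => // H; [left|move/eqP: hk|right].
have ey : mkof (h (x + u j *+ n)) (j + 3) = mkof (h (x + u j *+ n)) (j + 2).
  by rewrite -(mkof_corner1 cy) Z6E.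
rewrite ey in ly.
have lx : linked (side_mk h x j 0) (x, mkof (h x) j) by rewrite /side_mk addr0; exact: rt_refl.
have vx := tip_vertex hD hp cx lx; have vy := tip_vertex hD hp cy ly; have vz := tip_vertex hD hp cz lz.
have ty := tip_end eps x j n.
have tz : tip (x + u (j + 1) *+ k) (j + 4) = ray' eps x j (k%:R - 2 * e).
  rewrite /tip /ray' /bend posD posM -UE !Z6E U4 U5.
  by apply: plane_ext; rewrite !plane_coordE; field.
rewrite ty in vy; rewrite tz in vz.
have n1' : 1 <= n%:R :> R by rewrite ler1n.
have k1' : 1 <= k%:R :> R by rewrite ler1n.
set t := n%:R - 2 * e in ty vy; set t' := k%:R - 2 * e in tz vz.
have t0 : 0 < t by rewrite /t; lra.
have t0' : 0 < t' by rewrite /t'; lra.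
have d1 : dot (tip x j - ray eps x j t) (tip x j - ray eps x j t) = t ^+ 2.
  rewrite (_ : tip x j - _ = - t *: U R j); last by rewrite /ray /tip; apply: plane_ext; rewrite !plane_coordE; ring.
  by rewrite !dotE dotUU; ring.
have d2 : dot (tip x j - ray' eps x j t') (tip x j - ray' eps x j t') = t' ^+ 2.
  rewrite (_ : tip x j - _ = - t' *: U R (j + 1)); last by rewrite /ray' /tip; apply: plane_ext; rewrite !plane_coordE; ring.
  by rewrite !dotE dotUU; ring.
have d3 : dot (ray eps x j t - ray' eps x j t') (ray eps x j t - ray' eps x j t') = t ^+ 2 - t * t' + t' ^+ 2.
  rewrite (_ : _ - _ = t *: U R j - t' *: U R (j + 1)); last by rewrite /ray' /ray; apply: plane_ext; rewrite !plane_coordE; ring.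
  by rewrite !dotE !dotUU (dotC (U R (j + 1)) (U R j)) dotU1; field.
have z0 : dot (0 : plane R) 0 = 0 by rewrite /dot /=; ring.
have ne1 : tip x j <> ray eps x j t by move=> E; move: d1; rewrite E subrr z0; nra.
have ne2 : ray eps x j t <> ray' eps x j t' by move=> E; move: d3 (mulr_gt0 t0 t0') (sqr_ge0 (t - t')); rewrite E subrr z0; lra.
have ne3 : ray' eps x j t' <> tip x j by move=> E; move: d2; rewrite E subrr z0; nra.
have := vertices_equilateral heq ne1 ne2 ne3 vx vy vz => /dist_dot; rewrite d1 d2 => tt.
have {}tt : t = t' by nra.
have nk : n = k by apply/eqP; rewrite -(eqr_nat R); apply/eqP; exact: (addIr (- (2 * e)) tt).
subst k; exists n; split=> //; first by move=> i hi; rewrite nmin ?kmin.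
by split; apply/eqP.
Qed.

(** A stripe is followed backwards to the corner where its side starts. *)
Lemma ends_tri m : corners_close h -> stripes_end h -> exists x j n, triangle_at h x j n /\ on_tri h x j n m.
Proof.
move=> hc he.
have corner_case x j mk : mk = mkof (h x) j -> corner h x j ->
    exists x' j' n, triangle_at h x' j' n /\ on_tri h x' j' n (x, mk).
  move=> -> cx; have [n tn] := hc _ _ cx; exists x, j, n; split=> //.
  by exists 0%N; [case: tn|apply: Or31; rewrite /side_mk addr0].
case: m => x mk; set k := h x.
have C1 : mk = mkof k (k + 1) -> exists x' j' n, triangle_at h x' j' n /\ on_tri h x' j' n (x, mk).
  by move=> e1; apply: (corner_case _ _ _ e1); apply/cornerP; left; rewrite Z6E.
have C4 : mk = mkof k (k + 4) -> exists x' j' n, triangle_at h x' j' n /\ on_tri h x' j' n (x, mk).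
  by move=> e1; apply: (corner_case _ _ _ e1); apply/cornerP; right; rewrite Z6E.
have emk : [\/ mk = mkof k k, mk = mkof k (k + 1) | mk = mkof k (k + 4)].
  by rewrite !mkofD -{2}[k]addr0 mkofD; case: mk {C1 C4}; [apply: Or31|apply: Or32|apply: Or33].
case: emk => [em|//|//].
have [n' hn'] := he x.
have n'0 : (0 < n')%N by rewrite lt0n; apply/eqP => n0; apply: hn'; rewrite n0 mulr0n subr0.
have [|n [n0 hn nmin]] := @first_time (fun i => h (x - u k *+ i) != k); first by exists n'; split=> //; apply/eqP.
have {}nmin i : (i < n)%N -> h (x - u k *+ i) = k.
  have [->|i0 lt] := posnP i; first by rewrite subr0.
  by apply/eqP; apply: contraT => ne; move: (nmin i); rewrite i0 lt ne => /(_ isT).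
have cw : corner h (x - u k *+ n) k.
  have C : ccw (h (x - u k *+ n)) k.
    rewrite hm (_ : _ + u k = x - u k *+ n.-1); last by rewrite -{1}(prednK n0); qvec.
    by rewrite nmin ?ltn_predL // ccwE.
  by apply/cornerP; case/ccw_true: C => H; [move/eqP: hn|left|right].
have [N tN] := hc _ _ cw; exists (x - u k *+ n), k, N; split=> //.
exists n; last by apply: Or31; rewrite /side_mk subrK em.
rewrite ltnNge; apply/negP => le; case: (tN) => N0 _ _ [+ _]; apply.
rewrite (_ : x - u k *+ n + u k *+ N = x - u k *+ (n - N)); last first.
  by rewrite -{1}(subnK le) mulrnDr opprD addrA subrK.
by apply: nmin; rewrite ltn_subrL N0 n0.
Qed.

Lemma tri_equilateral x j n : triangle_at h x j n -> equilateral (tip x j) (tip (x + u j *+ n) (j + 2))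
  (tip (x + u (j + 1) *+ n) (j + 4)).
Proof.
move=> [n0 _ _ _]; have e1 := offset_lt heps; have e0 := offset_gt0 heps.
have n1 : 1 <= n%:R :> R by rewrite ler1n.
have D y k : dot (tip y k - tip (y + u k *+ n) (k + 2)) (tip y k - tip (y + u k *+ n) (k + 2)) = (n%:R - 2 * e) ^+ 2.
  rewrite tip_end (_ : tip y k - _ = - (n%:R - 2 * e) *: U R k).
    by rewrite !dotE dotUU; ring.
  by rewrite /ray /tip; apply: plane_ext; rewrite !plane_coordE; ring.
have D1 := D x j; have D2 := D (x + u j *+ n) (j + 2); have D3 := D (x + u (j + 1) *+ n) (j + 4).
rewrite third_vertex Z6E in D2.
rewrite Z6E (_ : x + u (j + 1) *+ n + u (j + 4) *+ n = x) in D3; last by qvec.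
split; [|by rewrite /dist D1 D2|by rewrite /dist D2 D3].
move=> E; move: D1; rewrite E subrr (_ : dot _ _ = 0); last by rewrite /dot /=; ring.
nra.
Qed.

Lemma corners_close_N1 : corners_close h -> stripes_end h -> N1 eps h.
Proof.
move=> hc he m; have [x [j [n [t o]]]] := ends_tri m hc he.
exists (tip x j), (tip (x + u j *+ n) (j + 2)), (tip (x + u (j + 1) *+ n) (j + 4)); split.
  exact: tri_equilateral.
by rewrite (path_tri heps hm hc t o).
Qed.

Lemma dot_norm2 z : dot (pos R z) (pos R z) = (norm2 z)%:~R.
Proof. by rewrite dot_pos /norm2; field. Qed.

(** With l <= norm2 z this says that the direction of the bend points to a vertex
    of the Voronoi cell of 0. *)
Lemma bend_dot i z : exists l : int, [/\ dot (U R i + U R (i + 1)) (pos R z) = 3 / 2 * l%:~R, l <= norm2 z & 0 < norm2 z \/ z = 0].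
Proof.
have n0 : 0 < norm2 z \/ z = 0.
  have [z0|ne] := pselect (z = 0); [by right|left].
  rewrite /norm2; case: z ne => m n /= ne.
  have : m <> 0 \/ n <> 0.
    by have [m0|m0] := pselect (m = 0); [right=> n0; apply: ne; rewrite m0 n0|left].
  by move=> [] ?; nia.
have S (l : int) : l <= norm2 z -> dot (U R i + U R (i + 1)) (pos R z) = 3 / 2 * l%:~R ->
   exists l : int, [/\ dot (U R i + U R (i + 1)) (pos R z) = 3 / 2 * l%:~R, l <= norm2 z & 0 < norm2 z \/ z = 0].
  by exists l.
move: S; rewrite !UE -posD dot_pos; move: i; apply: Z6_ind => S.
- by apply: (S z.1); [exact: le_norm|rewrite /=; field].
- by apply: (S z.2); [have := le_norm z.2 z.1; rewrite /norm2; lia|rewrite /=; field].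
- by apply: (S (z.2 - z.1)); [have := le_norm (z.2 - z.1) z.2; rewrite /norm2; lia|rewrite /=; field].
- by apply: (S (- z.1)); [have := le_norm (- z.1) (- z.2); rewrite /norm2; lia|rewrite /=; field].
- by apply: (S (- z.2)); [have := le_norm (- z.2) (- z.1); rewrite /norm2; lia|rewrite /=; field].
- by apply: (S (z.1 - z.2)); [have := le_norm (z.1 - z.2) z.1; rewrite /norm2; lia|rewrite /=; field].
Qed.

Lemma tip_closest x i y : y <> x -> dist (tip x i) (pos R x) < dist (tip x i) (pos R y).
Proof.
move=> ne; have e1 := offset_lt heps; have e0 := offset_gt0 heps.
have -> : y = x + (y - x) by rewrite addrC subrK.
set z := y - x; have [l [hl ln [zp|z0]]] := bend_dot i z; last first.
  by case: ne; rewrite -[y](subrK x) -/z z0 add0r.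
have zi : 1 <= (norm2 z)%:~R :> R by rewrite ler1z.
have li : l%:~R <= (norm2 z)%:~R :> R by rewrite ler_int.
rewrite /dist; have -> : tip x i - pos R x = bend eps i by rewrite /tip addrAC subrr add0r.
have -> : tip x i - pos R (x + z) = bend eps i - pos R z by rewrite posD /tip opprD addrACA subrr add0r.
have E : dot (bend eps i - pos R z) (bend eps i - pos R z) =
    dot (bend eps i) (bend eps i) + ((norm2 z)%:~R - 2 * e * l%:~R).
  have -> : (norm2 z)%:~R = dot (pos R z) (pos R z) by rewrite dot_norm2.
  have -> : 2 * e * l%:~R = 2 * dot (bend eps i) (pos R z).
    by rewrite /bend dotZl hl; field.
  by move: (bend eps i) (pos R z) => B Z; rewrite /dot !plane_coordE; ring.
have pos0 : 0 < (norm2 z)%:~R - 2 * e * l%:~R :> R by nra.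
rewrite ltr_sqrt E; first by rewrite ltrDl.
by apply: ltr_wpDl => //; rewrite /dot -!expr2 addr_ge0 ?sqr_ge0.
Qed.

Lemma voronoi_tip x i : voronoi x (tip x i).
Proof. by move=> y; have [->|/eqP ne] := eqVneq y x; [|apply/ltW/tip_closest]. Qed.

Lemma voronoi_tip_uniq x y i : voronoi y (tip x i) -> y = x.
Proof.
move=> H; apply: contrapT => ne.
by have := lt_le_trans (tip_closest i ne) (H x); rewrite ltxx.
Qed.

Lemma tri_expanded x j n : corners_close h -> triangle_at h x j n ->
  expanded eps h x (x + u j *+ n) (x + u (j + 1) *+ n).
Proof.
move=> hc t; have n0 : (0 < n)%N by case: t.
exists (tip x j), (tip (x + u j *+ n) (j + 2)), (tip (x + u (j + 1) *+ n) (j + 4)).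
split; [|exact: voronoi_tip|exact: voronoi_tip|exact: voronoi_tip].
split; first exact: tri_equilateral t.
exists (side_mk h x j 0); apply: (path_tri heps hm hc t).
by exists 0%N => //; apply: Or31.
Qed.

(** Two equal triangle boundaries have the same vertices, and each vertex of the
    path lies in the interior of a single Voronoi cell. *)
Lemma expanded_tri x y z : corners_close h -> stripes_end h -> expanded eps h x y z ->
  exists x' j n, let V := [:: x'; x' + u j *+ n; x' + u (j + 1) *+ n] in
    [/\ triangle_at h x' j n, [/\ x \in V, y \in V & z \in V], x <> y, y <> z & z <> x].
Proof.
move=> hc he [a [b [c [[heq [m hp]] va vb vc]]]].
have [x' [j [n [t o]]]] := ends_tri m hc he; exists x', j, n => V.
have hD := equilateral_det heq.
have t2 := tri_rot hm t hc; have t3 := tri_rot2 hm hc t.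
have L x1 j1 n1 : triangle_at h x1 j1 n1 -> on_tri h x' j n (side_mk h x1 j1 0) ->
    [\/ tip x1 j1 = a, tip x1 j1 = b | tip x1 j1 = c].
  move=> [_ cx _ _] o1; apply: (tip_vertex hD hp cx).
  by have := proj2 (linked_tri hm _ hc t o) o1; rewrite /side_mk addr0.
have n0 : (0 < n)%N by case: t.
have A := L _ _ _ t; have B := L _ _ _ t2; have C := L _ _ _ t3.
have {}A := A (ex_intro2 _ _ 0%N n0 (Or31 _ _ erefl)).
have {}B := B (ex_intro2 _ _ 0%N n0 (Or32 _ _ erefl)).
have {}C := C (ex_intro2 _ _ 0%N n0 (Or33 _ _ erefl)).
have hD' := equilateral_det (tri_equilateral t).
set p := tip x' j in A hD'; set q := tip (x' + u j *+ n) (j + 2) in B hD'.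
set r := tip (x' + u (j + 1) *+ n) (j + 4) in C hD'.
have npq : q <> p by move=> E; move: hD'; rewrite E subrr /det /= !mul0r subrr eqxx.
have npr : r <> p by move=> E; move: hD'; rewrite E subrr /det /= !mulr0 subrr eqxx.
have nqr : q <> r by move=> E; move: hD'; rewrite E /det mulrC subrr eqxx.
have [a' b' c'] := three_points npq npr nqr A B C.
have nab : a <> b by move=> E; move: hD; rewrite E subrr /det /= !mul0r subrr eqxx.
have nca : c <> a by move=> E; move: hD; rewrite E subrr /det /= !mulr0 subrr eqxx.
have nbc : b <> c by move=> E; move: hD; rewrite E /det mulrC subrr eqxx.
have vV w d : voronoi w d -> [\/ d = p, d = q | d = r] ->
    [\/ d = p /\ w = x', d = q /\ w = x' + u j *+ n | d = r /\ w = x' + u (j + 1) *+ n].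
  by move=> vw [] E; rewrite E in vw; have := voronoi_tip_uniq vw; [move=> H; apply: Or31|move=> H; apply: Or32|move=> H; apply: Or33].
have d12 : x' <> x' + u j *+ n by rewrite -[X in X = _]addr0 => /addrI/esym; apply: umul_neq0.
have d13 : x' <> x' + u (j + 1) *+ n by rewrite -[X in X = _]addr0 => /addrI/esym; apply: umul_neq0.
have d23 : x' + u j *+ n <> x' + u (j + 1) *+ n.
  by move/addrI/eqP; rewrite eq_sym -subr_eq0 -mulrnBl -u2 => /eqP; apply: umul_neq0.
by case: (vV _ _ va a') (vV _ _ vb b') (vV _ _ vc c') => [] [ea ->] [] [eb ->] [] [ec ->];
  try (by case: nab; rewrite ea eb); try (by case: nca; rewrite ea ec); try (by case: nbc; rewrite eb ec);
  split=> //; (try by split; rewrite /V !inE eqxx ?orbT); by apply: nesym.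
Qed.
End Geo.

(** * Levels are the vertices of the arrangement *)

Lemma mul2_inj (a b : Qlat) : a *+ 2 = b *+ 2 -> a = b.
Proof.
move=> H; have := congr1 fst H; have := congr1 snd H; rewrite !c1M !c2M => h2 h1.
by apply: Qext; lia.
Qed.

Lemma u_odd j w : u j <> w *+ 2.
Proof.
move=> H; have := congr1 fst H; have := congr1 snd H; rewrite c1M c2M.
by move: j {H}; apply: Z6_ind => /=; lia.
Qed.

Lemma mul_exp_eq0 (a : Qlat) k : a *+ 2 ^ k = 0 -> a = 0.
Proof.
move=> H; have := congr1 fst H; have := congr1 snd H; rewrite !c1M !c2M => /eqP h2 /eqP h1.
move: h1 h2; rewrite !mulrn_eq0 expn_eq0 /= => /eqP h1 /eqP h2; exact: Qext.
Qed.

Section Levels.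
Variables (R : realType) (eps : R) (h : Qlat -> hexagon) (c : nat -> Qlat).
Hypothesis heps : 0 < eps < (2 * Num.sqrt 3)^-1.
Hypotheses (hn : nest h c) (hc : corners_close h) (he : stripes_end h).
Let hm : well_matched h := nest_wm hn.
Let hesc : points_escape c := corners_close_escape hn hc.
Implicit Types (x y z : Qlat) (j : 'Z_6).
Notation level := (level c).

(** A face of the triangular lattice L_k, with j1, j2, j3 the directions of its
    sides. *)
Definition level_triangle x y z := exists k j1 j2 j3,
  [/\ level k x, y = x + u j1 *+ 2 ^ k, z = y + u j2 *+ 2 ^ k & x = z + u j3 *+ 2 ^ k].

Lemma expanded_level x y z : expanded eps h x y z -> level_triangle x y z.
Proof.
case/(expanded_tri heps hm hc he) => x' [j [n [t [vx vy vz] nxy nyz nzx]]].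
have [k [Lk nL]] := escape_level (hesc x').
have cx : corner h x' j by case: t.
have en : n = (2 ^ k)%N := tri_uniq t (nest_tri hn Lk nL cx).
rewrite {}en in t vx vy vz; set V := (V in x \in V) in vx vy vz.
have D a b : a \in V -> b \in V -> a <> b -> exists i, b = a + u i *+ 2 ^ k.
  rewrite !inE => /or3P[] /eqP-> /or3P[] /eqP-> // _.
  - by exists j.
  - by exists (j + 1).
  - by exists (j + 3); qvec.
  - by exists (j + 2); qvec.
  - by exists (j + 4); qvec.
  - by exists (j + 5); qvec.
have [j1 e1] := D _ _ vx vy nxy; have [j2 e2] := D _ _ vy vz nyz; have [j3 e3] := D _ _ vz vx nzx.
exists k, j1, j2, j3; split=> //.
by move: vx; rewrite !inE => /or3P[] /eqP-> //; apply: levelD.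
Qed.

(** The midpoints of the sides of a face of L_k are points of Q only if k > 0,
    and cut it into faces of L_(k-1). *)
Lemma corner_level x y z p q r : level_triangle x y z -> nested p q r x y z ->
  [/\ level_triangle x r q, level_triangle r y p & level_triangle q p z].
Proof.
case=> k [j1 [j2 [j3 [Lx ey ez ex]]]] [mp mq mr].
case: k Lx ey ez ex => [|k] Lx ey ez ex.
  case: (@u_odd j1 (r - x)); rewrite mulrnBl mr ey expn0 mulr1n; qvec.
have Lk := levelS hn Lx.
have sum0 : u j1 + u j2 + u j3 = 0.
  apply: (@mul_exp_eq0 _ k.+1); apply: (addrI x); rewrite [RHS]addr0 [RHS]ex ez ey.
  by rewrite !mulrnDl !addrA.
have e3 : u j3 = - (u j1 + u j2) by apply/eqP; rewrite -addr_eq0 addrC sum0.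
have er : r = x + u j1 *+ 2 ^ k by apply: mul2_inj; rewrite mr ey; qvec.
have ep : p = x + u j1 *+ 2 ^ k *+ 2 + u j2 *+ 2 ^ k by apply: mul2_inj; rewrite mp ez ey; qvec.
have eq' : q = x + (u j1 + u j2) *+ 2 ^ k by apply: mul2_inj; rewrite mq ez ey; qvec.
split; exists k, j1, j2, j3; rewrite e3 ?er ?ep ?eq' ?ez ?ey; split=> //; try qvec.
- exact: levelD.
- exact: levelD.
Qed.

Lemma arrangement_level x y z : arrangement eps h x y z -> level_triangle x y z.
Proof.
elim=> [a b d|a b d p q r _ IH _ nst|a b d p q r _ IH _ nst|a b d p q r _ IH _ nst].
- exact: expanded_level.
- by case: (corner_level IH nst).
- by case: (corner_level IH nst).
- by case: (corner_level IH nst).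
Qed.

Lemma dist_step x j n : dist (pos R x) (pos R (x + u j *+ n)) = n%:R.
Proof.
rewrite /dist posD posM -UE (_ : _ - _ = (- n%:R) *: U R j); last by apply: plane_ext; rewrite !plane_coordE; ring.
by rewrite !dotE dotUU mulr1 mulrNN -expr2 sqrtr_sqr ger0_norm.
Qed.

Lemma level_vertices_sub k x : level_vertices eps h k x -> level k x.
Proof.
case=> y [z [/arrangement_level[m [j1 [_ [_ [Lm -> _ _]]]]]]].
rewrite dist_step -natrX => /eqP; rewrite eqr_nat => /eqP e1.
suff <- : m = k by [].
by apply/eqP; rewrite -(eqn_exp2l m k (isT : 1 < 2)%N) e1.
Qed.

(** Let x be in L_m but not in L_(m+1), with k <= m.  From the path triangle of
    side 2^m at x one descends to the corner triangle at x of each smaller side: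
    the medial triangle is always a path triangle. *)
Lemma sub_level_vertices k x : level k x -> level_vertices eps h k x.
Proof.
move=> Lk; have [m [Lm nL]] := escape_level (hesc x).
have km : (k <= m)%N by rewrite leqNgt; apply/negP => lt; apply: nL; exact: (level_le hn lt Lk).
have [j cx] : exists j, corner h x j by exists (h x + 1); apply/cornerP; left; rewrite Z6E.
have A i : (i <= m)%N -> arrangement eps h x (x + u j *+ 2 ^ (m - i)) (x + u (j + 1) *+ 2 ^ (m - i)).
  elim: i => [|i IH] lt.
    rewrite subn0; apply: arr_path; exact: (tri_expanded heps hm hc (nest_tri hn Lm nL cx)).
  have := IH (ltnW lt); set n := (m - i.+1)%N; have -> : (m - i)%N = n.+1 by rewrite /n; lia.
  move=> T; set r := x + u j *+ 2 ^ n.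
  have Lx : level n.+1 x by apply: (level_le hn _ Lm); rewrite /n; lia.
  have hr : h r = j by rewrite /r (nest_mid hn _ Lx); case/andP: cx => ->.
  have cr : corner h r (j + 1) by apply/cornerP; left; rewrite hr Z6E.
  have nr : ~ level n.+1 r.
    move=> /(level_diff Lx)[w] /addrI; rewrite expnS mulrnA => H.
    apply: (@u_odd j w); apply/eqP; rewrite -subr_eq0; apply/eqP; apply: (@mul_exp_eq0 _ n).
    by rewrite mulrnBl H subrr.
  have Lr : level n r by apply/levelD/(levelS hn).
  have tr := nest_tri hn Lr nr cr.
  have := tri_expanded heps hm hc (tri_rot hm tr hc); rewrite !Z6E.
  rewrite (_ : r + u (j + 1) *+ 2 ^ n + u (j + 4) *+ 2 ^ n = r); last by qvec.
  rewrite (_ : r + u (j + 1) *+ 2 ^ n + u (j + 3) *+ 2 ^ n = x + u (j + 1) *+ 2 ^ n); last by rewrite /r; qvec.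
  move=> E; apply: (arr_corner1 T E); split; rewrite /midpoint /r; qvec.
have := A (m - k)%N (leq_subr _ _); rewrite subKn // => H.
by do 2!eexists; split; first exact: H; rewrite dist_step natrX.
Qed.

Lemma level_verticesE k : level_vertices eps h k = level k.
Proof. by apply/seteqP; split=> x; [exact: level_vertices_sub|exact: sub_level_vertices]. Qed.

End Levels.

(** * Singular lines *)

(** For the element q of the inverse limit: q is in no x + Z_2 3w. *)
Definition w_lines_escape (c : nat -> Qlat) := forall x j, exists k, forall t : int, ~ level c k (x + v j *~ t).

Section NonSingular.
Variables (R : realType) (eps : R).
Notation s3 := (Num.sqrt 3 : R).

Lemma w_direction j : exists w (s : R), (w = w1 R \/ w = w2 R \/ w = w2 R - w1 R) /\ pos R (v j) = s *: w.
Proof.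
have S w s : (w = w1 R \/ w = w2 R \/ w = w2 R - w1 R) -> pos R (v j) = s *: w ->
  exists w (s : R), (w = w1 R \/ w = w2 R \/ w = w2 R - w1 R) /\ pos R (v j) = s *: w by exists w, s.
have E x y d : pos R x = (y : R) *: d <-> x.1%:~R *: a1 R + x.2%:~R *: a2 R = y *: d by [].
move: S; move: j; apply: Z6_ind => S.
- by apply: (S (w1 R) 3); [by left|apply/E; rewrite /w1 /w2; move: (a1 R) (a2 R) => A B; apply: plane_ext; rewrite !plane_coordE /=; field].
- by apply: (S (w2 R) 3); [by right; left|apply/E; rewrite /w1 /w2; move: (a1 R) (a2 R) => A B; apply: plane_ext; rewrite !plane_coordE /=; field].
- by apply: (S (w2 R - w1 R) 3); [by right; right|apply/E; rewrite /w1 /w2; move: (a1 R) (a2 R) => A B; apply: plane_ext; rewrite !plane_coordE /=; field].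
- by apply: (S (w1 R) (- 3)); [by left|apply/E; rewrite /w1 /w2; move: (a1 R) (a2 R) => A B; apply: plane_ext; rewrite !plane_coordE /=; field].
- by apply: (S (w2 R) (- 3)); [by right; left|apply/E; rewrite /w1 /w2; move: (a1 R) (a2 R) => A B; apply: plane_ext; rewrite !plane_coordE /=; field].
- by apply: (S (w2 R - w1 R) (- 3)); [by right; right|apply/E; rewrite /w1 /w2; move: (a1 R) (a2 R) => A B; apply: plane_ext; rewrite !plane_coordE /=; field].
Qed.

(** A vector of Q parallel to w is an integral multiple of 3w. *)
Lemma w_lattice w : (w = w1 R \/ w = w2 R \/ w = w2 R - w1 R) ->
  exists j, forall z t, pos R z = t *: w -> exists n : int, z = v j *~ n.
Proof.
have e1 : w1 R = (1 / 2, s3 / 6) by rewrite /w1 /a1 /a2; apply: plane_ext; rewrite !plane_coordE /=; field.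
have e2 : w2 R = (0, s3 / 3) by rewrite /w2 /a1 /a2; apply: plane_ext; rewrite !plane_coordE /=; field.
have s0 : s3 != 0 by apply: lt0r_neq0; rewrite sqrtr_gt0.
have I (a b : int) : a%:~R = b%:~R :> R -> a = b by move/eqP; rewrite eqr_int => /eqP.
have key z t a b : pos R z = t *: ((a, s3 * b) : plane R) ->
    z.1%:~R - 2^-1 * z.2%:~R = t * a /\ z.2%:~R / 2 = t * b.
  move=> H; have h1 : (pos R z).1 = t * a by rewrite H.
  have h2 : (pos R z).2 = t * (s3 * b) by rewrite H.
  rewrite pos1 in h1; rewrite pos2 in h2; split=> //; apply: (mulIf s0).
  by rewrite (mulrC _ s3) mulrCA -[RHS]mulrA [b * s3]mulrC -h2 mulrCA [s3 * _]mulrC.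
case=> [|[|]] ->; [exists 0|exists 1|exists 2] => z t.
- rewrite e1 => /key[h1 h2].
  exists z.2; apply: Qext; rewrite /v !coordE /=; last by lia.
  by rewrite (_ : _ *~ _ = 2 * z.2); [apply: I; rewrite intrM; lra|lia].
- rewrite e2 => /key[h1 h2].
  exists z.1; apply: Qext; rewrite /v !coordE /=; first by lia.
  by rewrite (_ : _ *~ _ = 2 * z.1); [apply: I; rewrite intrM; lra|lia].
- rewrite (_ : w2 R - w1 R = (- 2^-1, s3 * 6^-1)); last first.
    by rewrite e1 e2; apply: plane_ext; rewrite !plane_coordE /=; field.
  move=> /key[h1 h2]; exists z.2; apply: Qext; rewrite /v !coordE /=; last by lia.
  by rewrite (_ : _ *~ _ = - z.2); [apply: I; rewrite intrN; lra|lia].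
Qed.

Variables (h : Qlat -> hexagon) (c : nat -> Qlat).
Hypothesis hl : forall k, level_vertices eps h k = level c k.

Lemma N2_w_lines_escape : N2 eps h <-> w_lines_escape c.
Proof.
split=> [n2 x j|ve [x [w [hw H]]]].
  apply: contrapT => no; apply: n2.
  have [w [s [hw es]]] := w_direction j; exists x, w; split=> // k.
  have [t Lt] : exists t : int, level c k (x + v j *~ t).
    by apply: contrapT => H; apply: no; exists k => t Lt; apply: H; exists t.
  exists (x + v j *~ t); rewrite hl; split=> //.
  by exists (t%:~R * s); rewrite posD posZ es scalerA.
have [j hj] := w_lattice hw; have [k hk] := ve x j; have [y [+ [t et]]] := H k.
rewrite hl => Ly; have [n en] : exists n : int, y - x = v j *~ n.
  by apply: (hj _ t); rewrite posD posN et addrAC subrr add0r.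
by apply: (hk n); rewrite -en addrC subrK.
Qed.

End NonSingular.

(** * Colours *)

(** (RT2), with the two tiles named by the vector between them. *)
Definition RT2h (h : Qlat -> hexagon) (f : Qlat -> bool) :=
  forall x j, red (TSTile (h x) (f x)) j = ~~ red (TSTile (h (x + v j)) (f (x + v j))) (j + 3).

(** The stripe is perpendicular to [v j]. *)
Definition perp (s : hexagon) (j : 'Z_6) := (s == j + 2) || (s == j + 5).

Lemma red_perpP s b j : perp s j -> red (TSTile s b) (j + 3) = ~~ red (TSTile s b) j.
Proof. by case/orP=> /eqP e; rewrite [in RHS]red_perp ?negbK //; [right|left]. Qed.

Lemma red_nonperp s b b' j : ~~ perp s j ->
  red (TSTile s b) (j + 3) = red (TSTile s b') j /\ red (TSTile s b) j = ((s == j + 1) || (s == j + 4)).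
Proof.
have H : ~~ perp s j ==> (red (TSTile s b) (j + 3) == red (TSTile s b') j) &&
    (red (TSTile s b) j == ((s == j + 1) || (s == j + 4))).
  by rewrite /perp; move: s j; do 2!apply: Z6_ind; case: b; case: b'; vm_compute.
by move=> n; have := implyP H n => /andP[/eqP-> /eqP->].
Qed.

Lemma perp3 s j : perp (s + 3) j = perp s j.
Proof. by apply/eqP; move: s j; do 2!apply: Z6_ind; vm_compute. Qed.

Lemma perp_class a s j : perp s j -> (s = a \/ s = a + 3) -> perp a j.
Proof. by move=> + [] e; rewrite e // perp3. Qed.

(** The stripes for which the diameter in direction [v j] is entirely red. *)
Definition red_class (s : hexagon) j := (s == j + 1) || (s == j + 4).

Lemma red_class3 s j : red_class (s + 3) j = red_class s j.
Proof. by apply/eqP; move: s j; do 2!apply: Z6_ind; vm_compute. Qed.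

Lemma red_classE j : ((red_class j j = false) * (red_class (j + 1)%R j = true) *
  (red_class (j + 3)%R j = false) * (red_class (j + 4)%R j = true))%type.
Proof. by move: j; apply: Z6_ind. Qed.

Lemma red_mixed s b : red (TSTile s b) (s + 1) = b.
Proof. by rewrite redE. Qed.

Lemma v3 j : v (j + 3) = - v j.
Proof. rewrite /v; qvec. Qed.

Lemma vmul_neq0 j n : (0 < n)%N -> v j *+ n <> 0.
Proof.
move=> n0 H; have := congr1 fst H; have := congr1 snd H.
rewrite c1M c2M /v !coordE; move: j H; apply: Z6_ind => _ /=; lia.
Qed.

Section Colours.
Variables (h : Qlat -> hexagon) (c : nat -> Qlat).
Hypotheses (hn : nest h c) (ve : w_lines_escape c).
Implicit Types (x y z b : Qlat) (j : 'Z_6).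
Notation level := (level c).

(** [v j] is a primitive vector. *)
Lemma vM_divides j (t : int) k z : v j *~ t = z *+ 2 ^ k -> exists q : int, t = q *+ 2 ^ k.
Proof.
move=> H; have := congr1 fst H; have := congr1 snd H; rewrite /v !coordE.
move: j {H}; apply: Z6_ind => /= h2 h1.
- by exists z.2; rewrite -h2; lia.
- by exists z.1; rewrite -h1; lia.
- by exists z.2; rewrite -h2; lia.
- by exists (- z.2); rewrite mulNrn -h2; lia.
- by exists (- z.1); rewrite mulNrn -h1; lia.
- by exists (- z.2); rewrite mulNrn -h2; lia.
Qed.

(** Here k is the deepest level met by the line through x in direction [v j], and
    b is the last point of that level on the line that is not beyond x. *)
Definition base j x b := exists k r, [/\ (r < 2 ^ k)%N, b = x - v j *+ r, level k b
  & forall t : int, ~ level k.+1 (x + v j *~ t)].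

Lemma base_exists j x : exists b, base j x b.
Proof.
have [k hk] := ve x j.
have [m [[t Lt] nL]] : exists m, (exists t : int, level m (x + v j *~ t)) /\
    forall t : int, ~ level m.+1 (x + v j *~ t).
  elim: k hk => [|k IH] hk; first by case: (hk 0); exact: level0.
  have [ex|no] := pselect (exists t : int, level k (x + v j *~ t)); first by exists k.
  by apply: IH => t Lt; apply: no; exists t.
pose r := ((- t) %% (2 ^ m)%:Z)%Z; pose q := ((- t) %/ (2 ^ m)%:Z)%Z.
have er : - t = q * (2 ^ m)%:Z + r := divz_eq _ _.
have m0 : (2 ^ m)%:Z != 0 by rewrite eqz_nat expn_eq0.
have r0 : 0 <= r := modz_ge0 _ m0.
have rl : r < (2 ^ m)%:Z by apply: ltz_pmod; rewrite ltz_nat expn_gt0.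
exists (x - v j *+ `|r|%N), m, `|r|%N; split=> //; first by rewrite -ltz_nat gez0_abs.
have -> : x - v j *+ `|r|%N = x + v j *~ t + (v j *~ q) *+ 2 ^ m; last exact: levelD.
have -> : t = - (q * (2 ^ m)%:Z + r) by rewrite -er opprK.
rewrite -{2}(gez0_abs r0) mulrNz mulrzDr mulrzA -!pmulrn opprD.
by rewrite addrA addrAC subrK.
Qed.

Lemma base_uniq j x b b' : base j x b -> base j x b' -> b = b'.
Proof.
case=> k [r [rk eb Lb nb]] [k' [r' [rk' eb' Lb' nb']]].
have W i s l b1 : b1 = x - v j *+ s -> level i b1 -> (forall t : int, ~ level l.+1 (x + v j *~ t)) -> (i <= l)%N.
  move=> e1 L1 n; rewrite leqNgt; apply/negP => lt; apply: (n (- s%:Z)).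
  by rewrite mulrNz -pmulrn -e1; exact: (level_le hn lt L1).
have kk : k = k' by apply/eqP; rewrite eqn_leq (W _ _ _ _ eb Lb nb') (W _ _ _ _ eb' Lb' nb).
subst k'; have [z ez] := level_diff Lb Lb'.
have : v j *~ (r%:Z - r'%:Z) = z *+ 2 ^ k.
  by apply: (addrI b); rewrite -ez eb eb' mulrzBr -!pmulrn addrA subrK.
case/vM_divides => q eq; suff : r = r' by move=> rr; rewrite eb eb' rr.
have q0 : q = 0.
  move: rk rk' eq; set M := (2 ^ k)%N => *; nia.
by move: eq; rewrite q0 mul0rn; lia.
Qed.

Lemma two_adic r : (0 < r)%N -> exists i s, r = (2 ^ i * (2 * s).+1)%N.
Proof.
elim/ltn_ind: r => r IH r0; have [o|e] := boolP (odd r).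
  by exists 0%N, r./2; rewrite mul1n -[LHS]odd_double_half o mul2n.
have e2 : r = r./2.*2 by rewrite -[LHS]odd_double_half (negbTE e).
have [||i [s es]] := IH r./2; [lia|lia|].
by exists i.+1, s; rewrite e2 es expnS -mul2n; lia.
Qed.

(** If the stripe of x were perpendicular to the line, then the other end of the
    edge of L_(k+1) through x would lie on the line too, because [v j] is congruent
    to [u (j + 2)] modulo 2Q. *)
Lemma level_nonperp k x j : level k x -> (forall t : int, ~ level k.+1 (x + v j *~ t)) -> ~~ perp (h x) j.
Proof.
move=> Lx nx; apply/negP => p.
have nL : ~ level k.+1 x by have := nx 0; rewrite mulr0z addr0.
have [a [La ha]] := nest_stripe hn Lx nL.
have pa := perp_class p ha; apply: (nx (2 ^ k)%:Z); rewrite -pmulrn.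
case/orP: pa => /eqP ea; subst a.
  rewrite (_ : x + _ = x + u (j + 2) *+ 2 ^ k + u j *+ 2 ^ k.+1); first exact: levelD.
  rewrite /v; qvec.
rewrite (_ : x + _ = x + u (j + 5) *+ 2 ^ k + u (j + 1) *+ 2 ^ k.+1); first exact: levelD.
rewrite /v; qvec.
Qed.

(** Modulo 2Q the points of the line in L_k alternate between two classes,
    those of the stripes in directions j and j + 1. *)
Lemma alternate k x j : level k x -> (forall t : int, ~ level k.+1 (x + v j *~ t)) ->
  red_class (h (x + v j *+ 2 ^ k)) j = ~~ red_class (h x) j.
Proof.
move=> Lx nx; have np := level_nonperp Lx nx.
have nL : ~ level k.+1 x by have := nx 0; rewrite mulr0z addr0.
have [a [La ha]] := nest_stripe hn Lx nL.
have S i : (exists w, x + v j *+ 2 ^ k = x + u a *+ 2 ^ k + u i *+ 2 ^ k + w *+ 2 ^ k.+1) ->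
    h (x + v j *+ 2 ^ k) = i \/ h (x + v j *+ 2 ^ k) = i + 3.
  exact: (nest_class hn La).
have T i : (exists w, x + v j *+ 2 ^ k = x + u a *+ 2 ^ k + u i *+ 2 ^ k + w *+ 2 ^ k.+1) ->
    red_class i j = ~~ red_class a j -> red_class (h (x + v j *+ 2 ^ k)) j = ~~ red_class (h x) j.
  move=> /S e1 e2; have -> : red_class (h x) j = red_class a j by case: ha => ->; rewrite ?red_class3.
  by rewrite -e2; case: e1 => ->; rewrite ?red_class3.
have : ~~ perp a j by apply/negP => pa; case/negP: np; case: ha => ->; rewrite ?perp3.
have [i ei] : exists i, a = j + i by exists (a - j); rewrite addrC subrK.
move: ei T {S La ha}; move: i; apply: Z6_ind => -> T np'.
- rewrite addr0 in T; by apply: (T (j + 1)); [exists 0; rewrite /v; qvec|rewrite !red_classE].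
- by apply: (T j); [exists 0; rewrite /v; qvec|rewrite !red_classE].
- by rewrite /perp eqxx in np'.
- by apply: (T (j + 1)); [exists (u j); rewrite /v; qvec|rewrite !red_classE].
- by apply: (T j); [exists (u (j + 1)); rewrite /v; qvec|rewrite !red_classE].
- by rewrite /perp eqxx orbT in np'.
Qed.

(** A point of the line at distance 2^i times an odd number from b is the
    midpoint of an edge of L_(i+1) perpendicular to the line. *)
Lemma base_perp x b j : base j x b -> (b == x) = ~~ perp (h x) j.
Proof.
case=> k [r [rk eb Lb nb]].
have nb' (t : int) : ~ level k.+1 (b + v j *~ t).
  by move: (nb (t - r%:Z)); rewrite eb mulrzBr -pmulrn addrAC addrA.
have [r0|r0] := posnP r.
  by move: eb Lb nb'; rewrite r0 mulr0n subr0 => -> Lb nb'; rewrite eqxx (level_nonperp Lb nb').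
have [i [s es]] := two_adic r0.
have ik : (i < k)%N by rewrite -(ltn_exp2l _ _ (isT : 1 < 2)%N) (leq_ltn_trans _ rk) // es leq_pmulr.
have ex : x = b + v j *+ r by rewrite eb subrK.
have p : perp (h x) j.
  have Lb' : level i.+1 b := level_le hn ik Lb.
  have hx : h x = j + 2 \/ h x = j + 2 + 3.
    apply: (nest_class hn Lb'); exists (u j + v j *+ s); rewrite ex es /v; qvec.
  by case: hx => ->; rewrite ?perp3 /perp eqxx.
rewrite p; apply/eqP => bx; move: ex; rewrite bx -[X in X = _]addr0 => /addrI/esym.
exact: vmul_neq0.
Qed.

(** The colour that the end of x in direction [v j] must have: perpendicular
    tiles transmit the colour of the last tile of the deepest level. *)
Definition front x j := red_class (h (projT1 (cid (base_exists j x)))) j.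

Lemma frontE x j b : base j x b -> front x j = red_class (h b) j.
Proof. by move=> hb; rewrite /front; have := projT2 (cid (base_exists j x)) => /base_uniq/(_ hb) ->. Qed.

Lemma front_nonperp x j : ~~ perp (h x) j -> front x j = red_class (h x) j.
Proof.
move=> np; have [b hb] := base_exists j x; rewrite (frontE hb).
by have := base_perp hb; rewrite np => /eqP->.
Qed.

(** Going one step along the line, the last point of the deepest level is either
    unchanged, and the new tile is perpendicular, or it is the new tile, of the
    opposite colour. *)
Lemma front_next x j : front x j = if perp (h (x + v j)) j then front (x + v j) j else ~~ front (x + v j) j.
Proof.
have [b hb] := base_exists j x; have := hb; case=> k [r [rk eb Lb nb]].
have nb' (t : int) y : (exists s : int, y = x + v j *~ s) -> ~ level k.+1 (y + v j *~ t).
  by case=> s ->; rewrite -addrA -mulrzDr; exact: nb.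
have [lt|ge] := ltnP r.+1 (2 ^ k).
  have hb' : base j (x + v j) b.
    exists k, r.+1; split=> //; first by rewrite eb mulrS opprD addrA addrK.
    by move=> t; apply: nb'; exists 1; rewrite mulr1z.
  have := base_perp hb'; rewrite (_ : (b == x + v j) = false) => [/esym/negbFE ->|].
    by rewrite (frontE hb) (frontE hb').
  apply/eqP => H; have : v j *+ r.+1 = 0; last exact: vmul_neq0.
  have : x + v j - v j *+ r.+1 = x + v j by rewrite -[RHS]H eb mulrS opprD addrA addrK.
  by rewrite -[RHS]subr0 => /addrI/oppr_inj.
have er : r.+1 = (2 ^ k)%N by apply/eqP; rewrite eqn_leq rk.
have hb' : base j (x + v j) (x + v j).
  exists k, 0%N; split=> //; first by rewrite expn_gt0.
  - by rewrite mulr0n subr0.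
  - rewrite (_ : x + v j = b + v j *+ 2 ^ k); last by rewrite -er mulrSr eb [RHS]addrA subrK.
    by rewrite /v mulrnDl addrA; do 2!apply: levelD.
  - by move=> t; apply: nb'; exists 1; rewrite mulr1z.
have := base_perp hb'; rewrite eqxx => /esym np; rewrite (negbTE np) (frontE hb) (frontE hb').
rewrite (_ : x + v j = b + v j *+ 2 ^ k); last by rewrite -er mulrSr eb [RHS]addrA subrK.
rewrite alternate ?negbK // => t; apply: nb'; exists (- r%:Z).
by rewrite mulrNz -pmulrn.
Qed.

(** One of each pair of opposite directions, to orient all lines. *)
Definition even6 (j : 'Z_6) := j \in [:: 0; 2; 4].

Lemma even6_3 j : even6 (j + 3) = ~~ even6 j.
Proof. by move: j; apply: Z6_ind; vm_compute. Qed.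

(** The colour in the direction perpendicular to the stripe, on the side that
    [towards_red] refers to. *)
Definition colour x := if even6 (h x + 1) then front x (h x + 1) else ~~ front x (h x + 4).

Lemma red_colour x j : even6 j -> red (TSTile (h x) (colour x)) j = front x j.
Proof.
move=> ej; have [p|np] := boolP (perp (h x) j); last first.
  by rewrite (proj2 (red_nonperp _ true np)) front_nonperp.
have e8 : (j + 3 = h x + 1) \/ j = h x + 1 by case/orP: p => /eqP ->; rewrite !Z6E; auto.
case: e8 => e9.
  have e4 : h x + 4 = j by rewrite -(addrK 3 j) e9; apply/eqP; move: (h x); apply: Z6_ind; vm_compute.
  rewrite -[LHS]negbK -red_perpP // e9 red_mixed /colour e4 -e9 even6_3 ej.
  by rewrite negbK.
by rewrite e9 red_mixed /colour -e9 ej.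
Qed.

Lemma colour_RT2 : RT2h h colour.
Proof.
have E x j : even6 j -> red (TSTile (h x) (colour x)) j = ~~ red (TSTile (h (x + v j)) (colour (x + v j))) (j + 3).
  move=> ej; rewrite red_colour // front_next; case: ifP => p.
    by rewrite red_perpP // negbK red_colour.
  by rewrite (proj1 (red_nonperp _ (colour (x + v j)) (negbT p))) red_colour.
move=> x j; have [ej|oj] := boolP (even6 j); first exact: E.
have := E (x + v j) (j + 3); rewrite even6_3 oj v3 addrK Z6E => /(_ isT) ->.
by rewrite negbK.
Qed.

(** The colour of a mixed end is forced by the next tile on the line that is not
    perpendicular to it. *)
Lemma RT2_uniq f f' : RT2h h f -> RT2h h f' -> f =1 f'.
Proof.
move=> hf hf' x; rewrite -[LHS](red_mixed (h x)) -[RHS](red_mixed (h x)).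
have K n y j : ~~ perp (h (y + v j *+ n)) j ->
    red (TSTile (h y) (f y)) j = red (TSTile (h y) (f' y)) j.
  elim: n y => [|n IH] y np.
    by rewrite addr0 in np; rewrite (proj2 (red_nonperp _ true np)) (proj2 (red_nonperp _ true np)).
  rewrite hf hf'; congr negb; have [p|np'] := boolP (perp (h (y + v j)) j).
    by rewrite !red_perpP //; congr negb; apply: IH; rewrite -addrA -mulrS.
  by rewrite !(proj1 (red_nonperp _ true np')).
set j := h x + 1; have [b [k [r [rk eb Lb nb]]]] := base_exists j x.
have nb' (t : int) : ~ level k.+1 (b + v j *~ t).
  by move: (nb (t - r%:Z)); rewrite eb mulrzBr -pmulrn addrAC addrA.
apply: (K (2 ^ k - r)%N).
have -> : x + v j *+ (2 ^ k - r) = b + v j *+ 2 ^ k.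
  by rewrite eb -{2}(subnK (ltnW rk)) mulrnDr addrA addrAC subrK.
apply: level_nonperp; first by rewrite /v mulrnDl addrA; do 2!apply: levelD.
by move=> t; rewrite -addrA pmulrn -mulrzDr; exact: nb'.
Qed.

End Colours.

(** * Double hexagons, colours and periods *)

(** The double hexagon whose outer arrows are the colours of a tile: counterclockwise
    for red. *)
Definition dtile (t : ts_tile) : dhex :=
  DHex (if towards_red t then black t + 1 else black t + 4) (black t).

Lemma ccw_dtile t k : ccw (outer (dtile t)) k = red t k.
Proof.
have : ccw (outer (dtile t)) k == red t k.
  by case: t => s b; move: s k; do 2!apply: Z6_ind; case: b; vm_compute.
by move/eqP.
Qed.

Section Tiles.
Variables (R : realType) (eps : R).
Hypothesis heps : 0 < eps < (2 * Num.sqrt 3)^-1.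

Lemma right_angledP t : right_angled R t <-> outer t = inner t + 1 \/ outer t = inner t + 4.
Proof.
case: t => o i; rewrite /right_angled /= side_dirE.
have -> : pos R (u (o + 1)) - pos R (u o) = U R (o + 2) by rewrite U2 !UE.
have s0 : Num.sqrt 3 / 3 != 0 :> R by apply: lt0r_neq0; rewrite divr_gt0 ?sqrtr_gt0.
have -> : 2 *: U R (i + 1) - U R i = pos R (u (i + 1) *+ 2 - u i).
  by rewrite !UE posD posN posM.
rewrite dotZr UE dot_pos.
have C (s m n : int) : (s = 0 <-> 2 * m = n) -> Num.sqrt 3 / 3 * (m%:~R - 2^-1 * n%:~R) = 0 :> R <-> s = 0.
  move=> ->; split=> [/eqP|<-]; last by rewrite intrM; field.
  rewrite mulf_eq0 (negbTE s0) => /eqP H; apply/eqP; rewrite -(eqr_int R) intrM; apply/eqP; lra.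
pose s := 2 * ((u (o + 2)).1 * (u (i + 1) *+ 2 - u i).1 + (u (o + 2)).2 * (u (i + 1) *+ 2 - u i).2) -
  ((u (o + 2)).1 * (u (i + 1) *+ 2 - u i).2 + (u (o + 2)).2 * (u (i + 1) *+ 2 - u i).1).
have B : (s == 0) = (o == i + 1) || (o == i + 4).
  by rewrite /s; move: o i {s}; do 2!apply: Z6_ind; vm_compute.
rewrite (C s); last by rewrite /s; split=> [/subr0_eq//|->]; rewrite subrr.
split=> [/eqP|H]; first by rewrite B => /orP[/eqP|/eqP]; auto.
by apply/eqP; rewrite B; case: H => ->; rewrite eqxx ?orbT.
Qed.

Lemma dtile_right_angled t : right_angled R (dtile t).
Proof. by apply/right_angledP; rewrite /dtile /=; case: ifP; auto. Qed.

Lemma dtileK t : right_angled R t -> dtile (TSTile (inner t) (outer t == inner t + 1)) = t.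
Proof.
move=> /right_angledP; case: t => o i /= [] ->; rewrite /dtile /= ?eqxx // ?Z6_neq //.
Qed.

Lemma RT1_wm (S : Qlat -> ts_tile) : RT1 eps S <-> well_matched (fun x => black (S x)).
Proof.
have e0 : eps != 0 by case/andP: heps => /lt0r_neq0.
have s0 : Num.sqrt 3 != 0 :> R by apply: lt0r_neq0; rewrite sqrtr_gt0.
have E s s' x k : pos R x + marked_point eps s k = pos R (x + u k) + marked_point eps s' (k + 3) <->
    ccw s k = ~~ ccw s' (k + 3).
  rewrite !marked_pointE posD -UE U3 !Z6E U4.
  set e := offset eps; have en : e != 0 by rewrite mulf_neq0.
  set N := 2 *: U R (k + 1) - U R k.
  have N0 : N <> 0.
    move=> N0; have : dot N N = 0 by rewrite N0 /dot /=; ring.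
    rewrite /N !dotE !dotUU (dotC (U R (k + 1)) (U R k)) !dotU1; lra.
  have e3 : e / 3 + e / 3 != 0 by have e_gt : 0 < e := offset_gt0 heps; apply: lt0r_neq0; lra.
  set al := if ccw s k then _ else _; set al' := if ccw s' (k + 3) then _ else _.
  have K : pos R x + (2^-1 *: U R k + al *: N) =
      pos R x + U R k + (2^-1 *: - U R k + al' *: (2 *: - U R (k + 1) - - U R k)) <-> (al + al') *: N = 0.
    rewrite (_ : pos R x + U R k + (2^-1 *: - U R k + al' *: (2 *: - U R (k + 1) - - U R k)) = pos R x + (2^-1 *: U R k - al' *: N)); last first.
      by rewrite /N; apply: plane_ext; rewrite !plane_coordE; field.
    split=> [/addrI/addrI H|]; first by rewrite scalerDl H addNr.
    by rewrite scalerDl => /eqP; rewrite addr_eq0 => /eqP ->.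
  rewrite K; split=> [/eqP|].
    rewrite scaler_eq0 => /orP[|/eqP//]; rewrite /al /al'.
    by do 2!case: ccw => //=; rewrite ?(negbTE e3) // -opprD oppr_eq0 (negbTE e3).
  rewrite /al /al' => ->; case: ccw => /=; by rewrite ?addNr ?subrr scale0r.
split=> H x k; first by apply/E/H.
exact/E/H.
Qed.

Lemma RT2_RT2h (S : Qlat -> ts_tile) :
  RT2 S <-> RT2h (fun x => black (S x)) (fun x => towards_red (S x)).
Proof.
have eta x : TSTile (black (S x)) (towards_red (S x)) = S x by case: (S x).
have km k : k - 1 = k + 5 :> 'Z_6 by apply/eqP; move: k; apply: Z6_ind; vm_compute.
split=> H x k.
  have e1 : x + u (k + 1) + u (k + 5 - 1) = x by rewrite km Z6E u4 addrK.
  have e2 : x + u (k + 1) + u (k + 5 + 1) = x + v k by rewrite Z6E /v -addrA (addrC (u _)).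
  by have := H (x + u (k + 1)) (k + 5); rewrite e1 e2 !Z6E !eta.
have e3 : x + u (k - 1) + v (k + 1) = x + u (k + 1).
  by rewrite km /v Z6E u5 u2; apply: Qext; rewrite !coordE; ring.
by have := H (x + u (k - 1)) (k + 1); rewrite !eta e3 !Z6E.
Qed.

End Tiles.

(** Three alternate sides of a well-arrowed hexagon are always of mixed type. *)
Lemma mixed_alternate s b e : exists k, even6 k = e /\ ccw s k = b.
Proof.
have : has (fun k => (even6 k == e) && (ccw s k == b)) [:: 0; 1; 2; 3; 4; 5].
  by move: s; apply: Z6_ind; case: b; case: e; vm_compute.
by case/hasP => k _ /andP[/eqP h1 /eqP h2]; exists k.
Qed.

(** The unique completion of three alternate arrows. *)
Lemma alternate_inj s s' e : (forall k, even6 k = e -> ccw s k = ccw s' k) -> s = s'.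
Proof.
move=> H; apply/eqP.
have : all (fun k => (even6 k == e) ==> (ccw s k == ccw s' k)) [:: 0; 1; 2; 3; 4; 5].
  by apply/allP => k _; apply/implyP => /eqP/H/eqP.
apply/implyP; move: s s' {H}; do 2!apply: Z6_ind; case: e; vm_compute; done.
Qed.

Lemma same3_alternate c y : ~~ same3 c y -> exists e, forall k, even6 k = e -> same3 c (y + u k).
Proof.
rewrite /same3 => n.
have [h1|h2] : (3 %| y.1 + y.2 - c.1 - c.2 - 1)%Z \/ (3 %| y.1 + y.2 - c.1 - c.2 + 1)%Z by lia.
  by exists false; apply: Z6_ind => //= _; lia.
by exists true; apply: Z6_ind => //= _; lia.
Qed.

Lemma same3_v c x j : same3 c (x + v j) = same3 c x.
Proof. by rewrite /same3 /v !coordE; move: j; apply: Z6_ind => /=; lia. Qed.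

Section Penrose.
Variables (R : realType) (c : Qlat).

Lemma penrose_centresE D x : penrose R c D -> same3 c x <-> exists t, D x = Some t.
Proof. by move=> p; rewrite -same3P; exact: (penrose_centres p). Qed.

Lemma small_hexagons_uniq D h h' : penrose R c D -> small_hexagons D h -> small_hexagons D h' -> h = h'.
Proof.
move=> p [h1 h2] [h1' h2']; apply: funext => y; case Dy: (D y) => [t|].
  by rewrite (h1 _ _ Dy) (h1' _ _ Dy).
have n3 : ~~ same3 c y by apply/negP => /(penrose_centresE _ p)[t]; rewrite Dy.
have [e he] := same3_alternate n3; apply: (alternate_inj (e := e)) => k ek.
have [t Dt] := proj1 (penrose_centresE _ p) (he k ek).
by rewrite (h2 _ Dy _ _ Dt) (h2' _ Dy _ _ Dt).
Qed.

(** Matching of the outer hexagons is the colour rule on c + 3P. *)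
Lemma penrose_RT2on D h : penrose R c D -> small_hexagons D h ->
  RT2on c h (fun x => if D x is Some t then outer t == inner t + 1 else false).
Proof.
move=> p [h1 _] x j s3.
have [t Dt] := proj1 (penrose_centresE _ p) s3.
have s3' : same3 c (x + v j) by rewrite same3_v.
have [t' Dt'] := proj1 (penrose_centresE _ p) s3'.
rewrite Dt Dt' (h1 _ _ Dt) (h1 _ _ Dt') -!ccw_dtile (dtileK (penrose_tiles p Dt)) (dtileK (penrose_tiles p Dt')).
by apply: (penrose_outer p) Dt _; rewrite -addrA.
Qed.

(** Forgets the colours off c + 3P. *)
Definition decorate (S : Qlat -> ts_tile) : tiling dhex :=
  fun x => if same3 c x then Some (dtile (S x)) else None.

Lemma decorate_small S : well_matched (fun x => black (S x)) -> small_hexagons (decorate S) (fun x => black (S x)).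
Proof.
move=> hm; split=> [x t|y Dy k t]; rewrite /decorate; case: ifP => // _ [<-] //=.
Qed.

Lemma decorate_penrose S : well_matched (fun x => black (S x)) ->
  RT2on c (fun x => black (S x)) (fun x => towards_red (S x)) -> penrose R c (decorate S).
Proof.
move=> hm hr; have sm := decorate_small hm; split.
- by move=> x; rewrite same3P /decorate; case: ifP => _; [by split=> // _; eexists|by split=> // -[]].
- by move=> x t; rewrite /decorate; case: ifP => // _ [<-]; exact: dtile_right_angled.
- move=> x k t t'; rewrite /decorate; case: ifP => // s3 [<-]; case: ifP => // _ [<-].
  rewrite !ccw_dtile; have := hr x k s3; rewrite -addrA -/(v k).
  by case: (S x) (S (x + v k)) => [b1 r1] [b2 r2].
- move=> y Dy b; have n3 : ~~ same3 c y by move: Dy; rewrite /decorate; case: ifP.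
  have [e he] := same3_alternate n3; have [k [ek kb]] := mixed_alternate (black (S y)) b e.
  exists k, (dtile (S (y + u k))); rewrite /decorate (he k ek); split=> //=.
  by rewrite -kb; symmetry; exact: hm.
- by exists (fun x => black (S x)).
Qed.

End Penrose.

(** If a period is in 2^k Q but not in 2^(k+1) Q, it maps one class of points of
    L_k outside L_(k+1) to another one, with another direction of stripes. *)
Lemma nest_aperiodic h c z : nest h c -> (forall x, h (x + z) = h x) -> z = 0.
Proof.
move=> hn hz.
have D k : exists w, z = w *+ 2 ^ k.
  elim: k => [|k [w ez]]; first by exists z.
  case: (parity w) => [[w' ew]|[a [w' ew]]]; first by exists w'; rewrite ez ew; qvec.
  exfalso; have Lp : level c k.+1 (c k.+1) by exists 0; rewrite mul0rn addr0.
  set p := c k.+1 in Lp.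
  have h1 : h (p + u (a + 1) *+ 2 ^ k) = a + 1 \/ h (p + u (a + 1) *+ 2 ^ k) = a + 1 + 3.
    by apply: (nest_class hn Lp); exists 0; rewrite mul0rn addr0.
  have h2 : h (p + u (a + 1) *+ 2 ^ k + z) = a + 5 \/ h (p + u (a + 1) *+ 2 ^ k + z) = a + 5 + 3.
    by apply: (nest_class hn Lp); exists (u (a + 1) + w'); rewrite ez ew; qvec.
  rewrite hz !Z6E in h1 h2.
  by case: h1 h2 => -> [] /eqP; rewrite Z6_neq.
have Z (s : int) : (forall k, exists q : int, s = q *+ 2 ^ k) -> s = 0.
  move=> H; have [q eq] := H `|s|%N; have := ltn_expl `|s|%N (isT : 1 < 2)%N.
  move: eq; move: (2 ^ _)%N => M eq; rewrite eq -mulr_natr natz abszM absz_nat.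
  have [->|q0] := eqVneq q 0; first by rewrite mul0r.
  by rewrite ltnNge leq_pmull // absz_gt0.
by apply: Qext; apply: Z => k; have [w ->] := D k; rewrite ?c1M ?c2M; eexists.
Qed.

(** * From one kind of tiling to the other *)

Lemma pos_inj (R : realType) x y : pos R x = pos R y -> x = y.
Proof.
move=> H; have h1 : (pos R x).1 = (pos R y).1 by rewrite H.
have h2 : (pos R x).2 = (pos R y).2 by rewrite H.
have s0 : Num.sqrt 3 / 2 != 0 :> R by apply: lt0r_neq0; rewrite divr_gt0 ?sqrtr_gt0.
rewrite !pos2 in h2; have e2 : x.2 = y.2 by have := mulIf s0 h2 => /eqP; rewrite eqr_int => /eqP.
rewrite !pos1 e2 in h1; have := addIr _ h1 => /eqP; rewrite eqr_int => /eqP e1.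
exact: Qext.
Qed.

Lemma decorate_eq S c c' : decorate c S = decorate c' S <-> coset3P c c'.
Proof.
rewrite same3P; split=> [/(congr1 (fun D => D c'))|H].
  rewrite /decorate; have -> : same3 c' c' by rewrite /same3; lia.
  by case: ifP.
apply: funext => x; rewrite /decorate; have -> // : same3 c x = same3 c' x.
by move: H; rewrite /same3; lia.
Qed.

Section Main.
Variables (R : realType) (eps : R).
Hypothesis heps : 0 < eps < (2 * Num.sqrt 3)^-1.

(** What both kinds of tilings have in common. *)
Lemma nonsingular_nest h f c0 : well_matched h -> RT2on c0 h f -> nonsingular eps h ->
  exists c, [/\ nest h c, (forall k, level_vertices eps h k = level c k) & w_lines_escape c].
Proof.
move=> hm hr [n1 n2]; have hc := N1_corners_close heps hm n1; have he := N1_stripes_end heps n1.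
have [c hn] : exists c, nest h c by apply: (@deflatable_nest h f); split=> //; exists c0.
have hl k := level_verticesE heps hn hc he k.
by exists c; split=> //; apply/(N2_w_lines_escape hl).
Qed.

Lemma RT2h_on c0 h f : RT2h h f -> RT2on c0 h f.
Proof. by move=> H x j _; apply: H. Qed.

Lemma ts_wm S : nonsingular_ts eps S -> well_matched (fun x => black (S x)).
Proof. by case=> /(RT1_wm heps). Qed.

Lemma ts_aperiodic S : nonsingular_ts eps S -> aperiodic R (full_tiling S).
Proof.
move=> hS; have hm := ts_wm hS; case: hS => _ /RT2_RT2h/(@RT2h_on 0) hr ns.
have [c [hn _ _]] := nonsingular_nest hm hr ns => w hw.
have P0 x : placed (full_tiling S) (pos R x) (S x) by exists x.
have [z [ez _]] : placed (full_tiling S) (pos R 0 + w) (S 0) by apply/hw.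
have p0 : pos R 0 = 0 by rewrite /pos !scale0r addr0.
rewrite p0 add0r in ez; suff z0 : z = 0 by rewrite ez z0 p0.
apply: (nest_aperiodic hn) => x; have : placed (full_tiling S) (pos R x + w) (S x) by apply/hw.
case=> y [ey [es]]; have <- : y = x + z by apply: (@pos_inj R); rewrite posD -ey ez.
by rewrite es.
Qed.

Lemma penrose_nonsingular_small c D h : nonsingular_penrose eps c D -> small_hexagons D h ->
  [/\ well_matched h, nonsingular eps h & exists f, RT2on c h f].
Proof.
case=> p [h1 [s1 ns]] s2; have [h2 [s3 m]] := penrose_small p.
have e1 := small_hexagons_uniq p s1 s2; have e2 := small_hexagons_uniq p s3 s2; subst h1 h2.
by split=> //; eexists; exact: penrose_RT2on p s2.
Qed.

Lemma penrose_aperiodic c D : nonsingular_penrose eps c D -> aperiodic R D.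
Proof.
move=> hp; have [p [h [sm _]]] := hp; have [hm ns [f hr]] := penrose_nonsingular_small hp sm.
have [c' [hn _ _]] := nonsingular_nest hm hr ns => w hw.
have sc : same3 c c by rewrite /same3; lia.
have [t0 D0] := proj1 (penrose_centresE _ p) sc.
have [z [ez _]] : placed D (pos R c + w) t0 by apply/hw; exists c.
have {ez}ez : w = pos R (z - c) by rewrite posD posN -ez addrAC subrr add0r.
set y := z - c in ez.
have shift x : D (x + y) = D x.
  case Dx: (D x) => [t|].
    have [x' [ex Dx']] : placed D (pos R x + w) t by apply/hw; exists x.
    by have <- : x' = x + y by apply: (@pos_inj R); rewrite posD -ex ez.
  case Dy: (D (x + y)) => [t|] //.
  have [x' [ex Dx']] : placed D (pos R x) t by apply/hw; exists (x + y); rewrite posD -ez.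
  by rewrite -(pos_inj ex) Dx in Dx'.
suff y0 : y = 0 by rewrite ez y0 /pos !scale0r addr0.
apply: (nest_aperiodic hn).
have s2 : small_hexagons D (fun x => h (x + y)).
  case: sm => m1 m2; split=> [x t Dx|x Dx k t Dt]; first by apply: m1; rewrite shift.
  by apply: m2; [rewrite shift|rewrite addrAC shift].
by move=> x; have := small_hexagons_uniq p s2 sm => /(congr1 (fun g => g x)).
Qed.

Lemma ts_decorate c S : nonsingular_ts eps S ->
  nonsingular_penrose eps c (decorate c S) /\ small_hexagons (decorate c S) (fun x => black (S x)).
Proof.
move=> hS; have hm := ts_wm hS; case: hS => _ /RT2_RT2h/(@RT2h_on c) hr ns.
have sm := decorate_small c hm.
by split=> //; split; [exact: decorate_penrose|exists (fun x => black (S x))].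
Qed.

Lemma penrose_levels c D h : nonsingular_penrose eps c D -> small_hexagons D h ->
  exists! q : nat -> set Qlat, inv_lim_Q q /\ forall k, level_vertices eps h k = q k.
Proof.
move=> hp sm; have [hm ns [f hr]] := penrose_nonsingular_small hp sm.
have [c' [hn hl _]] := nonsingular_nest hm hr ns.
exists (level c'); split; first by split=> //; exact: (level_inv_lim hn).
by move=> q [_ hq]; apply: funext => k; rewrite -hl hq.
Qed.

Lemma penrose_ts c D : nonsingular_penrose eps c D ->
  exists! S : Qlat -> ts_tile, nonsingular_ts eps S /\ small_hexagons D (fun x => black (S x)).
Proof.
move=> hp; have [p [h [sm _]]] := hp; have [hm ns [f hr]] := penrose_nonsingular_small hp sm.
have [c' [hn hl ve]] := nonsingular_nest hm hr ns.
exists (fun x => TSTile (h x) (colour h ve x)); split.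
  split=> //; split=> //; first exact/(RT1_wm heps).
  by apply/RT2_RT2h; exact: colour_RT2.
move=> S [[_ /RT2_RT2h h2 _] s2].
have eb : (fun x => black (S x)) = h := small_hexagons_uniq p s2 sm.
rewrite eb in h2; apply: funext => x.
have /(_ x) -> := RT2_uniq hn ve (colour_RT2 hn ve) h2.
by rewrite -[h x](congr1 (fun g => g x) eb); case: (S x).
Qed.

End Main.

(** * Inflation *)

Definition half (x : Qlat) : Qlat := ((x.1 %/ 2)%Z, (x.2 %/ 2)%Z).

(** The inverse of deflation, with centre 0. *)
Definition inflate (h : Qlat -> hexagon) (x : Qlat) : hexagon :=
  let stripe j := if ccw (h (half x)) j then j else j + 3 in
  match (2 %| x.1)%Z, (2 %| x.2)%Z with
  | true, true => h (half x)
  | false, true => stripe 0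
  | false, false => stripe 1
  | true, false => stripe 2
  end.

Lemma half_even (z e : Qlat) : (0 <= e.1 < 2) -> (0 <= e.2 < 2) -> half (z *+ 2 + e) = z.
Proof. by move=> h1 h2; apply: Qext; rewrite /half /= ?c1M ?c2M; lia. Qed.

Lemma inflate_even h z : inflate h (z *+ 2) = h z.
Proof.
have hz : half (z *+ 2) = z by rewrite -[z *+ 2]addr0; exact: half_even.
rewrite /inflate hz c1M c2M.
have e1 : (2 %| z.1 *+ 2)%Z by lia.
have e2 : (2 %| z.2 *+ 2)%Z by lia.
by rewrite e1 e2.
Qed.

Section Inflate.
Variable h : Qlat -> hexagon.
Hypothesis hm : well_matched h.

(** The definition uses one of the two ends of the edge with midpoint
    2 z + u j; for the other end this is the matching condition. *)
Lemma inflate_mid z j : inflate h (z *+ 2 + u j) = if ccw (h z) j then j else j + 3.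
Proof.
have B i w : i \in [:: 0; 1; 2] -> inflate h (w *+ 2 + u i) = if ccw (h w) i then i else i + 3.
  rewrite !inE => /or3P[] /eqP->; rewrite /inflate half_even // !coordE /=.
  - have e1 : (2 %| w.1 *+ 2 + 1)%Z = false by lia.
    have e2 : (2 %| w.2 *+ 2 + 0)%Z by lia.
    by rewrite e1 e2.
  - have e1 : (2 %| w.1 *+ 2 + 1)%Z = false by lia.
    have e2 : (2 %| w.2 *+ 2 + 1)%Z = false by lia.
    by rewrite e1 e2.
  - have e1 : (2 %| w.1 *+ 2 + 0)%Z by lia.
    have e2 : (2 %| w.2 *+ 2 + 1)%Z = false by lia.
    by rewrite e1 e2.
have [lt|ge] := boolP (j \in [:: 0; 1; 2]); first exact: B.
have j3 : j + 3 \in [:: 0; 1; 2] by move: j ge; apply: Z6_ind.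
have := B _ (z + u j) j3; rewrite (_ : _ + u (j + 3) = z *+ 2 + u j); last by qvec.
by move=> ->; rewrite (hm z j) Z6E; case: ccw.
Qed.

Lemma inflate_inflates : inflates 0 (inflate h).
Proof. by move=> z j; rewrite add0r inflate_mid inflate_even. Qed.

Lemma inflate_wm : well_matched (inflate h).
Proof.
have key y b : ccw (inflate h (y *+ 2)) b = ~~ ccw (inflate h (y *+ 2 + u b)) (b + 3).
  by rewrite inflate_even inflate_mid; case: ifP; rewrite ?ccwE.
move=> x k; case: (parity x) => [[w ->]|[a [w ex]]]; first exact: key.
have ea i y : x = y *+ 2 + u i -> inflate h x = i \/ inflate h x = i + 3.
  by move=> ->; rewrite inflate_mid; case: ifP; auto.
have hx : inflate h x = a \/ inflate h x = a + 3 by apply: (ea _ w); rewrite ex addrC.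
have N i y : x + u k = y *+ 2 + u i -> inflate h (x + u k) = i \/ inflate h (x + u k) = i + 3.
  by move=> ->; rewrite inflate_mid; case: ifP; auto.
have [i ek] : exists i, k = a + i by exists (k - a); rewrite addrC subrK.
subst k; move: i N; apply: Z6_ind => N.
- rewrite addr0 in N *; have := key (w + u a) (a + 3); rewrite Z6E.
  rewrite (_ : _ + u (a + 3) = x); last by rewrite ex; qvec.
  by rewrite (_ : x + u a = (w + u a) *+ 2) => [->|]; rewrite ?negbK // ex; qvec.
- by case: (N (a + 2) (w + u a)) => [|->|->]; [rewrite ex; qvec| |]; case: hx => ->; rewrite ?Z6E ?ccwE.
- by case: (N (a + 1) w) => [|->|->]; [rewrite ex; qvec| |]; case: hx => ->; rewrite ?Z6E ?ccwE.
- have := key w a; rewrite addrC -ex => H; rewrite Z6E (_ : x + u (a + 3) = w *+ 2); last by rewrite ex; qvec.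
  by rewrite H negbK.
- by case: (N (a + 2) (w + u a - u (a + 1))) => [|->|->]; [rewrite ex; qvec| |]; case: hx => ->; rewrite ?Z6E ?ccwE.
- by case: (N (a + 1) (w + u a - u (a + 1))) => [|->|->]; [rewrite ex; qvec| |]; case: hx => ->; rewrite ?Z6E ?ccwE.
Qed.
End Inflate.

(** Path triangles of sides 1 and 2, arranged with period lattice 3P. *)
Definition periodic_start (x : Qlat) : hexagon := 2 - 2 * (x.1 + x.2)%:~R.

Lemma periodic_start_wm : well_matched periodic_start.
Proof.
move=> x k; rewrite /periodic_start (_ : (x + u k).1 + (x + u k).2 = x.1 + x.2 + ((u k).1 + (u k).2)); last by rewrite !coordE; ring.
rewrite (intrD _ (x.1 + x.2)); move: ((x.1 + x.2)%:~R) => t.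
by apply/eqP; move: t k; do 2!apply: Z6_ind; vm_compute.
Qed.

Fixpoint approx n (d : nat -> Qlat) : Qlat -> hexagon :=
  if n is n'.+1 then fun x => inflate (approx n' (fun i => d i.+1)) (x - d 0%N) else periodic_start.

(** The partial sums of a series with digits [d k]; they represent the levels. *)
Fixpoint csum (d : nat -> Qlat) k : Qlat := if k is k'.+1 then csum d k' + d k' *+ 2 ^ k' else 0.

Lemma csumS d k : csum d k.+1 = d 0%N + csum (fun i => d i.+1) k *+ 2.
Proof.
elim: k => [|k IH]; first by rewrite /= expn0 mulr1n mul0rn addr0 add0r.
rewrite -[LHS]/(csum d k.+1 + d k.+1 *+ 2 ^ k.+1) IH /=; qvec.
Qed.

Lemma translate_wm h (z : Qlat) : well_matched h -> well_matched (fun x => h (x - z)).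
Proof. by move=> hm x k; rewrite hm addrAC. Qed.

Lemma approx_wm n d : well_matched (approx n d).
Proof.
elim: n d => [|n IH] d; first exact: periodic_start_wm.
exact/translate_wm/inflate_wm/IH.
Qed.

Definition nest_upto n (h : Qlat -> hexagon) (c : nat -> Qlat) := forall k z j, (k < n)%N ->
  h (c k.+1 + z *+ 2 ^ k.+1 + u j *+ 2 ^ k) = if ccw (h (c k.+1 + z *+ 2 ^ k.+1)) j then j else j + 3.

Lemma approx_nest n d : nest_upto n (approx n d) (csum d).
Proof.
elim: n d => [|n IH] d k z j // lt; set h := approx n (fun i => d i.+1).
have hm : well_matched h by exact: approx_wm.
have E w : approx n.+1 d (d 0%N + w) = inflate h w by rewrite /= addrC addKr.
rewrite csumS; case: k lt => [|k] lt.
  rewrite (_ : csum _ 0 = 0) // mul0rn addr0 expn1 expn0 mulr1n -addrA !E.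
  by rewrite inflate_mid // inflate_even.
set c' := csum (fun i => d i.+1).
rewrite (_ : d 0%N + c' k.+1 *+ 2 + z *+ 2 ^ k.+2 + u j *+ 2 ^ k.+1 =
  d 0%N + (c' k.+1 + z *+ 2 ^ k.+1 + u j *+ 2 ^ k) *+ 2); last by qvec.
rewrite (_ : d 0%N + c' k.+1 *+ 2 + z *+ 2 ^ k.+2 = d 0%N + (c' k.+1 + z *+ 2 ^ k.+1) *+ 2); last by qvec.
by rewrite !E !inflate_even; exact: IH.
Qed.

(** * A tiling for every sequence of levels *)

Section Limit.
Variable d : nat -> Qlat.
Notation c := (csum d).
Notation level := (level c).

Lemma csum_level k : level k.+1 (c k.+1).
Proof. by exists 0; rewrite mul0rn addr0. Qed.

Lemma csum_levelS k x : level k.+1 x -> level k x.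
Proof. by case=> z ->; exists (d k + z *+ 2); rewrite /=; qvec. Qed.

Lemma csum_level_le k m x : (k <= m)%N -> level m x -> level k x.
Proof.
elim: m => [|m IH]; first by rewrite leqn0 => /eqP->.
by rewrite leq_eqVlt => /orP[/eqP->//|/IH H /csum_levelS].
Qed.

Definition misses n x (j : 'Z_6) := forall t : int, ~ level n (x + u j *~ t).

Lemma missesD n x j (t : int) : misses n x j -> misses n (x + u j *~ t) j.
Proof. by move=> H s; rewrite -addrA -mulrzDr; exact: H. Qed.

Lemma misses3 n x j : misses n x (j + 3) <-> misses n x j.
Proof.
by split=> H t; have := H (- t); rewrite u3 ?mulNrz mulrNz ?opprK.
Qed.

(** The black line on an edge at p is decided at the last level met by the line
    of the edge, or earlier; so n levels suffice if the line misses L_n. *)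
Lemma ccw_uniq n h h' b p a : nest_upto n h c -> nest_upto n h' c -> level b p -> misses n p a ->
  ccw (h p) a = ccw (h' p) a.
Proof.
move=> hh hh'; move em0: (n - b)%N => m; elim: m b p a em0 => [|m IH] b p a em Lb mi.
  by case: (mi 0); rewrite mulr0z addr0; apply: csum_level_le Lb; rewrite -subn_eq0 em.
have [Lp|nL] := pselect (level b.+1 p); first by apply: (IH b.+1) => //; rewrite subnS em.
have bn : (b < n)%N by rewrite -subn_gt0 em.
have [z ez] := level_diff (csum_levelS (csum_level b)) Lb.
case: (parity z) => [[w ew]|[i [w ew]]].
  by case: nL; exists w; rewrite ez ew expnS mulrnA.
set q := c b.+1 + w *+ 2 ^ b.+1.
have ep : p = q + u i *+ 2 ^ b by rewrite ez ew /q; qvec.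
have Lq : level b.+1 q by exists w.
have e1 := hh b w i bn; have e2 := hh' b w i bn; rewrite -/q -ep in e1 e2.
have ei : h p = i \/ h p = i + 3 by rewrite e1; case: ifP; auto.
have ei' : h' p = i \/ h' p = i + 3 by rewrite e2; case: ifP; auto.
have same : misses n p i -> h p = h' p.
  move=> mi'; rewrite e1 e2 (IH b.+1 q i) //; first by rewrite subnS em.
  by rewrite (_ : q = p + u i *~ (- (2 ^ b)%:Z)); [exact: missesD|rewrite ep mulrNz -pmulrn addrK].
have [s es] : exists s, a = i + s by exists (a - i); rewrite addrC subrK.
subst a; move: s mi; apply: Z6_ind => mi.
- by rewrite addr0 in mi *; rewrite same.
- by case: ei => ->; case: ei' => ->; rewrite !ccwE.
- by case: ei => ->; case: ei' => ->; rewrite !ccwE.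
- by rewrite same //; apply/misses3.
- by case: ei => ->; case: ei' => ->; rewrite !ccwE.
- by case: ei => ->; case: ei' => ->; rewrite !ccwE.
Qed.

Hypothesis he : lattice_lines_escape c.

Lemma all_misses x : exists n, forall j, misses n x j.
Proof.
have M m n j : (m <= n)%N -> misses m x j -> misses n x j.
  by move=> le H t /(csum_level_le le); exact: H.
have [n0 h0] := he x 0; have [n1 h1] := he x 1; have [n2 h2] := he x 2.
exists (n0 + n1 + n2)%N; apply: Z6_ind.
- by apply: M h0; lia.
- by apply: M h1; lia.
- by apply: M h2; lia.
- by apply/(misses3 _ _ 0); apply: M h0; lia.
- by apply/(misses3 _ _ 1); apply: M h1; lia.
- by apply/(misses3 _ _ 2); apply: M h2; lia.
Qed.

(** By [ccw_uniq] the approximations are eventually constant at every point. *)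
Lemma nest_exists : exists h, nest h c.
Proof.
pose N x := projT1 (cid (all_misses x)); pose h x := approx (N x) d x.
have E n x : (N x <= n)%N -> h x = approx n d x.
  move=> le; apply: (alternate_inj (e := true)) => a _.
  have mi : misses (N x) x a := projT2 (cid (all_misses x)) a.
  apply: (@ccw_uniq (N x) (approx (N x) d) (approx n d) 0) => //; first exact: approx_nest.
    by move=> k z j lt; exact: (@approx_nest n d k z j (leq_trans lt le)).
  exact: level0.
exists h; split=> [k|k z j]; first by exists (d k).
set p := c k.+1 + _; set x := p + _; pose n := (N p + N x + k.+1)%N.
rewrite (E n x) ?(E n p); [|rewrite /n; lia|rewrite /n; lia].
by apply: approx_nest; rewrite /n; lia.
Qed.
End Limit.

(** A stripe ends at the deepest level met by its line, at the latest. *)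
Lemma lattice_lines_stripes_end h c : nest h c -> lattice_lines_escape c -> stripes_end h.
Proof.
move=> hn he x; apply: contrapT => no; set k := h x in no.
have H n : h (x - u k *+ n) = k by apply: contrapT => ne; apply: no; exists n.
have [m hm] := he x k.
have [i [[t Lt] nL]] : exists i, (exists t : int, level c i (x + u k *~ t)) /\
    forall t : int, ~ level c i.+1 (x + u k *~ t).
  elim: m hm => [|m IH] hm; first by case: (hm 0); exact: level0.
  have [ex|nex] := pselect (exists t : int, level c m (x + u k *~ t)); first by exists m.
  by apply: IH => t Lt; apply: nex; exists t.
pose s := (`|t| * (2 ^ i)%:Z - t).
have [n en] : exists n : nat, s = n%:Z.
  exists `|s|%N; rewrite gez0_abs // /s subr_ge0.
  apply: le_trans (ler_norm t) _; rewrite ler_peMr // lez_nat expn_gt0 //.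
have ey : x - u k *+ n = x + u k *~ t - u k *~ `|t| *+ 2 ^ i.
  by rewrite (pmulrn _ n) -en /s mulrzBr mulrzA -pmulrn opprB addrA.
have Ly : level c i (x - u k *+ n).
  by rewrite ey -mulNrn; exact: levelD.
have line (r : int) : ~ level c i.+1 (x - u k *+ n + u k *~ r).
  by rewrite pmulrn -mulrNz -addrA -mulrzDr; exact: nL.
have ny : ~ level c i.+1 (x - u k *+ n) by have := line 0; rewrite mulr0z addr0.
have [a [La ha]] := nest_stripe hn Ly ny; rewrite H in ha.
case: ha => ea; [apply: (line (2 ^ i)%:Z)|apply: (line (- (2 ^ i)%:Z))].
  by move: La; rewrite -pmulrn -ea.
have ua : u a = - u k by rewrite ea u3 opprK.
by move: La; rewrite ua mulNrn mulrNz -pmulrn.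
Qed.

(** * A non-singular tiling *)

(** The base point is q = a_1 * 3 / 7 + a_2 * 2 / 7, the sum of the series with
    terms 2^k u_(2k), that is 1 / (1 - 2 omega) for a cube root of unity omega. *)
Definition digit k : Qlat := nth 0 [:: u 0; u 2; u 4] (k %% 3).
(** 7 times the difference between the k-th partial sum and q, divided by 2^k. *)
Definition carry k : Qlat := nth 0 [:: (-3, -2); (2, -1); (1, 3)] (k %% 3).

Lemma carryS k : carry k.+1 *+ 2 = carry k + digit k *+ 7.
Proof.
rewrite /carry /digit (divn_eq k 3) -addnS !modnMDl; have := ltn_pmod k (isT : 0 < 3)%N.
by case: (k %% 3)%N => [|[|[|]]].
Qed.

Lemma csum_digit k : csum digit k *+ 7 = (3, 2) + carry k *+ 2 ^ k.
Proof.
elim: k => [|k IH]; first by [].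
by rewrite /= mulrnDl IH expnS mulrnA carryS; qvec.
Qed.

Lemma coordinates (x D E : Qlat) (t : int) M : (x + D *~ t) *+ 7 = ((3, 2) : Qlat) + E *+ M ->
  7 * x.1 - 3 = E.1 * M%:Z - 7 * (D.1 * t) /\ 7 * x.2 - 2 = E.2 * M%:Z - 7 * (D.2 * t).
Proof.
case: x D E => [x1 x2] [D1 D2] [E1 E2] H; split.
  have : (x1 + D1 *~ t) *+ 7 = 3 + E1 *+ M by have := congr1 fst H; rewrite c1M c1D c1Z c1D c1M.
  rewrite (pmulrn E1) !mulrzz; move: (E1 * _) (D1 * t) => a b /=; lia.
have : (x2 + D2 *~ t) *+ 7 = 2 + E2 *+ M by have := congr1 snd H; rewrite c2M c2D c2Z c2D c2M.
rewrite (pmulrn E2) !mulrzz; move: (E2 * _) (D2 * t) => a b /=; lia.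
Qed.

(** On a line with equation al x_1 + be x_2 = const, the integer
    7 (al x_1 + be x_2) - (3 al + 2 be) is constant.  It is not 0 modulo 7, while
    2^k divides it if the line meets L_k. *)
Lemma line_escapes (D : Qlat) (al be : int) : al * D.1 + be * D.2 = 0 -> ~~ (7 %| 3 * al + 2 * be)%Z ->
  forall x, exists k, forall t : int, ~ level (csum digit) k (x + D *~ t).
Proof.
move=> hD h7 x; pose V := al * (7 * x.1 - 3) + be * (7 * x.2 - 2).
have V0 : V != 0 by apply: contra h7 => /eqP hV; apply/dvdzP; exists (al * x.1 + be * x.2); move: hV; rewrite /V; lia.
exists `|V|%N => t [z ez].
have e7 : (x + D *~ t) *+ 7 = (3, 2) + (carry `|V|%N + z *+ 7) *+ 2 ^ `|V|%N.
  by rewrite ez mulrnDl csum_digit; qvec.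
have [M eM] : exists M, M = (2 ^ `|V|)%N by exists (2 ^ `|V|)%N.
rewrite -eM in e7; have [e1 e2] := coordinates e7; set E := carry _ + _ in e1 e2.
have eV : V = (al * E.1 + be * E.2) * M%:Z.
  have -> : V = (al * E.1 + be * E.2) * M%:Z - 7 * t * (al * D.1 + be * D.2) by rewrite /V e1 e2; ring.
  by rewrite hD mulr0 subr0.
have : (M <= `|V|)%N.
  rewrite eV abszM absz_nat leq_pmull // absz_gt0; apply: contra V0 => /eqP e0.
  by rewrite eV e0 mul0r.
by rewrite leqNgt eM ltn_expl.
Qed.

Lemma digit_lattice_lines_escape : lattice_lines_escape (csum digit).
Proof.
move=> x j; move: x; move: j; apply: Z6_ind => x.
- exact: (@line_escapes _ 0 1).
- exact: (@line_escapes _ 1 (-1)).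
- exact: (@line_escapes _ 1 0).
- exact: (@line_escapes _ 0 1).
- exact: (@line_escapes _ 1 (-1)).
- exact: (@line_escapes _ 1 0).
Qed.

Lemma digit_w_lines_escape : w_lines_escape (csum digit).
Proof.
move=> x j; move: x; move: j; apply: Z6_ind => x.
- exact: (@line_escapes _ 1 (-2)).
- exact: (@line_escapes _ 2 (-1)).
- exact: (@line_escapes _ 1 1).
- exact: (@line_escapes _ 1 (-2)).
- exact: (@line_escapes _ 2 (-1)).
- exact: (@line_escapes _ 1 1).
Qed.

(** A non-singular Taylor-Socolar tiling, in combinatorial terms. *)
Definition model (h : Qlat -> hexagon) c f := [/\ nest h c, lattice_lines_escape c, w_lines_escape c & RT2h h f].

Lemma model_exists : exists h c f, model h c f.
Proof.
have [h hn] := nest_exists digit_lattice_lines_escape.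
exists h, (csum digit), (colour h digit_w_lines_escape); split=> //.
- exact: digit_lattice_lines_escape.
- exact: digit_w_lines_escape.
- exact: colour_RT2.
Qed.

Definition shift (c : nat -> Qlat) k : Qlat := if k is k'.+1 then c k' *+ 2 else 0.

Lemma shift_level c k y : level (shift c) k.+1 y -> exists2 y', y = y' *+ 2 & level c k y'.
Proof. by case=> z ->; exists (c k + z *+ 2 ^ k); [rewrite /=; qvec|exists z]. Qed.

Lemma shift_nest h c : nest h c -> nest (inflate h) (shift c).
Proof.
move=> hn; have hm := nest_wm hn; case: hn => hs hn; split=> [[|k]|[|k] z j].
- by exists (c 0%N *+ 2); rewrite /= add0r expn0 mulr1n.
- by have [d ed] := hs k; exists d; rewrite /= ed; qvec.
- rewrite (_ : shift c 1 + z *+ 2 ^ 1 = (c 0%N + z) *+ 2); last by rewrite /=; qvec.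
  by rewrite expn0 mulr1n inflate_mid // inflate_even.
rewrite (_ : shift c k.+2 + z *+ 2 ^ k.+2 = (c k.+1 + z *+ 2 ^ k.+1) *+ 2); last by rewrite /=; qvec.
rewrite (_ : _ + u j *+ 2 ^ k.+1 = (c k.+1 + z *+ 2 ^ k.+1 + u j *+ 2 ^ k) *+ 2); last by qvec.
by rewrite !inflate_even.
Qed.

(** A line whose direction is odd meets 2Q either not at all or in the image of
    a line. *)
Lemma shift_escapes c (D : Qlat) : (forall w, D <> w *+ 2) ->
  (forall x, exists k, forall t : int, ~ level c k (x + D *~ t)) ->
  forall x, exists k, forall t : int, ~ level (shift c) k (x + D *~ t).
Proof.
move=> Dodd H x; have [[t0 [x' ex]]|no] := pselect (exists t0 : int, exists x', x + D *~ t0 = x' *+ 2); last first.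
  by exists 1%N => t /shift_level[y' ey _]; apply: no; exists t, y'.
have [k hk] := H x'; exists k.+1 => t /shift_level[y' ey Ly].
have [s [es|es]] : exists s : int, t - t0 = 2 * s \/ t - t0 = 2 * s + 1.
  by exists ((t - t0) %/ 2)%Z; lia.
  apply: (hk s); rewrite (_ : x' + D *~ s = y') //; apply: mul2_inj; rewrite -ey mulrnDl -ex.
  have -> : t = t0 + 2 * s by lia.
  by apply: Qext; rewrite !coordE; ring.
apply: (Dodd (y' - x' - D *~ s)); rewrite !mulrnBl -ey -ex.
have -> : t = t0 + 2 * s + 1 by lia.
by apply: Qext; rewrite !coordE; ring.
Qed.

Lemma v_odd j w : v j <> w *+ 2.
Proof.
move=> H; apply: (@u_odd (j + 2) (w - u j)); rewrite mulrnBl -H /v; qvec.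
Qed.

(** The restriction of the new colours to 2Q satisfies the colour rule, so it is
    the old colouring. *)
Lemma model_inflate h c f : model h c f ->
  exists f', model (inflate h) (shift c) f' /\ forall z, f' (z *+ 2) = f z.
Proof.
case=> hn ha hv hf; have hn' := shift_nest hn; have hm := nest_wm hn.
have hv' : w_lines_escape (shift c) by move=> x j; apply: shift_escapes => [w|y]; [exact: v_odd|exact: hv].
exists (colour (inflate h) hv'); split.
  split=> //; last exact: colour_RT2.
  by move=> x j; apply: shift_escapes => [w|y]; [exact: u_odd|exact: ha].
have r := colour_RT2 hn' hv'.
suff E : RT2h h (fun z => colour (inflate h) hv' (z *+ 2)) by exact: (RT2_uniq hn hv E hf).
move=> x j.
have r' : RT2on (x *+ 2) (inflate h) (colour (inflate h) hv') by move=> y i _; apply: r.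
have := deflate_RT2on (inflate_inflates hm) r' (x := x) j.
rewrite /deflate !add0r !inflate_even; apply.
by rewrite subr0 /same3 !coordE; lia.
Qed.

(** * Patches that do not see the colour of their centre *)

(** The patches of squared radius b around y1 and y2 have the same black
    markings, and the same colours off the coset of 3P containing the centre. *)
Definition agree (b : int) (h : Qlat -> hexagon) (f : Qlat -> bool) (y1 y2 : Qlat) :=
  (forall z, norm2 z <= b -> h (y1 + z) = h (y2 + z)) /\
  (forall z, ~~ same3 0 z -> norm2 z <= b -> f (y1 + z) = f (y2 + z)).

Lemma norm2_double z : norm2 (z *+ 2) = 4 * norm2 z.
Proof. by rewrite /norm2 c1M c2M; ring. Qed.

(** The parallelogram law at the midpoint of an edge; one of its ends is hardly
    farther away than the midpoint. *)
Lemma norm2_edge w j : 2 * norm2 (w *+ 2 + u j) + 2 = 4 * norm2 w + 4 * norm2 (w + u j).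
Proof. by rewrite /norm2 !coordE; move: j; apply: Z6_ind => /=; ring. Qed.

(** The same across the stripe. *)
Lemma norm2_long w j : 2 * norm2 (w *+ 2 + u j) + 6 = 4 * norm2 (w + u (j + 1)) + 4 * norm2 (w + u (j + 5)).
Proof. by rewrite /norm2 !coordE; move: j; apply: Z6_ind => /=; ring. Qed.

Lemma same3_double w : same3 0 (w *+ 2) = same3 0 w.
Proof. rewrite /same3 !coordE; case: w => m n /=; lia. Qed.

Lemma same3_next w j : same3 0 (u j + w *+ 2) = same3 0 (w + u (j + 1)).
Proof. by case: w => m n; rewrite /same3 !coordE; move: j; apply: Z6_ind => /=; lia. Qed.

Lemma same3_prev w j : same3 0 (u j + w *+ 2) = same3 0 (w + u (j + 5)).
Proof. by case: w => m n; rewrite /same3 !coordE; move: j; apply: Z6_ind => /=; lia. Qed.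

Lemma norm2_le1 z : norm2 z <= 1 -> z = 0 \/ exists j, z = u j.
Proof.
move=> H; have [hm hn] : -1 <= z.1 <= 1 /\ -1 <= z.2 <= 1.
  have := le_norm z.1 z.2; have := le_norm z.2 z.1; have := le_norm (- z.1) (- z.2); have := le_norm (- z.2) (- z.1).
  by move: H; rewrite /norm2; lia.
have E (m n : int) : z.1 = m -> z.2 = n -> z = (m, n) by move=> e1 e2; apply: Qext.
move: H; rewrite /norm2.
have [e1|[e1|e1]] : z.1 = -1 \/ (z.1 = 0 \/ z.1 = 1) by lia.
- have [e2|[e2|e2]] : z.2 = -1 \/ (z.2 = 0 \/ z.2 = 1) by lia.
  + by move=> _; right; exists 4; exact: E.
  + by move=> _; right; exists 3; exact: E.
  + by rewrite e1 e2.
- have [e2|[e2|e2]] : z.2 = -1 \/ (z.2 = 0 \/ z.2 = 1) by lia.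
  + by move=> _; right; exists 5; exact: E.
  + by move=> _; left; exact: E.
  + by move=> _; right; exists 2; exact: E.
- have [e2|[e2|e2]] : z.2 = -1 \/ (z.2 = 0 \/ z.2 = 1) by lia.
  + by rewrite e1 e2.
  + by move=> _; right; exists 0; exact: E.
  + by move=> _; right; exists 1; exact: E.
Qed.

Lemma red_perp_inj s b b' j : perp s j -> red (TSTile s b) j = red (TSTile s b') j -> b = b'.
Proof.
have H : perp s j ==> (red (TSTile s b) j == red (TSTile s b') j) ==> (b == b').
  by rewrite /perp; move: s j; do 2!apply: Z6_ind; case: b; case: b'; vm_compute.
by move=> p e; apply/eqP; move/implyP: H => /(_ p) /implyP; apply; rewrite e.
Qed.

Section Step.
Variables (h : Qlat -> hexagon) (f f' : Qlat -> bool).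
Hypotheses (hm : well_matched h) (hr : RT2h (inflate h) f') (ff : forall z, f' (z *+ 2) = f z).

(** The neighbours of an odd tile across its stripe are even tiles, whose colours
    come from the tiling before inflation. *)
Lemma odd_front y j : red (TSTile (inflate h (y *+ 2 + u j)) (f' (y *+ 2 + u j))) (j + 1) =
  ~~ red (TSTile (h (y + u (j + 1))) (f (y + u (j + 1)))) (j + 4).
Proof.
rewrite hr (_ : y *+ 2 + u j + v (j + 1) = (y + u (j + 1)) *+ 2); last by rewrite /v; qvec.
by rewrite inflate_even ff Z6E.
Qed.

Lemma odd_perp y j : perp (inflate h (y *+ 2 + u j)) (j + 1).
Proof. by rewrite inflate_mid //; case: ifP => _; rewrite /perp !Z6E eqxx ?orbT. Qed.

Lemma odd_back y j : red (TSTile (inflate h (y *+ 2 + u j)) (f' (y *+ 2 + u j))) (j + 1) =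
  red (TSTile (h (y + u (j + 5))) (f (y + u (j + 5)))) (j + 1).
Proof.
have := red_perpP (f' (y *+ 2 + u j)) (odd_perp y j); rewrite Z6E => H.
rewrite -[LHS]negbK -H hr (_ : y *+ 2 + u j + v (j + 4) = (y + u (j + 5)) *+ 2).
  by rewrite inflate_even ff Z6E negbK.
rewrite /v; qvec.
Qed.

(** A tile of the inflated patch is determined by a tile of the patch before
    inflation, at half the distance: the nearer end of its edge for the black
    marking, the nearer neighbour across the stripe for the colour. *)
Lemma agree_inflate b y1 y2 : agree b h f y1 y2 ->
  agree (4 * b) (inflate h) f' (y1 *+ 2) (y2 *+ 2).
Proof.
case=> ah af.
have E (y w : Qlat) : y *+ 2 + w *+ 2 = (y + w) *+ 2 by rewrite mulrnDl.
have O (y w : Qlat) j : y *+ 2 + (u j + w *+ 2) = (y + w) *+ 2 + u j by qvec.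
have O' (y w : Qlat) j : (y + w) *+ 2 + u j = (y + (w + u j)) *+ 2 + u (j + 3) by qvec.
have mid w j : norm2 (u j + w *+ 2) <= 4 * b ->
    inflate h (y1 *+ 2 + (u j + w *+ 2)) = inflate h (y2 *+ 2 + (u j + w *+ 2)).
  move=> nz; have ne := norm2_edge w j; rewrite (addrC _ (u j)) in ne; rewrite !O.
  have [w1|w1] := leP (norm2 w) b; first by rewrite !inflate_mid // ah.
  have w2 : norm2 (w + u j) <= b.
    move: nz ne w1; move: (norm2 _) (norm2 w) (norm2 _) => X A B *; lia.
  by rewrite (O' y1 w j) (O' y2 w j) !inflate_mid // ah.
split=> z.
  case: (parity z) => [[w ->]|[j [w ->]]]; last exact: mid.
  by rewrite norm2_double !E !inflate_even => nz; apply: ah; rewrite -(ler_pM2l (isT : 0 < 4 :> int)).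
case: (parity z) => [[w ->]|[j [w ez]]] n3 nz.
  rewrite !E !ff; apply: af; last by rewrite -(ler_pM2l (isT : 0 < 4 :> int)) -norm2_double.
  by rewrite -same3_double.
rewrite ez in n3 nz *; have em := mid w j nz; rewrite !O in em *.
apply: (red_perp_inj (odd_perp (y1 + w) j)); rewrite {2}em.
have nl := norm2_long w j; rewrite (addrC _ (u j)) in nl.
have c1 : ~~ same3 0 (w + u (j + 1)) by rewrite -same3_next.
have c5 : ~~ same3 0 (w + u (j + 5)) by rewrite -same3_prev.
have [w1|w1] := leP (norm2 (w + u (j + 1))) b.
  by rewrite !odd_front -!addrA ah // af.
have w2 : norm2 (w + u (j + 5)) <= b.
  move: nz nl w1; move: (norm2 _) (norm2 (w + u (j + 1))) (norm2 _) => X A B *; lia.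
by rewrite !odd_back -!addrA ah // af.
Qed.

End Step.

(** After two inflations the neighbours of y have stripes directed towards y, and
    the colours of their perpendicular ends are decided by the black markings
    next to them. *)
Lemma agree_start h f2 y1 y2 : well_matched h -> RT2h (inflate (inflate h)) f2 -> h y1 = h y2 ->
  agree 1 (inflate (inflate h)) f2 (y1 *+ 2 *+ 2) (y2 *+ 2 *+ 2).
Proof.
move=> hm hr ey; have hm1 := inflate_wm hm.
have A1 j : inflate h (y1 *+ 2 + u j) = inflate h (y2 *+ 2 + u j) by rewrite !inflate_mid // ey.
have A2 j : inflate (inflate h) (y1 *+ 2 *+ 2 + u j) = inflate (inflate h) (y2 *+ 2 *+ 2 + u j).
  by rewrite !inflate_mid // !inflate_even ey.
split=> z.
  by case/norm2_le1=> [->|[j ->]] //; rewrite !addr0 !inflate_even.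
move=> n3 /norm2_le1[z0|[j ->]]; first by move: n3; rewrite z0.
apply: (red_perp_inj (odd_perp hm1 (y1 *+ 2) j)); rewrite {2}A2.
rewrite !(odd_front (f := fun z => f2 (z *+ 2)) hr) //; congr negb.
have B y b : red (TSTile (inflate h (y *+ 2 + u (j + 1))) b) (j + 4) = false.
  have S s : (s == j + 1) || (s == j + 4) -> red (TSTile s b) (j + 4) = false.
    by move: s j; do 2!apply: Z6_ind; case: b; vm_compute.
  by apply: S; rewrite inflate_mid //; case: ifP => _; rewrite ?Z6E eqxx ?orbT.
by rewrite !B.
Qed.

Lemma agree_iter h c f K : model h c f -> exists h' c' f', model h' c' f' /\
  (forall z, h' (z *+ 2 ^ K) = h z /\ f' (z *+ 2 ^ K) = f z) /\
  forall b y1 y2, agree b h f y1 y2 -> agree ((4 ^ K)%N%:Z * b) h' f' (y1 *+ 2 ^ K) (y2 *+ 2 ^ K).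
Proof.
move=> md; elim: K => [|K [h' [c' [f' [md' [e' a']]]]]].
  by exists h, c, f; split=> //; split=> [z|b y1 y2]; rewrite !expn0 !mulr1n ?mul1r.
have [f2 [md2 e2]] := model_inflate md'; have hm' : well_matched h' by case: md' => /nest_wm.
exists (inflate h'), (shift c'), f2; split=> //; split=> [z|b y1 y2 ag].
  by rewrite expnSr mulrnA inflate_even e2; exact: e'.
have r2 : RT2h (inflate h') f2 by case: md2.
have := agree_inflate hm' r2 e2 (a' _ _ _ ag).
have -> : (4 ^ K.+1)%N%:Z * b = 4 * ((4 ^ K)%N%:Z * b) by rewrite expnS PoszM mulrA.
by rewrite !expnSr !mulrnA.
Qed.

(** The midpoints of the two halves of an edge of L_2 have the same stripe.  The
    next tiles on the lines through them perpendicular to the edge have diameters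
    of different colours along these lines. *)
Lemma two_points h c f : model h c f -> exists y1 y2, h y1 = h y2 /\ f y1 <> f y2.
Proof.
case=> hn _ _ hr; pose x := c 2%N.
have Lx : level c 2 x by exists 0; rewrite mul0rn addr0.
have Lx1 := levelS hn Lx; set j := h x.
have p1 : h (x + u j) = j by have := nest_line hn j (i := 1) Lx isT; rewrite ccwE.
have p3 : h (x + u j *+ 3) = j by have := nest_line hn j (i := 3) Lx isT; rewrite ccwE.
have q1 : h (x + u j + v (j + 1)) = j + 1 \/ h (x + u j + v (j + 1)) = j + 1 + 3.
  by apply: (nest_class hn Lx); exists 0; rewrite expn1 /v; qvec.
have q3 : h (x + u j *+ 3 + v (j + 1)) = j + 2 \/ h (x + u j *+ 3 + v (j + 1)) = j + 2 + 3.
  by apply: (nest_class hn Lx); exists (u j); rewrite /v; qvec.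
exists (x + u j), (x + u j *+ 3); split; first by rewrite p1 p3.
move=> ef; have := hr (x + u j) (j + 1); have := hr (x + u j *+ 3) (j + 1).
rewrite p1 p3 ef => -> /esym.
have S s s' b b' : (s == j + 1) || (s == j + 1 + 3) -> (s' == j + 2) || (s' == j + 2 + 3) ->
   ~~ red (TSTile s b) (j + 1 + 3) <> ~~ red (TSTile s' b') (j + 1 + 3).
  move=> h1 h2.
  have -> : red (TSTile s b) (j + 1 + 3) = false.
    by move: s j h1 {h2 Lx Lx1 p1 p3 q1 q3 ef}; do 2!apply: Z6_ind; case: b; vm_compute.
  have -> // : red (TSTile s' b') (j + 1 + 3) = true.
  by move: s' j h2 {h1 Lx Lx1 p1 p3 q1 q3 ef}; do 2!apply: Z6_ind; case: b'; vm_compute.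
by apply: S; [case: q1 => ->|case: q3 => ->]; rewrite eqxx ?orbT.
Qed.

(** * The theorem *)

Section Nonlocal.
Variables (R : realType) (eps : R).
Hypothesis heps : 0 < eps < (2 * Num.sqrt 3)^-1.

Lemma model_nonsingular h c f : model h c f -> nonsingular_ts eps (fun x => TSTile (h x) (f x)).
Proof.
case=> hn ha hv hr; have hm := nest_wm hn.
have hc := nest_corners_close hn (lattice_lines_points_escape ha).
have he := lattice_lines_stripes_end hn ha.
split; [exact/(RT1_wm heps)|exact/RT2_RT2h|split; first exact: corners_close_N1].
by apply/(N2_w_lines_escape (level_verticesE heps hn hc he)).
Qed.

(** A rule of radius r fails on the two centres after enough inflations. *)
Lemma nonlocal : ~ (exists (r : R) (rule : tiling dhex -> ts_tile), 0 < r /\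
  forall (c : Qlat) (D : tiling dhex) (S : Qlat -> ts_tile),
    nonsingular_penrose eps c D -> nonsingular_ts eps S -> small_hexagons D (fun x => black (S x)) ->
    forall y : Qlat, S y = rule (patch r D y)).
Proof.
case=> r [rule [r0 H]].
have [h [c [f md]]] := model_exists; have [y1 [y2 [eh nf]]] := two_points md.
have [f1 [md1 e1]] := model_inflate md; have [f2 [md2 e2]] := model_inflate md1.
have hm : well_matched h by case: md => /nest_wm.
have r2 : RT2h (inflate (inflate h)) f2 by case: md2.
(* the squared radius of agreement after K + 2 inflations is 4^K > r^2 *)
pose K := (Num.truncn (r ^+ 2)).+1.
have [h' [c' [f' [md' [e' ag]]]]] := agree_iter K md2.
have := ag _ _ _ (agree_start hm r2 eh); rewrite mulr1.
set Y1 := y1 *+ 2 *+ 2 *+ 2 ^ K; set Y2 := y2 *+ 2 *+ 2 *+ 2 ^ K => -[ah af].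
set S := fun x => TSTile (h' x) (f' x).
have nS : nonsingular_ts eps S := model_nonsingular md'.
have T Y : S Y = rule (patch r (decorate (Y + u 0) S) Y).
  by have [np sm] := ts_decorate heps (Y + u 0) nS; exact: H np nS sm Y.
have : S Y1 = S Y2.
  rewrite T [RHS]T; congr rule; apply: funext => z; rewrite /patch; case: ifP => // hz.
  have E Y : same3 (Y + u 0) (Y + z) = same3 (u 0) z.
    by rewrite /same3 !coordE; apply/idP/idP; lia.
  rewrite /decorate !E; case: ifP => // s3.
  have n3 : ~~ same3 0 z by move: s3; rewrite /same3 /=; lia.
  have nz : norm2 z <= (4 ^ K)%N.
    have K0 : r ^+ 2 < (4 ^ K)%N%:R.
      apply: lt_trans (truncnS_gt _) _; rewrite ltr_nat; exact: ltn_expl.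
    move: hz; rewrite /dist subr0.
    rewrite dot_norm2 => hz; rewrite -(ler_int R); apply: le_trans (ltW K0).
    have n0 : 0 <= (norm2 z)%:~R :> R by rewrite -dot_norm2 /dot -!expr2 addr_ge0 ?sqr_ge0.
    by rewrite -(sqr_sqrtr n0) ler_pXn2r // ?nnegrE ?sqrtr_ge0 // ltW.
  by rewrite /S ah // af.
move=> /(congr1 towards_red) /=.
have F y : f' (y *+ 2 *+ 2 *+ 2 ^ K) = f y by rewrite (proj2 (e' _)) e2 e1.
by rewrite !F.
Qed.
End Nonlocal.

Theorem theorem7p1 (R : realType) (eps : R)
    (heps : 0 < eps < (2 * Num.sqrt 3)^-1) :
  (* (i) *)
  ((forall S : Qlat -> ts_tile, nonsingular_ts eps S -> aperiodic R (full_tiling S)) /\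
   (forall (c : Qlat) (D : tiling dhex),
      nonsingular_penrose eps c D -> aperiodic R D)) /\
  (* (ii) *)
  (exists (r : R) (rule : tiling ts_tile -> dhex), 0 < r /\
     forall S : Qlat -> ts_tile, nonsingular_ts eps S ->
     exists D : Qlat -> tiling dhex,
       (forall c : Qlat,
          [/\ nonsingular_penrose eps c (D c),
              small_hexagons (D c) (fun x => black (S x))
            & forall x, coset3P c x ->
                D c x = Some (rule (patch r (full_tiling S) x))]) /\
       (forall c c' : Qlat, D c = D c' <-> coset3P c c')) /\
  (* (iii) *)
  ((forall (c : Qlat) (D : tiling dhex), nonsingular_penrose eps c D ->
      (forall h : Qlat -> hexagon, small_hexagons D h ->
         exists! q : nat -> set Qlat,
           inv_lim_Q q /\ forall k, level_vertices eps h k = q k) /\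
      (exists! S : Qlat -> ts_tile,
         nonsingular_ts eps S /\ small_hexagons D (fun x => black (S x)))) /\
   ~ (exists (r : R) (rule : tiling dhex -> ts_tile), 0 < r /\
        forall (c : Qlat) (D : tiling dhex) (S : Qlat -> ts_tile),
          nonsingular_penrose eps c D ->
          nonsingular_ts eps S -> small_hexagons D (fun x => black (S x)) ->
          forall y : Qlat, S y = rule (patch r D y))).
Proof.
split; last split.
- by split=> [S|c D]; [exact: ts_aperiodic|exact: penrose_aperiodic].
- exists 1, (fun p => if p 0 is Some t then dtile t else DHex 0 0); split; first exact: ltr01.
  move=> S hS; exists (fun c => decorate c S); split; last by move=> c c'; have := decorate_eq S c c'.
  move=> c; have [np sm] := ts_decorate heps c hS; split=> // x /same3P s3.
  rewrite /decorate s3 /patch (_ : dist _ _ <= 1) /full_tiling ?addr0 //.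
  rewrite /dist (_ : pos R 0 = 0) ?subrr; last by rewrite /pos !scale0r addr0.
  by rewrite /dot /= mul0r addr0 sqrtr0 ler01.
- split; last exact: nonlocal.
  by move=> c D hp; split=> [h sm|]; [exact: (penrose_levels heps hp sm)|exact: (penrose_ts heps hp)].
Qed.
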